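(* Let $M_d(n)$ denote the number of $(d+1)$-colourful graphs $G$ on the vertex set $[1..n]$ such that $|X(G)|$ is a $d$-manifold. For every fixed $d\geq 3$ with $d\neq 4$, $$ n^{\frac{n}{2d}} \preceq \frac{1}{n!}M_d(n) \preceq n^{\left(\frac{1}{6}+(d-3)\frac{3}{20}\right)n},$$ and for $d=4$, $$ n^{\frac{n}{8}} \preceq \frac{1}{n!}M_4(n) \preceq n^{\frac{n}{3}}.$$
   Context: For $d\geq 1$ and $n$ even, a $(d+1)$-colourful graph of order $n$ is a bipartite $(d+1)$-regular multigraph on the vertex set $[1..n]$ whose edges are coloured with colours in $[1..d+1]$ so that each vertex is incident to exactly one edge of each colour. Given such $G$, the cell complex $X(G)$ is built as follows: to each vertex $v$ of $G$ associate a $d$-simplex whose vertices are coloured $1,\dots,d+1$; for each edge $\{u,v\}$ of colour $i$, glue the facet of the simplex of $u$ whose vertices are coloured $[1..d+1]\setminus\{i\}$ to the corresponding facet of the simplex of $v$ by the unique isometry preserving vertex colours. $|X(G)|$ is the resulting topological space (it is orientable since $G$ is bipartite). A manifold means a compact topological manifold without boundary. For sequences $f,g$: $f(n)\preceq g(n)$ means there exists $K>0$ such that $f(n)\leq K^n g(n)$ for all $n$ large enough. Here $d$ is fixed and $n\to\infty$ through even values. *)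

(* Defs.v *)
From HB Require Import structures.
From mathcomp Require Import all_boot all_order all_algebra all_fingroup.
From mathcomp Require Import generic_quotient.
From mathcomp Require Import all_classical all_reals all_analysis.
From mathcomp Require Import Rstruct Rstruct_topology.

Set Implicit Arguments.
Unset Strict Implicit.
Unset Printing Implicit Defensive.

Import Order.TTheory GRing.Theory Num.Theory.
Local Open Scope classical_set_scope.
Local Open Scope ring_scope.

Notation R := Rdefinitions.R.

(** A (d+1)-colourful graph on [1..n] (vertices 'I_n, colours 'I_(d.+1)) is
    recorded as the family of its colour classes: for each colour i, the
    colour-i edges form a perfect matching, i.e. a fixed-point-free involution
    [G i] of the vertex set (u -- v has colour i iff G i u = v).  Bipartiteness:
    there is a 2-colouring of the vertices that every edge respects. *)
Definition colgraph (d n : nat) := {ffun 'I_d.+1 -> {perm 'I_n}}.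

Definition colourful (d n : nat) (G : colgraph d n) : bool :=
  [forall i, forall v, (G i (G i v) == v) && (G i v != v)] &&
  [exists side : {ffun 'I_n -> bool}, forall i, forall v, side (G i v) != side v].

(** The standard d-std_simplex in R^(d+1), vertex j (= j-th basis vector) having
    colour j; the facet opposite colour i is {t | t_i = 0}. *)
Definition std_simplex (d : nat) : set 'rV[R]_(d.+1) :=
  [set t | (forall j, 0 <= t ord0 j) /\ \sum_j t ord0 j = 1].
Arguments std_simplex : clear implicits.

Definition cells (d n : nat) : Type :=
  (discrete_topology 'I_n * classical_sets.set_type (std_simplex d))%type.

(** Two points of the disjoint union are glued iff they have the same
    barycentric coordinates t and their vertices are joined by a path using
    only colours i with t_i = 0 (the equivalence relation generated by the
    colour-preserving facet identifications). *)
Definition glue_adj (d n : nat) (G : colgraph d n) (t : 'rV[R]_(d.+1)) : rel 'I_n :=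
  fun u v => [exists i, (t ord0 i == 0) && ((G i u == v) || (G i v == u))].

Definition glue (d n : nat) (G : colgraph d n) (p q : cells d n) : bool :=
  (set_val p.2 == set_val q.2) && connect (glue_adj G (set_val p.2)) p.1 q.1.

Lemma glue_adj_sym (d n : nat) (G : colgraph d n) t : symmetric (glue_adj G t).
Proof.
move=> u v; apply/existsP/existsP => -[i /andP[ti e]]; exists i;
  by rewrite ti orbC.
Qed.

Lemma glue_refl (d n : nat) (G : colgraph d n) : reflexive (@glue d n G).
Proof. by move=> p; rewrite /glue eqxx connect0. Qed.

Lemma glue_sym (d n : nat) (G : colgraph d n) : symmetric (@glue d n G).
Proof.
move=> p q; rewrite /glue eq_sym; case: eqP => //= e.
by rewrite e (sym_connect_sym (glue_adj_sym G _)).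
Qed.

Lemma glue_trans (d n : nat) (G : colgraph d n) : transitive (@glue d n G).
Proof.
move=> q p r /andP[/eqP e1 c1] /andP[/eqP e2 c2].
rewrite /glue e1 e2 eqxx /=; rewrite e1 e2 in c1; rewrite e2 in c2.
exact: connect_trans c1 c2.
Qed.

Definition glue_rel (d n : nat) (G : colgraph d n) : equiv_rel (cells d n) :=
  EquivRel (@glue d n G) (@glue_refl d n G) (@glue_sym d n G) (@glue_trans d n G).

Definition XG (d n : nat) (G : colgraph d n) : topologicalType :=
  quotient_topology {eq_quot (glue_rel G)}%qT.

(** A compact topological d-manifold without boundary: compact, Hausdorff,
    and every point has an open neighbourhood homeomorphic to an open subset
    of R^d. (Second countability follows from compactness + local charts.) *)
Definition is_manifold (X : topologicalType) (k : nat) : Prop :=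
  compact [set: X] /\ hausdorff_space X /\
    (forall x : X, exists (U : set X) (V : set 'rV[R]_k)
      (f : X -> 'rV[R]_k) (g : 'rV[R]_k -> X),
      open U /\ U x /\ open V /\
      {within U, continuous f} /\ {within V, continuous g} /\
      (forall y, U y -> V (f y) /\ g (f y) = y) /\
      (forall z, V z -> U (g z) /\ f (g z) = z)).

Definition M (d n : nat) : nat :=
  #|[set G : colgraph d n | colourful G && `[< is_manifold (XG G) d >]]|.

Definition preceq (f g : nat -> R) : Prop :=
  exists K : R, 0 < K /\ exists N : nat,
    forall n : nat, (N <= n)%N -> ~~ odd n -> f n <= K ^+ n * g n.

(* Main.v *)
(** Upper bound.  If |X(G)| is a manifold, then for every set S of at most d
    colours the numbers c_J of J-coloured components satisfy
    sum_(J subset S) (-1)^|J| c_J = c_S.  To see this locally, reflect the chart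
    around an interior point of a face in the transverse directions: one gets a
    cone over cubes in R^d, and a Sperner-type argument (a perturbed copy of the
    cone can be made to miss its apex, and rainbow simplices are counted modulo
    2) shows that the complex of its faces is exact in positive degrees, which
    forces the alternating sum of its ranks to be 1.  A colour class is coded by
    a permutation, and a pair of permutations whose product has few handles is
    coded by little more than its cycle counts, so the relations for small S,
    averaged over the orderings of the colours, bound the number of graphs.

    Lower bound.  Take a path whose edges are coloured periodically by d colours
    and use the last colour to plug every d-th node into an arbitrary earlier
    one.  After deleting any colour the components are trees, so in the double
    of this graph every vertex star collapses leaf by leaf onto the double of a
    single orthant, which is R^d.  Hence the double is a manifold, and there are
    about (n/2d)! such plugged paths. *)
From HB Require Import structures.
From mathcomp Require Import all_boot all_order all_algebra all_fingroup.
From mathcomp Require Import zify ring lra.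

Set Implicit Arguments.
Unset Strict Implicit.
Unset Printing Implicit Defensive.

Import Order.TTheory GRing.Theory Num.Theory.
Local Open Scope ring_scope.

(** * Components of coloured graphs and grid chains *)

(** The charts are only continuous, so no link, triangulation or homology theory is used. The
    complex has the faces around a point as cells, graded by codimension, and computes over F_2 the
    homology relative to the complement of that point; its one class, in codimension 0, is the 1 of
    every relation. Continuity meets combinatorics in a single place: an interpolation of the chart
    is Lipschitz, and can therefore be moved off the apex. Origin of the exponents: let y_k be the
    average number of components over the sets of k colours. One colour gives y_1 = n/2, two and
    four give nothing new, three give 6 y_2 = n + 4 y_3, the planarity behind the coding. The
    averaged cost exponent of the coding is then (d+4) n/6 - (d+1) y_3/3. A lower bound on y_3,
    namely n/20, needs five colours and hence d >= 5; d = 4 must do with y_3 >= 0, which explains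
    its separate exponent. Dividing by n! subtracts n. Lower bound: the path has n/2 nodes, so there
    are about n/(2d) plugs, and d >= 3 provides two new targets per period, one more than each plug
    consumes. *)

Section Orbits.
Variables (V I : finType) (g : I -> V -> V).
Hypothesis gK : forall i, involutive (g i).
Implicit Types (T : {set I}) (u v w : V).

(** The generators are arbitrary involutions: the same theory serves the coloured graph, its
    reflected version, and the restricted and mirrored involutions of the tree charts. *)
Definition adj (T : {set I}) : rel V := fun u v => [exists i in T, g i u == v].

Definition orb (T : {set I}) (v : V) : {set V} := [set w | connect (adj T) v w].

Lemma orb_refl T v : v \in orb T v.
Proof. by rewrite inE connect0. Qed.

Lemma adj_sym T : symmetric (adj T).
Proof.
move=> u v; apply/existsP/existsP => -[i /andP[iT /eqP e]]; exists i;
  by rewrite iT /= -e gK.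
Qed.

Lemma orb_sym T v w : (w \in orb T v) = (v \in orb T w).
Proof. by rewrite !inE (sym_connect_sym (adj_sym T)). Qed.

Lemma orb_trans T u v w : v \in orb T u -> w \in orb T v -> w \in orb T u.
Proof. by rewrite !inE; apply: connect_trans. Qed.

Lemma orb_step (T : {set I}) i v : i \in T -> g i v \in orb T v.
Proof. by move=> iT; rewrite inE connect1//; apply/existsP; exists i; rewrite iT /=. Qed.

Lemma orb_ind T v w (P : V -> Prop) :
  (forall i u, i \in T -> P u -> P (g i u)) -> P v -> w \in orb T v -> P w.
Proof.
move=> H Pv; rewrite inE => /connectP[p pth ->].
elim: p v Pv pth => //= x p IH v Pv /andP[/existsP[i /andP[iT /eqP e]] pth].
by apply: IH pth; rewrite -e; apply: H.
Qed.

Lemma orb_sub (T T' : {set I}) v : T \subset T' -> orb T v \subset orb T' v.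
Proof.
move=> /subsetP sT; apply/subsetP => w.
apply: (@orb_ind _ _ _ (fun w => w \in orb T' v)); last exact: orb_refl.
by move=> i u iT uo; apply: orb_trans uo (orb_step _ (sT _ iT)).
Qed.

Lemma orb_eq T v w : (orb T v == orb T w) = (w \in orb T v).
Proof.
apply/eqP/idP => [->|h]; first exact: orb_refl.
apply/setP => x; apply/idP/idP => hx; last exact: orb_trans h hx.
by apply: orb_trans hx; rewrite orb_sym.
Qed.

Lemma orb_eqP T v w : w \in orb T v -> orb T w = orb T v.
Proof. by rewrite -orb_eq => /eqP. Qed.

Lemma orb_fun_inv (A : Type) (f : V -> A) T v w :
  (forall i u, i \in T -> f (g i u) = f u) -> w \in orb T v -> f w = f v.
Proof.
by move=> H; apply: (@orb_ind _ _ _ (fun w => f w = f v)) => // i u iT <-; apply: H.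
Qed.

Definition ncomp (T : {set I}) (C : {set V}) : nat := #|[set orb T v | v in C]|.

End Orbits.

(** Sending a value of one map to the value of the other at a common preimage is onto, in both
    directions. Components can thus be counted through any invariant that separates them. *)
Lemma card_imset_eq (V W1 W2 : finType) (f1 : V -> W1) (f2 : V -> W2) (C : {set V}) :
  {in C &, forall x y, (f1 x == f1 y) = (f2 x == f2 y)} ->
  #|[set f1 x | x in C]| = #|[set f2 x | x in C]|.
Proof.
move=> H.
have [->|[x0 x0C]] := set_0Vmem C; first by rewrite !imset0 !cards0.
have le (A B : finType) (h1 : V -> A) (h2 : V -> B) :
    {in C &, forall x y, (h1 x == h1 y) = (h2 x == h2 y)} ->
    (#|[set h1 x | x in C]| <= #|[set h2 x | x in C]|)%N.
  move=> Hh.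
  pose k y := h1 (odflt x0 [pick x in C | h2 x == y]).
  rewrite (_ : [set h1 x | x in C] = k @: [set h2 x | x in C]); first exact: leq_imset_card.
  rewrite -imset_comp; apply: eq_in_imset => x xC /=; rewrite /k.
  case: pickP => [x' /andP[x'C /eqP e]|/(_ x)]; last by rewrite xC eqxx.
  by apply/eqP; rewrite Hh // e.
by apply/eqP; rewrite eqn_leq !le // => x y xC yC; rewrite H.
Qed.

Lemma char2 (x : 'F_2) : x + x = 0.
Proof. by rewrite -mulr2n; apply/val_inj; case: x => -[|[|]]. Qed.

Lemma F2_eq0 (b : bool) : (b%:R == 0 :> 'F_2) = ~~ b.
Proof. by case: b. Qed.

(** Each unordered pair occurs twice. This one cancellation is behind the vanishing of a double
    boundary and behind the cancellation of the inner faces of a cube. *)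
Lemma sum_sym_char2 (J : finType) (A : {set J}) (f : J -> J -> 'F_2) :
  (forall i j, f i j = f j i) ->
  \sum_(i in A) \sum_(j in A :\ i) f i j = 0.
Proof.
move=> fs.
rewrite (eq_bigr (fun i => \sum_(j in A | j != i) f i j)); last first.
  by move=> i _; apply: eq_bigl => j; rewrite !inE andbC.
rewrite pair_big_dep /=.
rewrite (bigID (fun p : J * J => (enum_rank p.1 < enum_rank p.2)%N)) /=.
rewrite [X in _ + X](reindex_inj (h := fun p : J * J => (p.2, p.1))) /=; last first.
  by move=> [a b] [c e] [-> ->].
rewrite (eq_bigl (fun p : J * J => [&& p.1 \in A, (p.2 \in A) && (p.2 != p.1)
   & (enum_rank p.1 < enum_rank p.2)%N])); last first.
  by move=> [a b] /=; rewrite -!andbA.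
rewrite [X in _ + X](eq_bigl (fun p : J * J => [&& p.1 \in A, (p.2 \in A) && (p.2 != p.1)
   & (enum_rank p.1 < enum_rank p.2)%N])); last first.
  move=> [a b] /=; rewrite -leqNgt leq_eqVlt.
  rewrite (inj_eq val_inj) (inj_eq enum_rank_inj) [b == a]eq_sym.
  by case: (altP (a =P b)) => [->|_]; case: (a \in A); case: (b \in A) => //=; rewrite ?andbF.
rewrite -big_split /= big1 // => -[a b] _ /=; by rewrite [f b a]fs char2.
Qed.

(* Grid chains: [chains k A p phi] sums phi over all increasing chains of k+1
   grid points that start at p and increment each coordinate of A once. *)
Section Grid.
Variable J : finType.
Implicit Types (A : {set J}) (p q : {ffun J -> nat}).
Local Notation grid := {ffun J -> nat}.

Definition incr p i : grid := [ffun j => p j + (j == i)]%N.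

Fixpoint chains (k : nat) A p (phi : seq grid -> 'F_2) : 'F_2 :=
  if k is k'.+1 then \sum_(i in A) chains k' (A :\ i) (incr p i) (fun l => phi (p :: l))
  else phi [:: p].

(** The simplicial coboundary modulo 2: [phi] is summed over the lists with one entry deleted, and
    no signs are needed. *)
Fixpoint delta (phi : seq grid -> 'F_2) (l : seq grid) : 'F_2 :=
  if l is x :: l' then phi l' + delta (fun m => phi (x :: m)) l' else 0.

Lemma incrC p i j : incr (incr p i) j = incr (incr p j) i.
Proof. by apply/ffunP => x; rewrite !ffunE addnAC. Qed.

Lemma eq_chains k A p phi psi : phi =1 psi -> chains k A p phi = chains k A p psi.
Proof.
elim: k A p phi psi => [|k IH] A p phi psi H /=; first exact: H.
by apply: eq_bigr => i _; apply: IH => l; apply: H.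
Qed.

Lemma chainsD k A p phi psi :
  chains k A p (fun l => phi l + psi l) = chains k A p phi + chains k A p psi.
Proof.
elim: k A p phi psi => [|k IH] A p phi psi //=.
by rewrite -big_split; apply: eq_bigr => i _; rewrite IH.
Qed.

Lemma chains0 k A p : chains k A p (fun=> 0) = 0.
Proof. by elim: k A p => [|k IH] A p //=; rewrite big1. Qed.

Lemma chains_sum (X : Type) (r : seq X) (P : pred X) k A p (phi : X -> seq grid -> 'F_2) :
  chains k A p (fun l => \sum_(x <- r | P x) phi x l) =
  \sum_(x <- r | P x) chains k A p (phi x).
Proof.
elim: r => [|x r IH].
  by rewrite big_nil; under eq_chains do rewrite big_nil; rewrite chains0.
rewrite big_cons; under eq_chains do rewrite big_cons.
by case: (P x); rewrite ?chainsD IH.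
Qed.

Lemma chainsZ c k A p phi : chains k A p (fun l => c * phi l) = c * chains k A p phi.
Proof.
elim: k A p phi => [|k IH] A p phi //=.
by rewrite big_distrr /=; apply: eq_bigr => i _; rewrite IH.
Qed.

Definition in_cube p A q := [forall j, (p j <= q j)%N && (q j <= p j + (j \in A))%N].

Lemma in_cube_refl p A : in_cube p A p.
Proof. by apply/forallP => j; rewrite leqnn leq_addr. Qed.

Lemma in_cube_incr p A i q : i \in A -> in_cube (incr p i) (A :\ i) q -> in_cube p A q.
Proof.
move=> iA /forallP H; apply/forallP => j; have := H j; rewrite !inE !ffunE.
case: (altP (j =P i)) => [->|_] /=; rewrite ?iA ?addn0 //.
by move=> /andP[h1 h2]; rewrite h2 andbT (leq_trans _ h1) // leq_addr.
Qed.

Lemma eq_chains_in k A p phi psi : #|A| = k ->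
  (forall l, size l = k.+1 -> all (in_cube p A) l -> phi l = psi l) ->
  chains k A p phi = chains k A p psi.
Proof.
elim: k A p phi psi => [|k IH] A p phi psi cA H /=.
  by apply: H => //=; rewrite in_cube_refl.
apply: eq_bigr => i iA; apply: IH => [|l sl al].
  by apply/eqP; rewrite -eqSS -cA (cardsD1 i A) iA.
apply: H; rewrite /= ?sl // in_cube_refl /=.
by apply: sub_all al => q; apply: in_cube_incr.
Qed.

Lemma card_rem k A i : #|A| = k.+1 -> i \in A -> #|A :\ i| = k.
Proof. by move=> cA iA; apply/eqP; rewrite -eqSS -cA (cardsD1 i A) iA. Qed.

(* The inner faces of the chains cancel in pairs, since the two orders of a
   pair of consecutive increments share them. *)
Lemma chains_delta k A p phi : #|A| = k.+1 ->
  chains k.+1 A p (delta phi) =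
  \sum_(i in A) (chains k (A :\ i) (incr p i) phi + chains k (A :\ i) p phi).
Proof.
elim: k A p phi => [|k IH] A p phi cA.
  by apply: eq_bigr => i _ /=; rewrite addr0 addrC addrC.
rewrite -[LHS]/(\sum_(i in A) chains k.+1 (A :\ i) (incr p i)
  (fun l => phi l + delta (fun m => phi (p :: m)) l)).
rewrite (eq_bigr (fun i => chains k.+1 (A :\ i) (incr p i) phi +
   \sum_(j in A :\ i) (chains k (A :\ i :\ j) (incr (incr p i) j) (fun l => phi (p :: l)) +
      chains k (A :\ i :\ j) (incr p i) (fun l => phi (p :: l))))); last first.
  by move=> i iA; rewrite -IH ?chainsD //; exact: card_rem.
rewrite 2!big_split /=; congr (_ + _).
under eq_bigr do rewrite big_split /=.
rewrite big_split /= sum_sym_char2 ?add0r; last first.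
  by move=> i j; rewrite incrC setDDl setUC -setDDl.
rewrite (exchange_big_dep (mem A)) /=; last by move=> i j _; rewrite !inE => /andP[].
apply: eq_bigr => j jA; apply: eq_big => [i|i].
  by rewrite !inE jA andbT eq_sym andbC.
by move=> _; rewrite setDDl setUC -setDDl.
Qed.

End Grid.

(** * Exactness and the Euler relation *)

Lemma mem_lkerP (K : fieldType) (aT rT : vectType K) (f : 'Hom(aT, rT)) v :
  reflect (f v = 0) (v \in lker f).
Proof. by rewrite memv_ker; exact: eqP. Qed.

Section Exactness.
Variables (V I : finType) (g : I -> V -> V).
Hypothesis gK : forall i, involutive (g i).
Hypothesis g_neq : forall i v, g i v != v.
Variable v0 : V.
Implicit Types (T : {set I}) (u v : V).

Let C := orb g setT v0.

Lemma orb_closed T u v : u \in orb g T v -> (u \in C) = (v \in C).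
Proof.
move=> uv; apply/idP/idP => h; apply: (orb_trans h).
  by rewrite (orb_sym gK) in uv; apply: subsetP (orb_sub g _ (subsetT T)) _ uv.
exact: subsetP (orb_sub g _ (subsetT T)) _ uv.
Qed.

(** A component for [T] is a disjoint union of components for the smaller set. *)
Lemma sum_suborb T T' (y : V -> 'F_2) v : T' \subset T ->
  (forall u, u \in orb g T v -> \sum_(w in orb g T' u) y w = 0) ->
  \sum_(w in orb g T v) y w = 0.
Proof.
move=> sT H.
rewrite (partition_big (orb g T') (fun K => K \in orb g T' @: orb g T v)) /=; last first.
  by move=> w wT; apply/imsetP; exists w.
rewrite big1 // => K /imsetP[u uT ->].
rewrite -[RHS](H u uT); apply: eq_bigl => w; rewrite (orb_eq gK) [u \in _](orb_sym gK).
apply: andb_idl => wu; apply: (orb_trans uT).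
exact: subsetP (orb_sub g _ sT) _ wu.
Qed.

Lemma orb0 v : orb g set0 v = [set v].
Proof.
apply/setP => w; apply/idP/idP => [|]; last by rewrite inE => /eqP ->; exact: orb_refl.
apply: (@orb_ind _ _ _ _ _ _ (fun w => w \in [set v])); last by rewrite inE.
by move=> i u /[!inE].
Qed.

Lemma orb1 i v : orb g [set i] v = [set v; g i v].
Proof.
apply/setP => w; apply/idP/idP => [|].
  apply: (@orb_ind _ _ _ _ _ _ (fun w => w \in [set v; g i v])); last by rewrite !inE eqxx.
  by move=> k u /set1P ->; rewrite !inE => /orP[]/eqP ->; rewrite ?gK eqxx ?orbT.
rewrite !inE => /orP[]/eqP ->; first by rewrite connect0.
by have := @orb_step _ _ g [set i] i v (set11 i); rewrite inE.
Qed.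

(** Degree [j] has as basis the pairs of a [j]-set [T] and a [T]-component inside [C]; adding a
    colour merges components, and this is the boundary map. A chain is given as a function on
    vertices, its value at a component being the sum over it, which avoids quotient spaces. *)
Definition exact_at (j : nat) := forall z : {set I} -> V -> 'F_2,
  (forall T v, #|T| = j.+1 -> v \in C ->
     \sum_(i in T) \sum_(u in orb g T v) z (T :\ i) u = 0) ->
  exists w : {set I} -> V -> 'F_2, forall T v, #|T| = j -> v \in C ->
     \sum_(i in T) \sum_(u in orb g T v) w (T :\ i) u = \sum_(u in orb g T v) z T u.

Local Notation F := ('F_2)^o.
Local Notation L := {ffun {set I} * V -> F}.

Section Maps.
Variable j : nat.

(** [evA] reads off the values on the components of degree [j], and [evB] is the boundary followed
    by that reading in degree [j.+1]. Both are endomorphisms of one space, so that their ranks can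
    be compared. *)
Definition evA (z : L) : L :=
  [ffun x : {set I} * V => if (#|x.1| == j) && (x.2 \in C) then \sum_(u in orb g x.1 x.2) z (x.1, u) else 0].

Definition evB (z : L) : L :=
  [ffun x : {set I} * V => if (#|x.1| == j.+1) && (x.2 \in C)
             then \sum_(i in x.1) \sum_(u in orb g x.1 x.2) z (x.1 :\ i, u) else 0].

Lemma evA_linear : linear evA.
Proof.
move=> a z1 z2; apply/ffunP => x; rewrite !ffunE; case: ifP => _; last by rewrite scaler0 addr0.
by rewrite scaler_sumr -big_split; apply: eq_bigr => u _; rewrite !ffunE.
Qed.

Lemma evB_linear : linear evB.
Proof.
move=> a z1 z2; apply/ffunP => x; rewrite !ffunE; case: ifP => _; last by rewrite scaler0 addr0.
rewrite scaler_sumr -big_split; apply: eq_bigr => i _.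
by rewrite scaler_sumr -big_split; apply: eq_bigr => u _; rewrite !ffunE.
Qed.

HB.instance Definition _ := GRing.isLinear.Build 'F_2 L L *:%R evA evA_linear.
HB.instance Definition _ := GRing.isLinear.Build 'F_2 L L *:%R evB evB_linear.

Definition lA : 'Hom(L, L) := linfun evA.
Definition lB : 'Hom(L, L) := linfun evB.

Definition cellP (c : {set I} * {set V}) := (#|c.1| == j) && (c.2 \in [set orb g c.1 v | v in C]).
Local Notation E := {ffun {c | cellP c} -> F}.

Definition ind (e : E) : L := [ffun x : {set I} * V => oapp e 0 (insub (x.1, orb g x.1 x.2))].

Lemma ind_linear : linear ind.
Proof.
move=> a z1 z2; apply/ffunP => x; rewrite !ffunE; case: insubP => [c _ _|_] /=.
  by rewrite !ffunE.
by rewrite scaler0 addr0.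
Qed.

HB.instance Definition _ := GRing.isLinear.Build 'F_2 E L *:%R ind ind_linear.
Definition lInd : 'Hom(E, L) := linfun ind.

Lemma cellPE T v : cellP (T, orb g T v) = (#|T| == j) && (v \in C).
Proof.
rewrite /cellP /=; congr (_ && _); apply/imsetP/idP => [[u uC e]|vC]; last by exists v.
by rewrite -(@orb_closed T u v) // e orb_refl.
Qed.

Lemma lInd_ker : lker lInd == 0%VS.
Proof.
apply/lker0P => e1 e2; rewrite !lfunE /= => /ffunP H; apply/ffunP => -[[T K] cP].
have /andP[/= cT /imsetP[v vC KE]] := cP.
have := H (T, v); rewrite !ffunE /= -KE; case: insubP => [c _ ce|]; last by rewrite cP.
by rewrite (_ : c = Sub (T, K) cP) //; apply/val_inj.
Qed.

(** A function constant on components is the evaluation of its restriction to one chosen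
    representative of each component. *)
Lemma limg_lA : limg lA = limg lInd.
Proof.
apply/eqP; rewrite eqEsubv; apply/andP; split; apply/subvP => _ /memv_imgP[z _ ->].
  have -> : lA z = lInd [ffun c : {c | cellP c} => \sum_(u in (val c).2) z ((val c).1, u)].
    apply/ffunP => -[T v]; rewrite !lfunE /= !ffunE /=.
    case: insubP => [c + ce|]; rewrite cellPE => h; last by rewrite (negbTE h).
    by rewrite h /= ffunE ce.
  exact: memv_img (memvf _).
pose rep T u := odflt u [pick w in orb g T u].
have -> : lInd z = lA [ffun x : {set I} * V => if x.2 == rep x.1 x.2 then ind z x else 0].
  apply/ffunP => -[T v]; rewrite !lfunE /= [in LHS]ffunE [in RHS]ffunE /=.
  case: insubP => [c + ce|]; rewrite cellPE => h; last by rewrite (negbTE h).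
  rewrite h /=.
  have rv : rep T v \in orb g T v.
    by rewrite /rep; case: pickP => // _; exact: orb_refl.
  rewrite (bigD1 (rep T v)) //= big1 ?addr0 => [|u /andP[uv ur]]; rewrite ffunE /=.
    have -> : rep T (rep T v) = rep T v.
      by rewrite {1}/rep (orb_eqP gK rv) /rep; case: [pick w in _].
    rewrite eqxx ffunE /= (orb_eqP gK rv); case: insubP => [c' _ ce'|] /=.
      by congr (z _); apply/val_inj; rewrite ce ce'.
    by rewrite cellPE h.
  rewrite (_ : rep T u = rep T v); first by rewrite (negbTE ur).
  rewrite /rep (orb_eqP gK uv); case: pickP => // H.
  by move: (H v) => /negbT/negP[]; exact: orb_refl.
exact: memv_img (memvf _).
Qed.

Lemma rank_lA : \dim (limg lA) = (\sum_(T : {set I} | #|T| == j) ncomp g T C)%N.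
Proof.
rewrite limg_lA limg_dim_eq ?(eqP lInd_ker) ?capv0 // dimvf.
rewrite -[LHS]/(#|{: {c | cellP c}}| * 1)%N muln1 card_sig.
rewrite -sum1_card (eq_bigl (fun c : {set I} * {set V} =>
   (#|c.1| == j) && (c.2 \in [set orb g c.1 v | v in C]))) //.
rewrite -(pair_big_dep (fun T : {set I} => #|T| == j)
  (fun T K => K \in [set orb g T v | v in C]) (fun _ _ => 1%N)) /=.
by apply: eq_bigr => T _; rewrite sum1_card.
Qed.

(** The boundary depends only on the component sums, since a component for [T] is made of components
    for [T :\ i]. *)
Lemma ker_sub : (lker lA <= lker lB)%VS.
Proof.
apply/subvP => z /(mem_lkerP lA) zA; apply/(mem_lkerP lB)/ffunP => -[T v].
rewrite !lfunE /= !ffunE /=; case: ifP => // /andP[/eqP cT vC].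
rewrite big1 // => i iT; apply: (@sum_suborb T (T :\ i)); first exact: subD1set.
move=> u uv; have /ffunP/(_ (T :\ i, u)) := zA; rewrite !lfunE /= !ffunE /=.
by rewrite -eqSS -cT (cardsD1 i T) iT eqxx (@orb_closed T u v) // vC.
Qed.

End Maps.

(** Exactness identifies the image of one boundary map with the kernel of the next, up to
    evaluation; three applications of rank and nullity give the count. *)
Lemma rank_exact j : exact_at j.+1 ->
  (\dim (limg (lB j)) + \dim (limg (lB j.+1)) = \dim (limg (lA j.+1)))%N.
Proof.
move=> ex.
have E : limg (lB j) = (lA j.+1 @: lker (lB j.+1))%VS.
  apply/eqP; rewrite eqEsubv; apply/andP; split; apply/subvP => _ /memv_imgP[z zk ->].
    have -> : lB j z = lA j.+1 [ffun x : {set I} * V => \sum_(i in x.1) z (x.1 :\ i, x.2)].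
      apply/ffunP => -[T v]; rewrite !lfunE /= !ffunE /=; case: ifP => // _.
      by rewrite exchange_big /=; apply: eq_bigr => u _; rewrite ffunE.
    apply: memv_img; rewrite memv_ker; apply/eqP/ffunP => -[T v].
    rewrite lfunE /= !ffunE /=; case: ifP => // _; rewrite exchange_big /= big1 // => u _.
    under eq_bigr do rewrite ffunE /=.
    by apply: sum_sym_char2 => i i'; rewrite setDDl setUC -setDDl.
  move: zk; rewrite memv_ker => /eqP zk.
  have [T v cT vC|w Hw] := ex (fun T u => z (T, u)).
    have /ffunP/(_ (T, v)) := zk; rewrite !lfunE /= !ffunE /= cT eqxx vC /= => e.
    exact: e.
  have -> : lA j.+1 z = lB j [ffun x : {set I} * V => w x.1 x.2].
    apply/ffunP => -[T v]; rewrite !lfunE /= !ffunE /=.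
    case: ifP => // /andP[/eqP cT vC]; rewrite -Hw //.
    by apply: eq_bigr => i _; apply: eq_bigr => u _; rewrite ffunE.
  exact: memv_img (memvf _).
have kAB := limg_ker_dim (lA j.+1) (lker (lB j.+1)).
have kA := limg_ker_dim (lA j.+1) fullv.
have kB := limg_ker_dim (lB j.+1) fullv.
rewrite E; move: kAB kA kB.
rewrite (capv_idPr (ker_sub _)) (capfv (lker (lA j.+1))) (capfv (lker (lB j.+1))); lia.
Qed.

(** The cycles of degree 0 are the functions constant on the connected set [C]: a line, spanned by
    [c]. This excess of one dimension is the right-hand side of the Euler relation. *)
Lemma rank_zero : \dim (limg (lA 0)) = (\dim (limg (lB 0))).+1.
Proof.
pose c : L := [ffun x : {set I} * V => ((x.1 == set0) && (x.2 \in C))%:R].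
suff E : (lA 0 @: lker (lB 0) = <[c]>)%VS.
  have kAB := limg_ker_dim (lA 0) (lker (lB 0)).
  have kA := limg_ker_dim (lA 0) fullv.
  have kB := limg_ker_dim (lB 0) fullv.
  move: kAB kA kB; rewrite (capv_idPr (ker_sub _)) (capfv (lker (lA 0))) (capfv (lker (lB 0))) E dim_vline.
  have -> : c != 0.
    by apply/eqP => /ffunP/(_ (set0, v0)); rewrite !ffunE /= eqxx orb_refl.
  lia.
apply/eqP; rewrite eqEsubv; apply/andP; split; last first.
  rewrite -memvE.
  have -> : c = lA 0 [ffun x : {set I} * V => 1].
    apply/ffunP => -[T v]; rewrite !lfunE /= !ffunE /= cards_eq0.
    case: (altP (T =P set0)) => //= ->; case: ifP => // _.
    by rewrite orb0 big_set1 ffunE.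
  apply: memv_img; rewrite memv_ker; apply/eqP/ffunP => -[T v]; rewrite !lfunE /= !ffunE /=.
  (* A component of a single colour has exactly two vertices, because no involution fixes a vertex;
     so the all-one function is a cycle. *)
  case: ifP => // /andP[/cards1P[i ->] vC]; rewrite big_set1 orb1 big_setU1 ?big_set1 ?inE;
    last by rewrite eq_sym.
  by rewrite !ffunE; exact: char2.
apply/subvP => _ /memv_imgP[z + ->]; rewrite memv_ker => /eqP/ffunP zk.
have zc i v : v \in C -> z (set0, g i v) = z (set0, v).
  move=> vC; have := zk ([set i], v); rewrite !lfunE /= !ffunE /= cards1 eqxx vC /=.
  rewrite big_set1 orb1 big_setU1 ?big_set1 ?inE; last by rewrite eq_sym.
  rewrite setDv => /eqP; rewrite addr_eq0 => /eqP ->.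
  by have /eqP := char2 (z (set0, g i v)); rewrite addr_eq0 => /eqP.
have zc' v : v \in C -> z (set0, v) = z (set0, v0).
  move=> vC; suff [] : v \in C /\ z (set0, v) = z (set0, v0) by [].
  apply: (@orb_ind _ _ g setT v0 v (fun v => v \in C /\ z (set0, v) = z (set0, v0))) => //.
    move=> i u _ [uC <-]; split; last exact: zc.
    by apply: orb_trans uC (orb_step _ _ _).
  by split => //; exact: orb_refl.
apply/vlineP; exists (z (set0, v0)); apply/ffunP => -[T v]; rewrite !lfunE /= !ffunE /= cards_eq0.
case: (altP (T =P set0)) => [->|] /=; last by rewrite scaler0.
case: ifP => [vC|_]; last by rewrite scaler0.
by rewrite orb0 big_set1 zc' // /GRing.scale /= mulr1.
Qed.

Lemma rank_top : \dim (limg (lB #|I|)) = 0%N.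
Proof.
apply/eqP; rewrite dimv_eq0 -subv0; apply/subvP => _ /memv_imgP[z _ ->].
rewrite memv0; apply/eqP/ffunP => -[T v]; rewrite !lfunE /= !ffunE /=.
case: ifP => // /andP[/eqP cT _]; have := max_card (mem T); by rewrite cT ltnn.
Qed.

(** The alternating sum up to degree [m] is 1 plus the signed rank of the boundary leaving degree
    [m], and this rank is 0 in the top degree. *)
Theorem euler_of_exact : (forall j, (0 < j)%N -> exact_at j) ->
  \sum_(T : {set I}) (-1) ^+ #|T| * (ncomp g T C)%:Z = 1.
Proof.
move=> ex.
have S m : (m <= #|I|)%N ->
    \sum_(T : {set I} | (#|T| <= m)%N) (-1) ^+ #|T| * (ncomp g T C)%:Z =
    1 + (-1) ^+ m * (\dim (limg (lB m)))%:Z.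
  have lev k : \sum_(T : {set I} | #|T| == k) (-1) ^+ #|T| * (ncomp g T C)%:Z =
      (-1) ^+ k * (\dim (limg (lA k)))%:Z.
    rewrite rank_lA raddf_sum /= big_distrr /=.
    by apply: eq_bigr => T /eqP ->.
  elim: m => [|m IH] hm.
    rewrite (eq_bigl (fun T : {set I} => #|T| == 0%N)); last by move=> T; rewrite leqn0.
    by rewrite lev rank_zero expr0 !mul1r; lia.
  rewrite (bigID (fun T : {set I} => #|T| == m.+1)) /=.
  rewrite (eq_bigl (fun T : {set I} => #|T| == m.+1)); last first.
    by move=> T; case: eqP => [->|]; rewrite ?leqnn ?andbF.
  rewrite [X in _ + X](eq_bigl (fun T : {set I} => (#|T| <= m)%N)); last first.
    by move=> T; rewrite andbC -ltn_neqAle ltnS.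
  rewrite lev IH ?(ltnW hm) //.
  have := rank_exact (ex m.+1 isT); rewrite exprS => <-.
  rewrite PoszD; ring.
rewrite -[RHS]addr0 -[X in _ = _ + X](mulr0 ((-1) ^+ #|I|)).
rewrite -[X in _ = _ + _ * X]/((0%N)%:Z) -rank_top -S //.
by apply: eq_bigl => T; rewrite max_card.
Qed.

End Exactness.

(** * Stokes' formula modulo 2 on a box of unit cubes *)

Section Box.
Variables (J : finType) (N : nat).
Implicit Types (A : {set J}) (p : {ffun J -> nat}) (q : {ffun J -> 'I_N.+1}).
Local Notation grid := {ffun J -> nat}.

Definition setp p i k : grid := [ffun j => if j == i then k else p j].

(** Coordinates outside [A] are pinned to 0, so the sums run over the unit cubes of one face of the
    big cube, indexed by their lowest corners. *)
Definition inbox A q := [forall j, if j \in A then (q j < N)%N else q j == ord0].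

Definition grid_of q : grid := [ffun j => val (q j)].

Definition box A (psi : grid -> 'F_2) : 'F_2 :=
  \sum_(q : {ffun J -> 'I_N.+1} | inbox A q) psi (grid_of q).

Lemma box_split A i psi : i \in A ->
  box A psi = box (A :\ i) (fun p => \sum_(k < N) psi (setp p i k)).
Proof.
move=> iA; rewrite /box.
pose upd q k : {ffun J -> 'I_N.+1} := [ffun j => if j == i then k else q j].
rewrite (partition_big (fun q => upd q ord0) (inbox (A :\ i))) /=; last first.
  move=> q /forallP H; apply/forallP => j; have := H j.
  by rewrite !inE !ffunE; case: (altP (j =P i)) => [->|].
apply: eq_bigr => q0 /forallP H0.
rewrite (big_ord_widen N.+1 (fun k => psi (setp (grid_of q0) i k))) //.
have q0i : q0 i = ord0 by have := H0 i; rewrite !inE eqxx => /eqP.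
rewrite (reindex_onto (fun k => upd q0 k) (fun q => q i)) /=; last first.
  move=> q /andP[_ /eqP <-]; apply/ffunP => j; rewrite !ffunE.
  by case: (altP (j =P i)) => [->|].
apply: eq_big => [k|k _]; last first.
  by congr psi; apply/ffunP => j; rewrite !ffunE; case: ifP.
rewrite ffunE eqxx eqxx andbT (_ : upd (upd q0 k) ord0 == q0) ?andbT; last first.
  by apply/eqP/ffunP => j; rewrite !ffunE; case: (altP (j =P i)) => [->|]; rewrite ?q0i.
apply/forallP/idP => [/(_ i)|kN j]; first by rewrite iA ffunE eqxx.
have := H0 j; rewrite !inE !ffunE; case: (altP (j =P i)) => [->|_] /=; last by [].
by rewrite iA.
Qed.

(** Along direction [i] every intermediate position occurs twice, and only 0 and [N] survive. *)
Lemma box_telescope A i psi : i \in A ->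
  box A (fun p => psi (incr p i) + psi p) =
  box (A :\ i) (fun p => psi p + psi (setp p i N)).
Proof.
move=> iA; rewrite (box_split _ iA); apply: eq_bigr => q /forallP H.
have q0 : grid_of q i = 0%N by have := H i; rewrite !inE eqxx ffunE => /eqP ->.
have -> : grid_of q = setp (grid_of q) i 0.
  by apply/ffunP => j; rewrite [RHS]ffunE; case: eqP => [->|].
move: (grid_of q) => p.
have E : forall k, setp (setp p i 0) i k = setp p i k.
  by move=> k; apply/ffunP => j; rewrite !ffunE; case: eqP.
under eq_bigr do rewrite !E.
rewrite E; elim: (N) => [|M IH]; first by rewrite big_ord0 char2.
rewrite big_ord_recr /= IH.
have -> : incr (setp p i M) i = setp p i M.+1.
  by apply/ffunP => j; rewrite !ffunE; case: eqP => _; rewrite ?addn1 ?addn0.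
by rewrite [psi (setp p i M.+1) + _]addrC addrA -(addrA _ (psi (setp p i M)) (psi (setp p i M))) char2 addr0.
Qed.

Lemma boxD A psi1 psi2 : box A (fun p => psi1 p + psi2 p) = box A psi1 + box A psi2.
Proof. by rewrite /box big_split. Qed.

Lemma box_sum (X : Type) (r : seq X) (P : pred X) A (psi : X -> grid -> 'F_2) :
  box A (fun p => \sum_(x <- r | P x) psi x p) = \sum_(x <- r | P x) box A (psi x).
Proof. by rewrite /box exchange_big. Qed.

Lemma eq_box A psi1 psi2 :
  (forall p, (forall j, if j \in A then (p j < N)%N else p j == 0%N) -> psi1 p = psi2 p) ->
  box A psi1 = box A psi2.
Proof.
move=> H; apply: eq_bigr => q /forallP Hq; apply: H => j; rewrite ffunE.
by have := Hq j; case: ifP => // _ /eqP ->.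
Qed.

(** The boundary formula holds in each unit cube; faces shared by neighbouring cubes cancel, and the
    outer faces remain. *)
Lemma stokes A k phi : #|A| = k.+1 ->
  box A (fun p => chains k.+1 A p (delta phi)) =
  \sum_(i in A) box (A :\ i) (fun p => chains k (A :\ i) p phi +
                                       chains k (A :\ i) (setp p i N) phi).
Proof.
move=> cA; rewrite (eq_box (psi2 := fun p => \sum_(i in A) (chains k (A :\ i) (incr p i) phi +
                                          chains k (A :\ i) p phi))); last first.
  by move=> p _; rewrite chains_delta.
rewrite box_sum.
by apply: eq_bigr => i iA; rewrite (box_telescope (fun p => chains k (A :\ i) p phi)).
Qed.

End Box.


(** * Sperner counting of rainbow simplices modulo 2 *)

Section Deletions.
Variable X : eqType.
Implicit Types l m : seq X.

Fixpoint deletions (l : seq X) : seq (seq X) :=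
  if l is x :: l' then l' :: map (cons x) (deletions l') else [::].

Lemma all2_deletions l : all2 (fun y m => perm_eq l (y :: m)) l (deletions l).
Proof.
elim: l => //= x l IH; rewrite perm_refl /=.
move: (deletions l) IH; move: {2 4}l => k.
elim: k => [|y k IH] [|m ms] //= /andP[h1 h2].
rewrite IH // andbT; rewrite -(perm_cons x) in h1; apply: perm_trans h1 _.
by rewrite -[[:: x, y & m]]/([:: x] ++ [:: y] ++ m) -[[:: y, x & m]]/([:: y] ++ [:: x] ++ m)
  perm_catCA.
Qed.

Lemma deletions_sub l m : m \in deletions l -> {subset m <= l}.
Proof.
elim: l m => //= x l IH m; rewrite inE => /orP[/eqP -> y yl|/mapP[m' m'l -> y]].
  by rewrite inE yl orbT.
by rewrite !inE => /orP[->//|/(IH _ m'l) ->]; rewrite orbT.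
Qed.

Lemma count_deletions (L l : seq X) :
  count (fun m => perm_eq m L) (deletions l) = count (fun y => perm_eq l (y :: L)) l.
Proof.
have := all2_deletions l; move: (deletions l); move: {2 4}l => k.
elim: k => [|y k IH] [|m ms] //= /andP[h1 h2].
rewrite IH // (permPl h1) perm_cons //.
Qed.

End Deletions.

Lemma map_deletions (X Y : eqType) (f : X -> Y) (l : seq X) :
  deletions (map f l) = map (map f) (deletions l).
Proof. by elim: l => //= x l ->; congr cons; rewrite -!map_comp. Qed.

(** Sperner's count: a list that repeats a label of [L] has two facets labelled by [L], which
    cancel, while a list with one new label has exactly one. *)
Lemma count_deletions_rainbow (C : finType) (L l : seq C) : uniq L ->
  ((count (fun m => perm_eq m L) (deletions l))%:R : 'F_2) =
  \sum_(y : C | y \notin L) (perm_eq l (y :: L))%:R.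
Proof.
move=> uL; rewrite count_deletions.
have [x hx|nx] := pickP (fun x => perm_eq l (x :: L)); last first.
  rewrite big1 => [|y _]; last by rewrite nx.
  by rewrite (@eq_count _ _ pred0) ?count_pred0.
have E y : perm_eq l (y :: L) = (y == x).
  apply/idP/eqP => [hy|->//].
  have : perm_eq (y :: L) (x :: L) by rewrite -(permPl hy).
  move/seq.permP/(_ (pred1 x)) => /=; rewrite eqxx => /eqP; rewrite eqn_add2r.
  by case: (altP (y =P x)).
rewrite (eq_count E) (seq.permP hx) /= eqxx count_uniq_mem //.
under eq_bigr do rewrite E.
rewrite big_mkcond (bigD1 x) //= big1 ?addr0 => [|y /negbTE ->]; last by case: ifP.
by case: (x \in L); rewrite ?eqxx /=; apply/val_inj.
Qed.

Section Rainbow.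
Variables (J C : finType) (col : {ffun J -> nat} -> C) (x0 : {ffun J -> nat}).
Variable b : {ffun J -> nat} -> bool.

(** The flag at the head will tell in which component the simplex lies, so that rainbow simplices
    can be counted component by component. *)
Definition rainbow (L : seq C) (l : seq {ffun J -> nat}) : 'F_2 :=
  (perm_eq (map col l) L && b (head x0 l))%:R.

Lemma delta_deletions (phi : seq {ffun J -> nat} -> 'F_2) l :
  delta phi l = \sum_(m <- deletions l) phi m.
Proof.
elim: l phi => [|x l IH] phi /=; first by rewrite big_nil.
by rewrite big_cons big_map IH.
Qed.

Lemma delta_rainbow (L : seq C) l : uniq L ->
  (forall m, m \in deletions l -> perm_eq (map col m) L -> b (head x0 m) = b (head x0 l)) ->
  delta (rainbow L) l = \sum_(y : C | y \notin L) rainbow (y :: L) l.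
Proof.
move=> uL H; rewrite delta_deletions.
rewrite (eq_big_seq (fun m => (perm_eq (map col m) L)%:R * (b (head x0 l))%:R)); last first.
  move=> m hm; rewrite /rainbow; case E: (perm_eq _ _) => //=; last by rewrite mul0r.
  by rewrite H // mul1r.
rewrite -mulr_suml (eq_bigr (fun y => (perm_eq (map col l) (y :: L))%:R * (b (head x0 l))%:R));
  last by move=> y _; rewrite /rainbow; case: (b _); rewrite ?andbT ?andbF ?mulr1 ?mulr0.
rewrite -mulr_suml -count_deletions_rainbow // map_deletions count_map; congr (_ * _).
by rewrite -sum1_count natr_sum [RHS]big_mkcond; apply: eq_bigr => m _ /=; case: ifP.
Qed.

End Rainbow.

Section RainbowCount.
Variables (J : finType) (rk : J -> nat) (z : J) (B : {set J}) (N a : nat).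
Hypothesis rk_inj : injective rk.
Hypothesis zB : z \notin B.
Hypothesis aN : (a < N)%N.
Implicit Types p : {ffun J -> nat}.
Variable lab : {ffun J -> nat} -> J.
Hypothesis lab_low : forall p, (forall j, j \in B -> p j <= a)%N -> lab p = z.
Hypothesis lab_high : forall p, (exists2 j, j \in B & a < p j)%N -> lab p != z.
Hypothesis lab_top : forall p i, i \in B -> p i = a.+1 ->
  (forall j, j \in B -> p j <= a.+1)%N ->
  (forall j, j \in B -> p j = a.+1 -> rk i <= rk j)%N -> lab p = i.

(** Only the element of largest rank can contribute. *)
Lemma sum_max (D : {set J}) (Q : pred J) : D != set0 ->
  \sum_(i in D) (Q i && [forall j in D :\ i, Q j && (rk j < rk i)%N])%:R =
  ([forall j in D, Q j])%:R :> 'F_2.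
Proof.
move=> /set0Pn[j0 j0D].
pose m := [arg max_(i > j0 | i \in D) rk i].
have [mD mmax] : m \in D /\ forall j, j \in D -> (rk j <= rk m)%N.
  by rewrite /m; case: arg_maxnP => // i iD H; split.
rewrite (bigD1 m) //= big1 ?addr0; last first.
  move=> i /andP[iD im]; rewrite (_ : [forall j in _, _] = false) ?andbF //.
  apply/negbTE; rewrite negb_forall_in; apply/exists_inP; exists m.
    by rewrite !inE eq_sym im.
  by rewrite negb_and -leqNgt mmax // orbT.
congr ((nat_of_bool _)%:R); apply/idP/forall_inP => [/andP[Qm /forall_inP H] j jD|H].
  have [->//|jm] := eqVneq j m.
  by have := H j; rewrite !inE jm jD => /(_ isT) /andP[].
apply/andP; split; first exact: H.
apply/forall_inP => j; rewrite !inE => /andP[jm jD]; rewrite H //=.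
by rewrite ltn_neqAle mmax // andbT (inj_eq rk_inj).
Qed.

Lemma chains_head0 k A (p : {ffun J -> nat}) phi :
  (forall l, phi (p :: l) = 0) -> chains k A p phi = 0.
Proof.
case: k => [|k] H /=; first exact: H.
by rewrite big1 // => i _; rewrite (eq_chains _ _ _ (psi := fun=> 0)) ?chains0.
Qed.

(** The label of a point is its coordinate of least rank at height [a.+1]. A new label therefore
    appears only by raising a coordinate at height [a] of smaller rank, and the rest of a rainbow
    chain is forced. *)
Lemma chains_tail k (D : {set J}) m p : #|D| = k -> D \subset B -> m \in B -> m \notin D ->
  p m = a.+1 -> (forall j, j \in D -> p j <= a)%N ->
  (forall j, j \in B -> p j <= a.+1)%N ->
  (forall j, j \in B -> p j = a.+1 -> rk m <= rk j)%N ->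
  chains k D p (fun l => (perm_eq (map lab l) (m :: enum D))%:R) =
  ([forall j in D, (p j == a) && (rk j < rk m)%N])%:R.
Proof.
elim: k D m p => [|k IH] D m p cD /subsetP DB mB mD pm pD pB pmin.
  move/cards0_eq: cD => ->; rewrite /= enum_set0 (lab_top mB) // perm_refl.
  by rewrite (_ : [forall j in _, _] = true) //; apply/forall_inP => j; rewrite inE.
have labp : lab p = m by apply: lab_top.
rewrite /= -sum_max; last by rewrite -card_gt0 cD.
apply: eq_bigr => i iD; have iB := DB _ iD.
under eq_chains do rewrite labp perm_cons.
have enumi : perm_eq (enum D) (i :: enum (D :\ i)).
  apply: uniq_perm; rewrite /= ?enum_uniq ?mem_enum ?inE ?eqxx // => j.
  by rewrite !inE !mem_enum !inE; case: eqP => [->|].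
have bi j : incr p i j = (p j + (j == i))%N by rewrite ffunE.
have [/andP[/eqP pi rim]|low] := boolP ((p i == a) && (rk i < rk m)%N).
  under eq_chains do rewrite (permPr enumi).
  rewrite IH; first 1 last.
  - exact: card_rem.
  - by apply/subsetP => j; rewrite !inE => /andP[_ /DB].
  - by [].
  - by rewrite !inE eqxx.
  - by rewrite bi eqxx pi addn1.
  - by move=> j; rewrite !inE bi => /andP[/negbTE -> jD]; rewrite addn0 pD.
  - move=> j jB; rewrite bi; case: eqP => [->|]; first by rewrite pi addn1.
    by rewrite addn0 pB.
  - move=> j jB; rewrite bi; case: eqP => [->//|_]; rewrite addn0 => /(pmin _ jB).
    by apply: leq_trans; exact: ltnW.
  rewrite /=; congr ((nat_of_bool _)%:R); apply: eq_forallb_in => j.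
  rewrite !inE bi => /andP[/negbTE -> _]; rewrite addn0; case: (p j == a) => //=.
  by case: ltnP => h; rewrite ?andbF // (ltn_trans h rim).
rewrite /= chains_head0 // => l; apply/eqP; rewrite F2_eq0 /=.
have -> : lab (incr p i) = m.
  apply: lab_top => //.
  - rewrite bi; case: eqP => [e|]; last by rewrite addn0.
    by move: mD; rewrite e iD.
  - move=> j jB; rewrite bi; case: eqP => [->|]; last by rewrite addn0 pB.
    by rewrite addn1 ltnS pD.
  - move=> j jB; rewrite bi; case: eqP => [->|_]; last by rewrite addn0; apply: pmin.
    rewrite addn1 => -[pia]; move: low; rewrite pia eqxx /= -leqNgt //.
apply/negP => /perm_mem/(_ m); by rewrite inE eqxx /= mem_enum (negbTE mD).
Qed.

(** The unique rainbow chain starts where all coordinates in [B] equal [a] and raises them in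
    decreasing order of rank. *)
Lemma rainbow_box k : #|B| = k ->
  box N B (fun p => chains k B p (fun l => (perm_eq (map lab l) (z :: enum B))%:R)) = 1.
Proof.
move=> cB.
transitivity (box N B (fun p => ([forall j in B, p j == a])%:R)); last first.
  have q0P j : ((if j \in B then a else 0) < N.+1)%N by case: ifP => // _; rewrite ltnS ltnW.
  pose q0 : {ffun J -> 'I_N.+1} := [ffun j => Ordinal (q0P j)].
  rewrite /box (bigD1 q0) /=; last first.
    by apply/forallP => j; rewrite ffunE; case: ifP => h; rewrite -?val_eqE /= h.
  rewrite big1 ?addr0 => [|q /andP[/forallP Hq qq0]].
    rewrite (_ : [forall j in _, _] = true) //; apply/forall_inP => j jB.
    by rewrite !ffunE /= jB.
  apply/eqP; rewrite F2_eq0; apply: contra qq0 => /forall_inP H.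
  apply/eqP/ffunP => j; apply/val_inj; rewrite ffunE /=.
  have := Hq j; case: ifP => [jB _|_ /eqP -> //].
  by have /eqP := H _ jB; rewrite ffunE.
apply: eq_box => p Hp.
(* If a coordinate already exceeds [a], the label [z] does not occur in the cube. *)
have [low|/forall_inPn[j0 j0B j0a]] := boolP [forall j in B, (p j <= a)%N]; last first.
  rewrite (_ : [forall j in _, _] = false); last first.
    apply/negbTE; rewrite negb_forall_in; apply/exists_inP; exists j0 => //.
    by apply: contraNneq j0a => ->.
  rewrite (eq_chains_in (psi := fun=> 0)) ?chains0 // => l sl /allP al.
  apply/eqP; rewrite F2_eq0; apply/negP => /perm_mem /(_ z).
  rewrite inE eqxx /= => /mapP[q ql zE].
  have /forallP/(_ j0)/andP[h _] := al _ ql.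
  have : lab q != z.
    by apply: lab_high; exists j0 => //; apply: leq_trans h; rewrite ltnNge.
  by rewrite -zE eqxx.
move/forall_inP: low => low.
have labp : lab p = z by apply: lab_low.
case: k cB => [|k] cB.
  rewrite /= labp; move/cards0_eq: cB => ->; rewrite enum_set0 perm_refl.
  by rewrite (_ : [forall j in _, _] = true) //; apply/forall_inP => j; rewrite inE.
rewrite /= -sum_max; last by rewrite -card_gt0 cB.
apply: eq_bigr => i iB.
under eq_chains do rewrite labp perm_cons.
have enumi : perm_eq (enum B) (i :: enum (B :\ i)).
  apply: uniq_perm; rewrite /= ?enum_uniq ?mem_enum ?inE ?eqxx // => j.
  by rewrite !inE !mem_enum !inE; case: eqP => [->|].
have bi j : incr p i j = (p j + (j == i))%N by rewrite ffunE.
have [/eqP pi|low'] := boolP (p i == a).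
  under eq_chains do rewrite (permPr enumi).
  rewrite chains_tail ?inE ?eqxx //; first 1 last.
  - exact: card_rem.
  - by apply/subsetP => j; rewrite !inE => /andP[].
  - by rewrite bi eqxx pi addn1.
  - by move=> j; rewrite !inE bi => /andP[/negbTE -> jD]; rewrite addn0 low.
  - move=> j jB; rewrite bi; case: eqP => [->|]; first by rewrite pi addn1.
    by rewrite addn0 (leq_trans (low _ jB)).
  - move=> j jB; rewrite bi; case: eqP => [->//|_]; rewrite addn0 => e.
    by have := low _ jB; rewrite e ltnn.
  rewrite /=; congr ((nat_of_bool _)%:R); apply: eq_forallb_in => j.
  by rewrite !inE bi => /andP[/negbTE -> _]; rewrite addn0.
rewrite /= chains_head0 // => l; apply/eqP; rewrite F2_eq0 /=.
have -> : lab (incr p i) = z.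
  apply: lab_low => j jB; rewrite bi; case: eqP => [->|]; last by rewrite addn0 low.
  by rewrite addn1 ltn_neqAle low' low.
apply/negP => /perm_mem/(_ z); by rewrite inE eqxx /= mem_enum (negbTE zB).
Qed.

End RainbowCount.

Section FirstMax.
Variables (disp : Order.disp_t) (R : orderType disp) (d : nat).
Implicit Types (f : 'I_d -> R).

(** Ties go to the least index. The result depends only on the order of the values, so a labelling
    by real coordinates can be compared with one by grid coordinates. *)
Definition is_first_max f i := [forall j, (f j <= f i)%O && ((j < i)%N ==> (f j < f i)%O)].
Definition first_max f : option 'I_d := [pick i | is_first_max f i].

Lemma first_max_uniq f i : is_first_max f i -> first_max f = Some i.
Proof.
move=> fi; rewrite /first_max; case: pickP => [k fk|/(_ i)]; last by rewrite fi.
congr Some; apply/val_inj/eqP; rewrite eqn_leq.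
have /forallP/(_ k)/andP[k1 /implyP k2] := fi.
have /forallP/(_ i)/andP[i1 /implyP i2] := fk.
by apply/andP; split; rewrite leqNgt; apply/negP; [move=> /i2|move=> /k2]; rewrite ltNge ?k1 ?i1.
Qed.

Lemma first_max_some f (i0 : 'I_d) : exists2 i, first_max f = Some i & forall j, (f j <= f i)%O.
Proof.
pose m := [arg max_(i > i0) f i]%O.
have mP j : (f j <= f m)%O by rewrite /m; case: arg_maxP => // i _ H; apply: H.
have ex : exists k : nat, [exists i : 'I_d, (val i == k) && (f i == f m)].
  by exists m; apply/existsP; exists m; rewrite !eqxx.
case: (ex_minnP ex) => k /existsP[i /andP[/eqP ik /eqP fim]] kmin.
exists i; last by move=> j; rewrite fim.
apply: first_max_uniq; apply/forallP => j; rewrite fim mP /=; apply/implyP => ji.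
rewrite lt_neqAle mP andbT; apply: contraTneq ji => fj; rewrite -leqNgt ik; apply: kmin.
by apply/existsP; exists j; rewrite eqxx fj eqxx.
Qed.

End FirstMax.

(** * Exactness from a Sperner labelling of prisms *)

Section SpernerExact.
Variables (d : nat) (V : finType) (g : 'I_d -> V -> V) (v0 : V) (N a : nat).
Hypothesis gK : forall i, involutive (g i).
Local Notation grid := {ffun option 'I_d -> nat}.
(** Over every orthant [u] stands a prism: the coordinates [Some i] run in the orthant, [None] is
    the time of a deformation, and [lab] and [nu] are the label of the deformed point and an orthant
    containing it. The label [None] stands for a point near the apex, so the hypotheses forbid it on
    the faces at final time and on the far sides. *)
Variables (lab : V -> grid -> option 'I_d) (nu : V -> grid -> V).
Let C := orb g setT v0.
Implicit Types (T : {set 'I_d}) (p q : grid) (u v : V).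

Definition valid p := [forall i, (p i <= N)%N].
Definition on_face p := [exists i, p (Some i) == 0%N].
Definition base_label p : option 'I_d :=
  if [forall i, (p (Some i) <= a)%N] then None else first_max (fun i => p (Some i)).

Hypothesis a_gt0 : (0 < a)%N.
Hypothesis aN : (a < N)%N.
Hypothesis glueH : forall u k p, u \in C -> valid p -> p (Some k) = 0%N ->
  lab (g k u) p = lab u p /\ nu (g k u) p = nu u p.
Hypothesis topH : forall u p, u \in C -> valid p -> on_face p -> p None = N -> lab u p != None.
Hypothesis farH : forall u p k, u \in C -> valid p -> on_face p -> p (Some k) = N -> lab u p != None.
Hypothesis baseH : forall u p, u \in C -> valid p -> on_face p -> p None = 0%N ->
  lab u p = base_label p /\ nu u p \in orb g [set i | p (Some i) == 0%N] u.
Hypothesis cohH : forall u p (A : {set option 'I_d}) T (l : seq grid), u \in C ->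
  all (fun q => valid q && on_face q) l -> all (in_cube p A) l ->
  (forall i, i \notin T -> Some i \in map (lab u) l) ->
  forall x y, x \in l -> y \in l -> nu u y \in orb g T (nu u x).

(** The labels of a rainbow simplex of dimension [d - #|T|]. *)
Definition colours T : seq (option 'I_d) := None :: map Some (enum (~: T)).
Definition cube_dirs T : {set option 'I_d} := [set Some i | i in ~: T].
Definition prism_dirs T : {set option 'I_d} := None |: cube_dirs T.

Lemma colours_uniq T : uniq (colours T).
Proof.
rewrite /= map_inj_uniq ?enum_uniq ?andbT; last by move=> x y [].
by apply/mapP => -[].
Qed.

Lemma notin_colours T y : (y \notin colours T) = (if y is Some i then i \in T else false).
Proof.
case: y => [i|]; last by rewrite inE eqxx.
by rewrite inE /= mem_map ?mem_enum ?inE ?negbK // => x y [].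
Qed.

Lemma colours_D1 T i : i \in T -> perm_eq (Some i :: colours T) (colours (T :\ i)).
Proof.
move=> iT; apply: uniq_perm => [||y].
- by rewrite cons_uniq notin_colours iT colours_uniq.
- exact: colours_uniq.
rewrite -[RHS]negbK notin_colours inE -[y \in colours T]negbK notin_colours.
case: y => [k|]; last by rewrite orbT.
by rewrite !inE negb_and negbK.
Qed.

Lemma card_cube_dirs T : #|cube_dirs T| = (d - #|T|)%N.
Proof.
rewrite card_imset; last by move=> x y [].
by rewrite cardsCs setCK card_ord.
Qed.

Lemma none_cube T : None \notin cube_dirs T.
Proof. by apply/imsetP => -[]. Qed.

Lemma card_prism_dirs T : #|prism_dirs T| = (d - #|T|).+1.
Proof. by rewrite cardsU1 none_cube card_cube_dirs. Qed.

Lemma some_cube T i : (Some i \in cube_dirs T) = (i \notin T).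
Proof. by rewrite mem_imset ?inE // => x y []. Qed.

Local Notation x0 := [ffun=> 0%N : nat].
Local Notation rb u T v := (rainbow (lab u) x0 (fun p => nu u p \in orb g T v) (colours T)).

(** The rainbow count on the side of the prism where the coordinates in [T1] vanish. *)
Definition wall_sum T1 T v u : 'F_2 :=
  box N (prism_dirs T1) (fun p => chains #|prism_dirs T1| (prism_dirs T1) p (rb u T v)).

Lemma box_valid (A : {set option 'I_d}) p q :
  (forall j, if j \in A then (p j < N)%N else p j == 0%N) -> in_cube p A q ->
  valid q /\ (forall j, j \notin A -> q j = 0%N).
Proof.
move=> Hp /forallP Hq; split.
  apply/forallP => j; have := Hp j; have /andP[_] := Hq j; case: (j \in A) => /=.
    by rewrite addn1 => h1 h2; apply: leq_trans h1 h2.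
  by rewrite addn0 => h1 /eqP e; apply: leq_trans h1 _; rewrite e.
move=> j jA; have := Hp j; have /andP[_] := Hq j; rewrite (negbTE jA) addn0 => h /eqP e.
by apply/eqP; rewrite -leqn0 -e.
Qed.

Lemma face_of T q : T != set0 -> (forall j, j \in T -> q (Some j) = 0%N) -> on_face q.
Proof. by move=> /set0Pn[j jT] H; apply/existsP; exists j; rewrite H. Qed.

Lemma chains_far k (A : {set option 'I_d}) p T v u : #|A| = k ->
  (forall q, in_cube p A q -> lab u q != None) -> chains k A p (rb u T v) = 0.
Proof.
move=> cA H; rewrite (eq_chains_in (psi := fun=> 0)) ?chains0 // => l sl /allP al.
apply/eqP; rewrite F2_eq0; apply/negP => /andP[/perm_mem/(_ None)].
rewrite inE eqxx => /mapP[q ql qE] _.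
by have := H q (al _ ql); rewrite -qE.
Qed.

(** At time 0, on the face where [T0] vanishes, only labels outside [T0] occur. A rainbow simplex
    for [T] thus needs [T] to contain [T0], and then the sizes force equality; [rainbow_box] yields
    exactly one. *)
Lemma base_box T0 : T0 != set0 -> forall T v u, u \in C -> #|T| = #|T0| ->
  box N (cube_dirs T0) (fun p => chains #|cube_dirs T0| (cube_dirs T0) p (rb u T v)) =
  ((T == T0) && (u \in orb g T v))%:R.
Proof.
move=> T0n T v u uC cT.
pose B := cube_dirs T0.
pose lab' p : option 'I_d := if [forall j in B, (p j <= a)%N] then None
   else first_max (fun i => if Some i \in B then p (Some i) else 0%N).
have zeroB q : (forall j, j \notin B -> q j = 0%N) -> forall j, j \in T0 -> q (Some j) = 0%N.
  by move=> H j jT; apply: H; rewrite some_cube jT.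
have labE q : valid q -> (forall j, j \notin B -> q j = 0%N) -> lab u q = lab' q.
  move=> vq qB; have qf : on_face q by apply: face_of T0n (zeroB _ qB).
  have [-> _] := baseH uC vq qf (qB _ (none_cube _)); rewrite /base_label /lab'.
  have -> : [forall i, (q (Some i) <= a)%N] = [forall j in B, (q j <= a)%N].
    apply/forallP/forall_inP => [H [i|] _|H i]; first exact: H.
      by rewrite qB ?none_cube.
    by have [iB|iB] := boolP (Some i \in B); [apply: H|rewrite qB].
  case: ifP => // _; rewrite /first_max; apply: eq_pick => i; rewrite /is_first_max.
  have E k : (if Some k \in B then q (Some k) else 0%N) = q (Some k).
    by case: ifP => // /negbT/qB.
  by apply: eq_forallb => k; rewrite !E.
have [eT|nT] := eqVneq T T0; last first.
  rewrite (eq_box (psi2 := fun=> 0)); first by rewrite /box big1.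
  move=> p Hp; rewrite (eq_chains_in (psi := fun=> 0)) ?chains0 // => l sl /allP al.
  apply/eqP; rewrite F2_eq0; apply/negP => /andP[/perm_mem pm _].
  have sub : ~: T \subset ~: T0.
    apply/subsetP => i; rewrite !inE => iT.
    have := pm (Some i); rewrite -[RHS]negbK notin_colours iT => /mapP[q ql qE].
    have [vq q0] := box_valid Hp (al _ ql).
    rewrite (labE _ vq q0) /lab' in qE; move: qE; case: ifP => // /negbT.
    rewrite negb_forall_in => /exists_inP[j jB ja].
    have [k0 k0j] : exists k0, j = Some k0 by case: (j) jB => [k0|]; [exists k0|rewrite (negbTE (none_cube _))].
    have [k ->] := first_max_some (fun i => if Some i \in B then q (Some i) else 0%N) i.
    move=> kmax [ik]; rewrite -ik in kmax.
    apply/negP => iT0; have := kmax k0; rewrite -k0j jB some_cube iT0 /= => h.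
    by move: ja; rewrite -ltnNge ltnNge (leq_trans h).
  rewrite setCS in sub; have /eqP e : T0 == T by rewrite eqEcard sub cT leqnn.
  by rewrite e eqxx in nT.
rewrite eT /=.
transitivity (box N B (fun p => chains #|B| B p
   (fun l => (perm_eq (map lab' l) (None :: enum B))%:R * (u \in orb g T0 v)%:R))); last first.
  rewrite (eq_box (psi2 := fun p => (u \in orb g T0 v)%:R *
     chains #|B| B p (fun l => (perm_eq (map lab' l) (None :: enum B))%:R))); last first.
    by move=> p _; rewrite -chainsZ; apply: eq_chains => l; rewrite mulrC.
  rewrite /box -mulr_sumr -/(box N B (fun p => chains #|B| B p
     (fun l => (perm_eq (map lab' l) (None :: enum B))%:R))).
  pose rk (x : option 'I_d) := if x is Some i then i.+1 else 0%N.
  rewrite (@rainbow_box _ rk None B N a) ?mulr1 //.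
  - by move=> [x|] [y|] //= [] /val_inj ->.
  - exact: none_cube.
  - by move=> p H; rewrite /lab'; case: ifP => // /forall_inP[].
  - move=> p [j jB ja]; rewrite /lab'; case: ifP => [/forall_inP/(_ _ jB)|_]; first by rewrite leqNgt ja.
    have [k0 k0j] : exists k0, j = Some k0 by case: (j) jB => [k0|]; [exists k0|rewrite (negbTE (none_cube _))].
    by have [k ->] := first_max_some (fun i => if Some i \in B then p (Some i) else 0%N) k0.
  - move=> p [i|] iB pa pm pmin; last by rewrite (negbTE (none_cube _)) in iB.
    rewrite /lab'; case: ifP => [/forall_inP/(_ _ iB)|_]; first by rewrite pa ltnn.
    apply: first_max_uniq; apply/forallP => k; rewrite iB pa.
    apply/andP; split; first by case: ifP => // kB; apply: pm.
    apply/implyP => ki; case: ifP => // kB; rewrite ltEnat /= ltn_neqAle pm // andbT.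
    by apply/negP => /eqP e; have := pmin _ kB e; rewrite /= ltnS leqNgt ki.
apply: eq_box => p Hp; apply: eq_chains_in => // l sl /allP al.
rewrite /rainbow.
have -> : map (lab u) l = map lab' l.
  by apply/eq_in_map => q /al /(box_valid Hp)[]; exact: labE.
have pE : perm_eq (colours T0) (None :: enum B).
  rewrite perm_cons; apply: uniq_perm; rewrite ?enum_uniq // ?map_inj_uniq ?enum_uniq //; first by move=> x y [].
  move=> y; rewrite mem_enum; apply/mapP/imsetP => -[i iT ->]; exists i => //.
    by rewrite -mem_enum.
  by rewrite mem_enum.
rewrite (permPr pE).
case: (boolP (perm_eq _ _)) => [pm|_]; last by rewrite mul0r.
rewrite mul1r /=; congr ((nat_of_bool _)%:R).
case: l sl al pm => [//|q l] sl al pm; rewrite [head _ _]/=.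
have [vq q0] := box_valid Hp (al q (mem_head _ _)).
have qf : on_face q by apply: face_of T0n (zeroB _ q0).
have [_] := baseH uC vq qf (q0 _ (none_cube _)).
have -> : [set i | q (Some i) == 0%N] = T0; last first.
  by move=> h; rewrite -!(orb_eq gK) (orb_eqP gK h) eq_sym.
(* The first point of a rainbow chain is interior to the face: each direction outside [T0] is a
   label, hence some point of the chain exceeds [a > 0] there, and points of one cube differ by at
   most 1. *)
apply/setP => i; rewrite inE; apply/eqP/idP => [qi|]; last exact: (zeroB _ q0).
apply: contraTT isT => iT; move/perm_mem/(_ (Some i)): pm.
have -> : Some i \in None :: enum B by rewrite in_cons mem_enum some_cube iT orbT.
move=> /mapP[q' q'l q'E].
have [vq' q'0] := box_valid Hp (al _ q'l).
have h1 : (a < q' (Some i))%N.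
  move: q'E; rewrite /lab'; case: ifP => // /negbT; rewrite negb_forall_in => /exists_inP[j jB ja].
  have [k0 k0j] : exists k0, j = Some k0 by case: (j) jB => [k0|]; [exists k0|rewrite (negbTE (none_cube _))].
  have [k -> kmax [ik]] := first_max_some (fun i => if Some i \in B then q' (Some i) else 0%N) i.
  rewrite -ik in kmax; have := kmax k0; rewrite -k0j jB some_cube iT; apply: leq_trans.
  by rewrite ltnNge.
have /forallP/(_ (Some i))/andP[g1 _] := al q (mem_head _ _).
have /forallP/(_ (Some i))/andP[_ g2] := al _ q'l.
move: g1; rewrite qi leqn0 => /eqP p0; have := leq_trans h1 g2; rewrite p0 add0n.
by case: (_ \in _) => //=; rewrite ltnS leqNgt a_gt0.
Qed.



Lemma cube_dirs_face T0 k : k \notin T0 -> prism_dirs T0 :\ Some k = prism_dirs (k |: T0).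
Proof.
move=> kT; apply/setP => -[i|]; rewrite !inE ?orbT // !some_cube !inE.
by case: (altP (i =P k)) => [->|ik]; rewrite ?(inj_eq (@Some_inj _)) ?eqxx ?ik //= (negbTE ik).
Qed.

Lemma prism_none T0 : prism_dirs T0 :\ None = cube_dirs T0.
Proof. by rewrite /prism_dirs setU1K // none_cube. Qed.

(** Crossing a wall in [T1] changes neither labels nor orthants at points lying on that wall. *)
Lemma wall_sum_inv T1 T v u u' : u \in C -> u' \in orb g T1 u -> T1 != set0 ->
  wall_sum T1 T v u' = wall_sum T1 T v u.
Proof.
move=> uC u'u T1n.
suff [] : u' \in C /\ wall_sum T1 T v u' = wall_sum T1 T v u by [].
apply: (@orb_ind _ _ _ _ _ _ (fun u' => u' \in C /\ wall_sum T1 T v u' = wall_sum T1 T v u) _ _ u'u);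
  last by [].
move=> k w kT [wC <-]; split; first exact: orb_trans wC (orb_step _ _ _).
apply: eq_box => p Hp; apply: eq_chains_in => // l sl /allP al.
have vz q : q \in l -> valid q /\ q (Some k) = 0%N.
  move=> /al /(box_valid Hp)[vq qz]; split => //; apply: qz.
  by rewrite !inE some_cube kT.
rewrite /rainbow; congr ((nat_of_bool (_ && _))%:R).
  congr perm_eq; apply/eq_in_map => q /vz[vq qk].
  by have [] := glueH wC vq qk.
case: l sl vz {al} => [//|q l] _ vz /=; have [vq qk] := vz q (mem_head _ _).
by have [_ ->] := glueH wC vq qk.
Qed.

(** Of the outer faces, the bottom gives the base count, the top and the far sides lack the label
    [None], and the sides at 0 are the walls. *)
Lemma prism_stokes T0 T v u : u \in C -> T0 != set0 -> #|T| = #|T0| ->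
  box N (prism_dirs T0) (fun p => chains #|prism_dirs T0| (prism_dirs T0) p (delta (rb u T v))) =
  ((T == T0) && (u \in orb g T v))%:R + \sum_(k in ~: T0) wall_sum (k |: T0) T v u.
Proof.
move=> uC T0n cT.
rewrite card_prism_dirs stokes ?card_prism_dirs //.
rewrite (bigD1 None) /=; last by rewrite !inE eqxx.
congr (_ + _).
  rewrite prism_none boxD -[RHS]addr0; congr (_ + _).
    by rewrite -(card_cube_dirs T0); apply: base_box.
  rewrite (eq_box (psi2 := fun=> 0)); first by rewrite /box big1.
  move=> p Hp; apply: chains_far => [|q qc]; first by rewrite card_cube_dirs.
  have [vp p0] : valid (setp p None N) /\ (forall j, j \notin prism_dirs T0 -> setp p None N j = 0%N).
    split; first apply/forallP => j; rewrite ?ffunE.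
      by case: eqP => // _; have := Hp j; case: ifP => [_ /ltnW|_ /eqP ->].
    move=> j; rewrite !inE negb_or ffunE => /andP[/negbTE -> jB].
    by have := Hp j; rewrite (negbTE jB) => /eqP.
  have qE j : j \notin cube_dirs T0 -> q j = setp p None N j.
    move=> jB; have /forallP/(_ j) := qc; rewrite (negbTE jB) addn0 => h.
    by apply/eqP; rewrite eqn_leq andbC.
  have vq : valid q.
    apply/forallP => j; have [jB|jB] := boolP (j \in cube_dirs T0); last by rewrite qE // (forallP vp).
    have /forallP/(_ j)/andP[_] := qc; rewrite jB ffunE => h; apply: leq_trans h _.
    have := Hp j; rewrite jB; case: j jB => [j|]; last by rewrite (negbTE (none_cube _)).
    by rewrite addn1.
  apply: topH => //; last by rewrite qE ?none_cube // ffunE eqxx.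
  apply: face_of T0n _ => j jT; rewrite qE ?some_cube ?jT //.
  by apply: p0; rewrite !inE some_cube jT.
rewrite (eq_bigl (mem (cube_dirs T0))); last first.
  move=> i; rewrite !inE; case: (altP (i =P None)) => [->|] /=; last by rewrite andbT.
  by rewrite (negbTE (none_cube _)).
rewrite big_imset /=; last by move=> x y _ _ [].
apply: eq_bigr => k; rewrite inE => kT.
have cw : (d - #|T0|)%N = #|prism_dirs (k |: T0)|.
  rewrite card_prism_dirs cardsU1 kT; have : (#|k |: T0| <= d)%N by rewrite -[X in (_ <= X)%N]card_ord max_card.
  by rewrite cardsU1 kT => h; rewrite -subSn // add1n subSS.
rewrite cube_dirs_face // boxD cw -[RHS]addr0; congr (_ + _).
rewrite (eq_box (psi2 := fun=> 0)); first by rewrite /box big1.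
move=> p Hp; apply: chains_far => // q qc.
have kA : Some k \notin prism_dirs (k |: T0) by rewrite !inE some_cube !inE eqxx.
have qk : q (Some k) = N.
  have /forallP/(_ (Some k)) := qc; rewrite (negbTE kA) addn0 ffunE eqxx => h.
  by apply/eqP; rewrite eqn_leq andbC.
have vq : valid q.
  apply/forallP => j; have /forallP/(_ j)/andP[_] := qc; rewrite ffunE => h; apply: leq_trans h _.
  case: eqP => [->|_]; first by rewrite (negbTE kA) addn0.
  by have := Hp j; case: ifP => [_|_ /eqP ->]; rewrite ?addn1 ?addn0.
apply: (@farH _ _ k) => //.
apply: face_of T0n _ => j jT.
have jA : Some j \notin prism_dirs (k |: T0) by rewrite !inE some_cube !inE jT orbT.
have /forallP/(_ (Some j))/andP[_] := qc; rewrite (negbTE jA) addn0 ffunE.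
have /negbTE -> : Some j != Some k by apply: contraTneq jT => -[->].
by have := Hp (Some j); rewrite (negbTE jA) => /eqP -> ; rewrite leqn0 => /eqP.
Qed.

(** The preimage [w] of a cycle [z] counts, in the prisms over [z], the rainbow simplices for sets
    of one colour less. Summing Stokes' formula against [z], the bottom returns [z], and the walls
    collect the boundary of [z], which is 0. *)
Theorem sperner_exact j : (0 < j)%N -> exact_at g v0 j.
Proof.
move=> j0 z zK.
pose w T' u' : 'F_2 := \sum_(T0 : {set 'I_d} | #|T0| == j) \sum_(u in C) z T0 u *
  box N (prism_dirs T0) (fun p => chains #|prism_dirs T0| (prism_dirs T0) p
    (fun l => (perm_eq (map (lab u) l) (colours T') && (nu u (head x0 l) == u'))%:R)).
have nz (T0 : {set 'I_d}) : #|T0| == j -> T0 != set0 by rewrite -card_gt0 => /eqP ->.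
exists w => T v cT vC.
transitivity (\sum_(T0 : {set 'I_d} | #|T0| == j) \sum_(u in C) z T0 u *
  box N (prism_dirs T0) (fun p => chains #|prism_dirs T0| (prism_dirs T0) p (delta (rb u T v)))).
  rewrite /w; under eq_bigr do rewrite exchange_big /=.
  rewrite exchange_big /=; apply: eq_bigr => T0 cT0.
  under eq_bigr do rewrite exchange_big /=.
  rewrite exchange_big /=; apply: eq_bigr => u uC.
  under eq_bigr do rewrite -mulr_sumr -box_sum.
  rewrite -mulr_sumr -box_sum; congr (_ * _); apply: eq_box => p Hp.
  rewrite -[LHS](eq_bigr _ (fun i _ => chains_sum _ _ _ _ _ _)) -chains_sum.
  apply: eq_chains_in => // l sl /allP al.
  rewrite delta_rainbow; first last.
  - move=> m ml pm; have sub := deletions_sub ml.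
    have mE : m != [::].
      by apply: contraTneq pm => ->; apply/negP => /perm_size.
    have hm : head x0 m \in l by case: m mE {ml pm} sub => //= q m _; apply; exact: mem_head.
    have hl : head x0 l \in l by case: (l) sl => //= q l' _; exact: mem_head.
    have coh := @cohH u p (prism_dirs T0) T l uC _ _ _.
    have coh' : forall x y, x \in l -> y \in l -> nu u y \in orb g T (nu u x).
      apply: coh.
      + apply/allP => q /al /(box_valid Hp)[-> qz] /=; apply: face_of (nz _ cT0) _ => i iT.
        by apply: qz; rewrite !inE some_cube iT.
      + exact/allP.
      + move=> i iT; have : Some i \in map (lab u) m.
          by rewrite (perm_mem pm) -[_ \in _]negbK notin_colours iT.
        by move=> /mapP[q /sub ql ->]; apply: map_f.
    by apply/idP/idP => h; apply: (orb_trans h); apply: coh'.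
  - exact: colours_uniq.
  rewrite (eq_bigl (mem [set Some i | i in T])); last first.
    move=> y; rewrite notin_colours inE; apply/idP/imsetP => [|[i iT ->] //].
    by case: y => // i iT; exists i.
  rewrite big_imset /=; last by move=> x y _ _ [].
  apply: eq_bigr => i iT; rewrite /rainbow (permPr (colours_D1 iT)).
  case: (perm_eq _ _) => /=; last by rewrite big1.
  case: (boolP (nu u (head x0 l) \in orb g T v)) => h.
    by rewrite (bigD1 (nu u (head x0 l))) //= eqxx big1 ?addr0 // => u' /andP[_]; rewrite eq_sym => /negbTE ->.
  by rewrite big1 // => u' u'T; case: eqP => // e; rewrite e u'T in h.
rewrite (eq_bigr (fun T0 : {set 'I_d} => \sum_(u in C) z T0 u * (((T == T0) && (u \in orb g T v))%:R +
  \sum_(k in ~: T0) wall_sum (k |: T0) T v u))); last first.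
  move=> T0 cT0; apply: eq_bigr => u uC; rewrite prism_stokes ?(nz T0) //.
  by rewrite cT (eqP cT0).
under eq_bigr do (under eq_bigr do rewrite mulrDr; rewrite big_split /=).
rewrite big_split /= [X in _ + X](_ : _ = 0) ?addr0.
  rewrite (bigD1 T) ?cT //= [X in _ + X]big1 ?addr0 => [|T0 /andP[_ /negbTE nT]]; last first.
    by rewrite big1 // => u _; rewrite eq_sym nT mulr0.
  rewrite eqxx /= [RHS]big_mkcond [LHS]big_mkcond /=; apply: eq_bigr => u _.
  case: (boolP (u \in orb g T v)) => [uv|_]; last by rewrite mulr0; case: ifP.
  by rewrite (orb_closed gK v0 uv) vC mulr1.
(* Regrouping by [T1 = k |: T0] factors out the boundary of [z] at [T1]. *)
transitivity (\sum_(T1 : {set 'I_d} | #|T1| == j.+1) \sum_(u in C)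
   wall_sum T1 T v u * \sum_(k in T1) z (T1 :\ k) u).
  rewrite exchange_big [RHS]exchange_big /=; apply: eq_bigr => u uC.
  under eq_bigr do rewrite mulr_sumr.
  under [RHS]eq_bigr do rewrite mulr_sumr.
  rewrite !pair_big_dep /= [RHS](reindex_onto (fun x => (x.2 |: x.1, x.2)) (fun x => (x.1 :\ x.2, x.2))) /=; last first.
    by move=> [T1 k] /= /andP[_ kT]; rewrite setD1K.
  apply: eq_big => [[T0 k]|[T0 k]] /=; rewrite ?inE; last first.
    move=> /andP[_ kT]; rewrite setU1K // mulrC //.
  rewrite eqxx /= andbT cardsU1; apply/andP/andP => [[/eqP <- kT]|[/eqP c /eqP[e]]].
    by rewrite kT add1n eqxx setU1K // eqxx.
  have kT : k \notin T0 by rewrite -e !inE eqxx.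
  by move: c; rewrite kT add1n => -[->].
rewrite big1 // => T1 /eqP cT1.
have T1n : T1 != set0 by rewrite -card_gt0 cT1.
rewrite (partition_big (orb g T1) (fun K => K \in orb g T1 @: C)) /=; last first.
  by move=> u uC; apply/imsetP; exists u.
rewrite big1 // => K /imsetP[u0 u0C ->].
rewrite (eq_bigr (fun u => wall_sum T1 T v u0 * \sum_(k in T1) z (T1 :\ k) u)); last first.
  move=> u /andP[uC]; rewrite (orb_eq gK) (orb_sym gK) => uu; congr (_ * _).
  by apply: wall_sum_inv.
rewrite -mulr_sumr -[RHS](mulr0 (wall_sum T1 T v u0)); congr (_ * _).
rewrite -[RHS](zK T1 u0 cT1 u0C) exchange_big /=; apply: eq_bigr => k kT1.
apply: eq_bigl => u; rewrite (orb_eq gK) [u0 \in _](orb_sym gK); apply: andb_idl => h.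
by rewrite (orb_closed gK v0 h).
Qed.

End SpernerExact.

(** * Counting permutations by number of cycles *)

Section PermutationCounting.
Local Open Scope nat_scope.
Import GroupScope.

Lemma card_bigcup_le (J W : finType) (P : pred J) (A : J -> {set W}) :
  #|\bigcup_(j | P j) A j| <= \sum_(j | P j) #|A j|.
Proof.
apply: (big_ind2 (fun (X : {set W}) k => #|X| <= k)) => [|X k Y m Xk Ym|//].
  by rewrite cards0.
by apply: leq_trans (leq_add Xk Ym); rewrite cardsU leq_subr.
Qed.

Section Cycles.
Variable T : finType.
Implicit Types (s t : {perm T}) (x y a b : T) (l : seq T) (c : {ffun T -> option T}).
Local Notation n := #|T|.

Definition cyc s := #|porbits s|.

Lemma cyc_tperm_mul s x y :
  cyc (tperm x y * s) + (x \notin porbit s y).*2 = cyc s + (x != y).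
Proof. exact: porbits_mul_tperm. Qed.

Lemma cyc_mul_tperm s x y :
  cyc (s * tperm x y) + (x \notin porbit s y).*2 = cyc s + (x != y).
Proof.
by rewrite /cyc -porbitsV invMg tpermV -(porbitsV s) -(porbitV s y) porbits_mul_tperm.
Qed.

Lemma cyc_tperm_le s x y : cyc (tperm x y * s) <= (cyc s).+1.
Proof. by have := cyc_tperm_mul s x y; case: (_ != _); case: (_ \notin _) => /=; lia. Qed.

Lemma cyc1 : cyc 1 = n.
Proof.
rewrite /cyc /porbits card_imset // => x y /eqP.
by rewrite eq_porbit_mem => /porbitP[i ->]; rewrite expg1n perm1.
Qed.

Lemma porbit_step s x : s x \in porbit s x.
Proof. by have := mem_porbit s 1 x; rewrite expg1. Qed.

Lemma cyc_remove s x : cyc (s * tperm x (s x)) = cyc s + (s x != x).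
Proof.
have := cyc_mul_tperm s x (s x); rewrite porbit_sym porbit_step /= addn0.
by rewrite eq_sym.
Qed.

Lemma remove_fix s x : (s * tperm x (s x)) x = x.
Proof. by rewrite permM tpermR. Qed.

Lemma remove_fixes s x y : s y = y -> (s * tperm x (s x)) y = y.
Proof.
move=> sy; rewrite permM sy; case: tpermP => // [<- //|e].
by apply: (@perm_inj _ s); rewrite sy.
Qed.

(** A code gives some points [a] a partner [c a], hence a transposition, multiplied in the order of
    a fixed list. Codes of weight [r] number at most 2^n n^r, so weights become exponents of n. *)
Definition dec (c : {ffun T -> option T}) a : {perm T} := if c a is Some b then tperm a b else 1.

Definition decode l c : {perm T} := \prod_(a <- l) dec c a.

Definition weight c := #|[set a | c a]|.

Definition upd c a b : {ffun T -> option T} := [ffun z => if z == a then Some b else c z].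

Lemma decode_upd l c a b : a \notin l -> decode l (upd c a b) = decode l c.
Proof.
move=> al; rewrite /decode; apply: eq_big_seq => z zl.
by rewrite /dec ffunE; case: eqP => // e; rewrite e in zl; rewrite zl in al.
Qed.

Lemma weight_upd c a b : c a = None -> weight (upd c a b) = (weight c).+1.
Proof.
move=> ca; rewrite /weight (cardsD1 a) inE ffunE eqxx add1n; congr _.+1.
by apply: eq_card => z; rewrite !inE ffunE; case: eqP => [->|]; rewrite ?ca.
Qed.

Definition supported l c := forall a, a \notin l -> c a = None.

(** Multiplying by [tperm x (s x)] takes [x] out of its cycle, which adds one cycle unless [x] was
    already fixed. *)
Lemma removal_code l s : uniq l ->
  exists c, [/\ supported l c, cyc (s * decode l c) = cyc s + weight c,
   (forall x, x \in l -> (s * decode l c) x = x) &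
   (forall x, s x = x -> (s * decode l c) x = x)].
Proof.
elim: l s => [|a l IH] s /=.
  exists [ffun=> None]; rewrite /decode big_nil mulg1; split => // [x|]; first by rewrite ffunE.
  rewrite (_ : weight _ = 0) ?addn0 //; apply/eqP; rewrite cards_eq0; apply/eqP/setP => x.
  by rewrite !inE ffunE.
move=> /andP[al ul].
have [sa|sa] := eqVneq (s a) a.
  have [c [c1 c2 c3 c4]] := IH s ul; exists c.
  have ca : c a = None by apply: c1.
  have -> : decode (a :: l) c = decode l c by rewrite /decode big_cons /dec ca mul1g.
  split => // [x|x]; first by rewrite inE negb_or => /andP[_]; apply: c1.
  by rewrite inE => /orP[/eqP ->|/c3//]; apply: c4.
have [c [c1 c2 c3 c4]] := IH (s * tperm a (s a)) ul; exists (upd c a (s a)).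
have ca : c a = None by apply: c1.
have -> : s * decode (a :: l) (upd c a (s a)) = s * tperm a (s a) * decode l c.
  by rewrite {1}/decode big_cons {1}/dec ffunE eqxx -/(decode l _) decode_upd // mulgA.
split => [x| |x|x sx].
- by rewrite inE negb_or ffunE => /andP[/negbTE -> ]; apply: c1.
- by rewrite c2 cyc_remove sa addn1 weight_upd // addnS.
- by rewrite inE => /orP[/eqP ->|/c3//]; apply: c4; rewrite remove_fix.
- by apply: c4; apply: remove_fixes.
Qed.

Lemma perm_code s : exists2 c, s * decode (enum T) c = 1 & n = cyc s + weight c.
Proof.
have [c [_ c2 c3 _]] := @removal_code (enum T) s (enum_uniq _); exists c.
  by apply/permP => x; rewrite perm1 c3 // mem_enum.
rewrite -c2 (_ : s * _ = 1) ?cyc1 //.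
by apply/permP => x; rewrite perm1 c3 // mem_enum.
Qed.

Lemma cyc_decode_mul l c s : uniq l -> cyc (decode l c * s) <= cyc s + weight c.
Proof.
move=> ul; have: cyc (decode l c * s) <= cyc s + count (fun a => c a) l.
  elim: l {ul} => [|a l IH]; first by rewrite /decode big_nil mul1g leq_addr.
  rewrite /decode big_cons /dec /= -mulgA -/(decode l c); case: (c a) => [b|] /=; last by rewrite mul1g.
  by apply: leq_trans (cyc_tperm_le _ _ _) _; rewrite addnS ltnS.
move/leq_trans; apply; rewrite leq_add2l /weight -size_filter.
rewrite -(card_uniqP (filter_uniq _ ul)); apply/subset_leq_card/subsetP => z.
by rewrite mem_filter inE => /andP[].
Qed.

(** The number of points minus the number of cycles is the length in transpositions, and each
    transposition changes the number of cycles by at most 1. *)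
Lemma cyc_triangle s t : cyc s + cyc t <= n + cyc (s * t).
Proof.
have [c c1 c2] := perm_code s.
have E : t = decode (enum T) c * (s * t).
  have -> : s = (decode (enum T) c)^-1.
    by rewrite -[LHS]mulg1 -(mulgV (decode (enum T) c)) mulgA c1 mul1g.
  by rewrite mulKVg.
have := @cyc_decode_mul (enum T) c (s * t) (enum_uniq _).
rewrite -E; lia.
Qed.

Lemma cyc_n s : cyc s = n -> s = 1.
Proof.
have [c c1 c2] := perm_code s => cn.
have /eqP : weight c = 0 by lia.
rewrite cards_eq0 => /eqP/setP c0.
move: c1; rewrite (_ : decode _ _ = 1) ?mulg1 //.
rewrite /decode big1 // => a _; rewrite /dec.
by have := c0 a; rewrite !inE; case: (c a).
Qed.

Lemma card_codes r : #|[set c : {ffun T -> option T} | weight c == r]| <= 2 ^ n * n ^ r.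
Proof.
rewrite (_ : [set c | _] = \bigcup_(A : {set T} | #|A| == r) [set c : {ffun T -> option T} | [set a | c a] == A]); last first.
  apply/setP => c; rewrite inE; apply/idP/bigcupP => [h|[A hA]].
    by exists [set a | c a]; rewrite ?inE.
  by rewrite inE => /eqP; rewrite /weight => ->.
apply: (leq_trans (card_bigcup_le _ _)) => /=.
apply: (@leq_trans (\sum_(A : {set T} | #|A| == r) n ^ r)).
  apply: leq_sum => A /eqP <-.
  have -> : n = #|predC1 (@None T)|.
    have := cardC1 (@None T); rewrite card_option /= => ->; by [].
  rewrite -(card_pffun_on None); apply/subset_leq_card/subsetP => c; rewrite inE => /eqP cA.
  apply/pffun_onP; split.
    by apply/subsetP => a; rewrite -cA !inE; case: (c a).
  by move=> y /imageP[a]; rewrite -cA !inE; case: (c a) => // b _ ->.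
rewrite sum_nat_const leq_mul2r; apply/orP; right.
rewrite -cardsT -card_powerset; apply/subset_leq_card/subsetP => A _.
by rewrite powersetE subsetT.
Qed.

Lemma card_cyc r : #|[set s : {perm T} | cyc s + r == n]| <= 2 ^ n * n ^ r.
Proof.
apply: leq_trans (card_codes r).
apply: leq_trans (leq_imset_card (fun c => (decode (enum T) c)^-1) _).
apply/subset_leq_card/subsetP => s; rewrite inE => /eqP cs.
have [c c1 c2] := perm_code s; apply/imsetP; exists c.
  by rewrite inE -(eqn_add2l (cyc s)) -c2 cs.
by rewrite -[LHS]mulg1 -(mulgV (decode (enum T) c)) mulgA c1 mul1g.
Qed.

End Cycles.

(** * Pairs of permutations of genus zero *)

Section Joins.
Variable T : finType.
Implicit Types (s t r : {perm T}) (x y a b : T) (l : seq T) (c : {ffun T -> option T}).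
Local Notation n := #|T|.

Lemma porbit_trans s x y z : y \in porbit s x -> z \in porbit s y -> z \in porbit s x.
Proof. by rewrite -!eq_porbit_mem => /eqP <- /eqP <-. Qed.

Lemma porbit_sub s (P : T -> Prop) x :
  (forall z, P z -> P (s z)) -> P x -> forall y, y \in porbit s x -> P y.
Proof.
move=> Ps Px y /porbitP[i ->]; elim: i => [|i IH]; first by rewrite expg0 perm1.
by rewrite expgSr permM; apply: Ps.
Qed.

Lemma porbit_join s x y : x \notin porbit s y ->
  [/\ cyc (s * tperm x y) + 1 = cyc s, y \in porbit (s * tperm x y) x &
   forall u v, u \in porbit s v -> u \in porbit (s * tperm x y) v].
Proof.
move=> xy; have nxy : x != y by apply: contraNneq xy => ->; exact: porbit_id.
have := cyc_mul_tperm s x y; rewrite xy nxy /= => E1.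
have E : cyc (s * tperm x y) + 1 = cyc s by lia.
have yx : y \in porbit (s * tperm x y) x.
  have := cyc_mul_tperm (s * tperm x y) x y; rewrite -mulgA tperm2 mulg1 nxy porbit_sym.
  by case: (_ \in _) => //=; lia.
split => // u v; apply: (porbit_sub (P := fun u => u \in porbit (s * tperm x y) v));
  last exact: porbit_id.
move=> z zv; have := porbit_trans zv (porbit_step _ _); rewrite permM.
case: tpermP => [-> h|-> h|//].
  by apply: porbit_trans h _; rewrite porbit_sym.
exact: porbit_trans h yx.
Qed.

Lemma inv_tperm (X : Type) (k : T -> X) a b : k a = k b -> forall z, k (tperm a b z) = k z.
Proof. by move=> e z; case: tpermP => // ->. Qed.

(** If [r a] lies outside the [s]-cycle of [a], then [tperm a (r a)] merges two cycles of [s] and at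
    the same time splits [a] off its cycle of [r]. Once no such [a] is left, [r] preserves the
    cycles of [s]. *)
Lemma join_code (X : Type) (k : T -> X) l s r : uniq l ->
  (forall x, k (s x) = k x) -> (forall x, k (r x) = k x) ->
  exists c, let p := decode l c in
  [/\ supported l c, cyc (s * p) + weight c = cyc s, cyc (r * p) = cyc r + weight c &
   [/\ forall x, x \in l -> (r * p) x \in porbit (s * p) x,
   forall x, r x \in porbit s x -> (r * p) x \in porbit (s * p) x,
   forall x, k ((s * p) x) = k x &
   forall u v, u \in porbit s v -> u \in porbit (s * p) v]].
Proof.
elim: l s r => [|a l IH] s r /=.
  exists [ffun=> None]; rewrite /decode big_nil !mulg1.
  rewrite (_ : weight _ = 0) ?addn0; last first.
    by apply/eqP; rewrite cards_eq0; apply/eqP/setP => x; rewrite !inE ffunE.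
  by split => // x; rewrite ffunE.
move=> /andP[al ul] ks kr.
have [sa|sa] := boolP (r a \in porbit s a).
  have [c [c1 c2 c3 [c4 c5 c6 c7]]] := IH s r ul ks kr; exists c.
  have ca : c a = None by apply: c1.
  have -> : decode (a :: l) c = decode l c by rewrite /decode big_cons /dec ca mul1g.
  split => //; first by move=> x; rewrite inE negb_or => /andP[_]; apply: c1.
  by split => // x; rewrite inE => /orP[/eqP ->|/c4//]; apply: c5.
have [|j1 j2 j3] := @porbit_join s a (r a); first by rewrite porbit_sym.
pose t := tperm a (r a).
have kt z : k (t z) = k z by apply: inv_tperm.
have [||c [c1 c2 c3 [c4 c5 c6 c7]]] := IH (s * t) (r * t) ul.
- by move=> x; rewrite permM kt.
- by move=> x; rewrite permM kt.
exists (upd c a (r a)).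
have ca : c a = None by apply: c1.
have E u : u * decode (a :: l) (upd c a (r a)) = u * t * decode l c.
  by rewrite {1}/decode big_cons {1}/dec ffunE eqxx -/(decode l _) decode_upd // mulgA.
have ra : r a != a by apply: contraNneq sa => ->; exact: porbit_id.
split; rewrite ?E.
- by move=> x; rewrite inE negb_or ffunE => /andP[/negbTE -> ]; apply: c1.
- by rewrite weight_upd //; rewrite -/t in j1; lia.
- by rewrite c3 cyc_remove ra weight_upd //; lia.
split; rewrite ?E.
- move=> x; rewrite inE => /orP[/eqP ->|/c4//]; apply: c5.
  by rewrite remove_fix porbit_id.
- move=> x rx; apply: c5; rewrite permM.
  case: tpermP => [e|e|_ _]; last exact: j3.
    by apply: porbit_trans j2; apply: j3; rewrite -e.
  by case/negP: sa; move: rx; rewrite e (perm_inj e).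
- by move=> x; rewrite c6.
- by move=> u v uv; apply/c7/j3.
Qed.

(** The geodesics from 1 to [s] for the length in transpositions; for a single cycle these are the
    noncrossing partitions. *)
Definition noncrossing s : {set {perm T}} := [set t | cyc t + cyc (t^-1 * s) == n + cyc s].

(** The equation is Euler's formula of genus zero on each of the [o] common orbits, which are the
    levels of [k]. Merging the cycles of [s] into orbits takes [cyc s - o] transpositions, each
    adding a cycle to [t^-1 * s]; the result is equality in [cyc_triangle]. *)
Lemma planar_code (X : finType) (k : T -> X) o s t :
  (forall x, k (s x) = k x) -> (forall x, k (t x) = k x) ->
  (forall f : T -> {set T}, (forall x, f (s x) = f x) -> (forall x, f (t x) = f x) ->
     forall x y, k x = k y -> f x = f y) ->
  #|[set k x | x in setT]| = o ->
  cyc s + cyc t + cyc (t^-1 * s) = n + 2 * o ->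
  exists2 c, weight c + o = cyc s & t \in noncrossing (s * decode (enum T) c).
Proof.
move=> ks kt kmin ko E.
have kr x : k ((t^-1 * s) x) = k x by rewrite permM ks -[in RHS](permKV t x) kt.
have [c [_ c2 c3 [c4 _ c6 c7]]] := join_code (enum_uniq T) ks kr.
set s' := s * _ in c2 c4 c6 c7.
have co : cyc s' = o.
  rewrite -ko /cyc /porbits; transitivity #|[set porbit s' x | x in setT]|.
    by apply: eq_card => K; apply/imsetP/imsetP => -[x _ ->]; exists x.
  apply: card_imset_eq => x y _ _; apply/eqP/eqP => [/eqP|kxy].
    rewrite eq_porbit_mem; apply: (porbit_sub (P := fun x => k x = k y)) => // z <-.
    exact: c6.
  have f2 z : porbit s' (s' z) = porbit s' z.
    by apply/eqP; rewrite eq_porbit_mem porbit_step.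
  apply: kmin kxy => z.
    by apply/eqP; rewrite eq_porbit_mem c7 // porbit_step.
  have rz : porbit s' ((t^-1 * s') (t z)) = porbit s' (t z).
    by apply/eqP; rewrite eq_porbit_mem /s' mulgA c4 // mem_enum.
  by rewrite -rz permM permK f2.
exists c; first by rewrite -co addnC.
rewrite inE mulgA c3 co; apply/eqP; lia.
Qed.

Lemma card_planar_le (K w : nat) s (Q : {set {perm T}}) :
  (forall s', #|noncrossing s'| <= K) ->
  (forall t, t \in Q -> exists2 c, weight c = w & t \in noncrossing (s * decode (enum T) c)) ->
  #|Q| <= 2 ^ n * n ^ w * K.
Proof.
move=> HK HQ.
apply: (@leq_trans #|\bigcup_(c in [set c : {ffun T -> option T} | weight c == w])
   noncrossing (s * decode (enum T) c)|).
  apply/subset_leq_card/subsetP => t /HQ[c wc tc]; apply/bigcupP; exists c => //.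
  by rewrite inE wc.
apply: leq_trans (card_bigcup_le _ _) _.
apply: (@leq_trans (\sum_(c in [set c : {ffun T -> option T} | weight c == w]) K)).
  by apply: leq_sum => c _.
by rewrite sum_nat_const leq_mul2r card_codes orbT.
Qed.

End Joins.

Section CatalanBound.
Local Open Scope ring_scope.

(* A closed-form majorant of the Catalan numbers that is stable under their
   quadratic recursion. *)
Definition cat_bound (m : nat) : rat := 16 ^+ m / (m.+1)%:R ^+ 2.

Lemma cat_bound0 : cat_bound 0 = 1.
Proof. by rewrite /cat_bound expr0 expr1n divr1. Qed.

Lemma cat_bound_ge0 m : 0 <= cat_bound m.
Proof. by rewrite /cat_bound mulr_ge0 ?invr_ge0 ?exprn_ge0 ?ler0n. Qed.

Lemma cat_bound_le m : cat_bound m <= 16 ^+ m.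
Proof.
rewrite /cat_bound ler_pdivrMr ?exprn_gt0 ?ltr0n //.
by rewrite ler_peMr ?exprn_ge0 ?ler0n // exprn_ege1 // ler1n.
Qed.

Lemma sum_inv_squares m : \sum_(i < m.+1) ((i.+1)%:R ^- 2 : rat) <= 2 - (m.+1)%:R^-1.
Proof.
elim: m => [|m IH]; first by rewrite big_ord1.
rewrite big_ord_recr /=; apply: (le_trans (lerD IH (lexx _))).
have h : (0 : rat) < (m.+1)%:R by rewrite ltr0n.
have -> : (m.+2)%:R = (m.+1)%:R + 1 :> rat by rewrite -[in LHS]addn1 natrD.
set x : rat := (m.+1)%:R in h *.
rewrite -subr_ge0 (_ : _ - _ = (x * (x + 1) ^+ 2)^-1); last first.
  by clearbody x; field; rewrite !gt_eqF ?addr_gt0.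
by rewrite invr_ge0 mulr_ge0 ?exprn_ge0 ?addr_ge0 // ltW.
Qed.

(** For a + b = m + 2 one has (1/a + 1/b)^2 <= 2 (1/a^2 + 1/b^2). As inverse squares add up to at
    most 2, the sum is at most 8 16^m / (m+2)^2, half of the right-hand side. *)
Lemma cat_bound_conv m :
  \sum_(i < m.+1) cat_bound i * cat_bound (m - i) <= cat_bound m.+1.
Proof.
have S0 : (0 : rat) < (m.+2)%:R by rewrite ltr0n.
apply: (@le_trans _ _ (\sum_(i < m.+1) 2 * 16 ^+ m / (m.+2)%:R ^+ 2 *
   ((i.+1)%:R ^- 2 + ((m - i).+1)%:R ^- 2))).
  apply: ler_sum => i _; rewrite /cat_bound.
  have im : (i <= m)%N by rewrite -ltnS.
  have -> : (16 : rat) ^+ m = 16 ^+ i * 16 ^+ (m - i) by rewrite -exprD subnKC.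
  have -> : (m.+2)%:R = (i.+1)%:R + ((m - i).+1)%:R :> rat.
    by rewrite -natrD; congr (_%:R); lia.
  set a : rat := (i.+1)%:R; set b : rat := ((m - i).+1)%:R.
  have a0 : 0 < a by rewrite ltr0n.
  have b0 : 0 < b by rewrite ltr0n.
  rewrite -subr_ge0 (_ : _ - _ = 16 ^+ i * 16 ^+ (m - i) * ((a - b) / (a * b * (a + b))) ^+ 2).
    by rewrite mulr_ge0 ?sqr_ge0 // mulr_ge0 // exprn_ge0.
  by clearbody a b; field; rewrite !gt_eqF ?addr_gt0.
rewrite -mulr_sumr big_split /=.
rewrite [X in _ * (_ + X)](reindex_inj rev_ord_inj) /=.
rewrite [X in _ * (_ + X)](eq_bigr (fun i : 'I_m.+1 => (i.+1)%:R ^- 2)); last first.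
  by move=> i _; congr (_%:R ^- 2); have := ltn_ord i; lia.
have h := sum_inv_squares m.
have h2 : \sum_(i < m.+1) ((i.+1)%:R ^- 2 : rat) <= 2.
  by apply: (le_trans h); rewrite gerBl invr_ge0.
rewrite /cat_bound.
set x := \sum_(i < m.+1) _ in h2 *.
have p0 : 0 <= (16 : rat) ^+ m by rewrite exprn_ge0.
have q0 : 0 <= ((m.+2)%:R ^+ 2)^-1 :> rat by rewrite invr_ge0 exprn_ge0.
move: p0 q0; set P := _ ^+ m; set q := (_ ^+ 2)^-1 => p0 q0.
rewrite [X in _ <= X](_ : _ = P * q * 16); last by rewrite exprS [RHS]mulrC mulrA.
rewrite [X in X <= _](_ : _ = P * q * (2 * (x + x))); last first.
  by rewrite [RHS]mulrCA !mulrA.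
apply: ler_wpM2l; first exact: mulr_ge0.
lra.
Qed.

End CatalanBound.

(** * A Catalan-type bound for noncrossing permutations *)

Section Noncrossing.
Variable T : finType.
Implicit Types (s t r : {perm T}) (x y z : T) (p : seq T) (ss : seq (seq T)).
Local Notation n := #|T|.

Lemma fpath_mem (f : T -> T) x p v : fpath f x p -> v \in belast x p -> f v \in p.
Proof.
elim: p x => //= y p IH x /andP[/eqP fx pth]; rewrite !inE => /orP[/eqP ->|/(IH _ pth) ->].
  by rewrite fx eqxx.
by rewrite orbT.
Qed.

Lemma fpath_ext (f f' : T -> T) x p : fpath f x p ->
  (forall v, v \in belast x p -> f' v = f v) -> fpath f' x p.
Proof.
elim: p x => //= y p IH x /andP[/eqP fx pth] H.
rewrite H ?inE ?eqxx // fx eqxx /=; apply: IH => // v vp.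
by apply: H; rewrite inE vp orbT.
Qed.

Lemma fcycle_ext (f f' : T -> T) p : fcycle f p ->
  (forall v, v \in p -> f v \in p -> f' v = f v) -> fcycle f' p.
Proof.
case: p => //= x p pth H; apply: (fpath_ext pth) => v; rewrite belast_rcons => vp.
apply: H => //; have := fpath_mem pth; rewrite belast_rcons => /(_ _ vp).
by rewrite mem_rcons.
Qed.

(* Splits the cycle of x at y, then takes y out. *)
Definition split_out s x y : {perm T} := tperm x y * s * tperm y (s x).

(** If [t x] left the [s]-cycle of [x], the transposition would split a cycle of [t] while merging
    two of [s], against [cyc_triangle]. Otherwise splitting and then removing [t x] adds the same
    amount to both sides of the equation. *)
Lemma noncrossing_split s x t : t \in noncrossing s ->
  t x \in porbit s x /\ tperm x (t x) * t \in noncrossing (split_out s x (t x)).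
Proof.
rewrite !inE => /eqP E; set y := t x; set u := tperm x y.
have cu : cyc (u * t) = cyc t + (x != y).
  have := cyc_tperm_mul t x y; rewrite porbit_sym -/(y \in _) porbit_step /= addn0 => <- //.
have rE : (u * t)^-1 * (u * s) = t^-1 * s by rewrite invMg mulgA mulgKV.
have cs := cyc_tperm_mul s x y.
have yx : y \in porbit s x.
  rewrite porbit_sym; apply/negPn/negP => nx; move: cs; rewrite nx /= => cs.
  have nxy : x != y by apply: contraNneq nx => ->; exact: porbit_id.
  have tri : cyc (u * t) + cyc (t^-1 * s) <= n + cyc (u * s).
    by have := cyc_triangle (u * t) (t^-1 * s); rewrite mulgA mulgK.
  have cs' : cyc (u * s) + 2 = cyc s + (x != y) by [].
  move: tri cs'; rewrite cu nxy; lia.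
split=> //.
move: cs; rewrite porbit_sym yx /= addn0 -/u => cs.
have uty : (u * t) y = y by rewrite permM tpermR.
have usy : (u * s) y = s x by rewrite permM tpermR.
have ry : (t^-1 * s) y = s x by rewrite permM permK.
have c1 : cyc (split_out s x y) = cyc (u * s) + (s x != y).
  by have := cyc_remove (u * s) y; rewrite usy.
have c2 : cyc (t^-1 * s * tperm y (s x)) = cyc (t^-1 * s) + (s x != y).
  by have := cyc_remove (t^-1 * s) y; rewrite ry.
have cs' : cyc (u * s) = cyc s + (x != y) by [].
have -> : cyc ((u * t)^-1 * split_out s x y) = cyc (t^-1 * s * tperm y (s x)).
  by rewrite /split_out -/u mulgA rE.
by rewrite c2 c1 cs' cu addnACA E -!addnA (addnC (x != y)).
Qed.

Lemma card_noncrossing_split s x (P : seq T) : uniq P ->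
  (forall y, y \in porbit s x -> y \in P) ->
  #|noncrossing s| <= \sum_(y <- P) #|noncrossing (split_out s x y)|.
Proof.
move=> uP HP; rewrite big_uniq //=.
rewrite [X in X <= _](_ : _ = \sum_(y in P) #|[set t in noncrossing s | t x == y]|); last first.
  rewrite -sum1_card (partition_big (fun t : {perm T} => t x) (fun y => y \in P)) /=.
    by apply: eq_bigr => y _; rewrite -sum1_card; apply: eq_bigl => t; rewrite inE.
  by move=> t tN; apply: HP; case: (noncrossing_split x tN).
apply: leq_sum => y _.
rewrite -(card_imset _ (mulgI (tperm x y))); apply/subset_leq_card/subsetP => _ /imsetP[t tN ->].
by move: tN; rewrite inE => /andP[/(noncrossing_split x)[_ h] /eqP <-].
Qed.

Lemma split_outE s x y v : v != x -> v != y -> s v != y -> split_out s x y v = s v.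
Proof.
move=> vx vy svy; rewrite /split_out !permM tpermD 1?eq_sym // tpermD // 1?eq_sym //.
by apply: contraNneq vx => e; apply/eqP/(@perm_inj _ s).
Qed.

Lemma noncrossing_id s : (forall x, x \notin [::] -> s x = x) -> noncrossing s = [set 1].
Proof.
move=> H; have -> : s = 1 by apply/permP => x; rewrite perm1 H.
apply/setP => t; rewrite !inE mulg1 cyc1.
have -> : cyc t^-1 = cyc t by rewrite /cyc porbitsV.
apply/eqP/eqP => [h|->]; last by rewrite cyc1.
by apply: cyc_n; lia.
Qed.

(** The Catalan recursion over the value [y] at the first point of a cycle. The measure counts
    points twice because a step removes one point but may create one more cycle. *)
Lemma card_noncrossing_cycles m ss s : 2 * size (flatten ss) + size ss <= m ->
  uniq (flatten ss) -> all (fcycle s) ss -> (forall x, x \notin flatten ss -> s x = x) ->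
  ((#|noncrossing s|)%:R <= \prod_(p <- ss) cat_bound (size p))%R.
Proof.
elim: m ss s => [|m IH] ss s.
  rewrite leqn0 addn_eq0 => /andP[_ /nilP ->] _ _ H.
  by rewrite big_nil (noncrossing_id H) cards1.
case: ss => [|[|x p] ss] /=.
- by move=> _ _ _ H; rewrite big_nil (noncrossing_id H) cards1.
- rewrite addnS ltnS => hm us hs H; rewrite big_cons cat_bound0 mul1r; exact: IH.
rewrite -cat_cons -[_ && uniq _]/(uniq ((x :: p) ++ flatten ss)) => hm us /andP[hx hs] H.
have [uxp dis uss] : [/\ uniq (x :: p), forall v, v \in flatten ss -> v \notin x :: p & uniq (flatten ss)].
  move: us; rewrite cat_uniq => /and3P[-> /hasPn h ->]; split => // v vs; exact: h.
have xss q v : q \in ss -> v \in q -> v \notin x :: p.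
  by move=> qs vq; apply: dis; apply/flattenP; exists q.
have orbx y : y \in porbit s x -> y \in x :: p.
  apply: (porbit_sub (P := fun y => y \in x :: p)) => [v vp|]; last exact: mem_head.
  have := fpath_mem hx; rewrite belast_rcons => /(_ _ vp).
  by rewrite mem_rcons.
have others y : y \in x :: p -> all (fcycle (split_out s x y)) ss.
  move=> yp; apply/allP => q qs; apply: (fcycle_ext (allP hs _ qs)) => v vq svq.
  have h := xss _ _ qs; apply: split_outE.
  - by apply: contraNneq (h _ vq) => ->; exact: mem_head.
  - by apply: contraNneq (h _ vq) => ->.
  - by apply: contraNneq (h _ svq) => ->.
have fixed y : y \in x :: p -> split_out s x y y = y.
  by move=> _; rewrite /split_out !permM tpermR tpermR.
have outside y v : y \in x :: p -> v \notin (x :: p) ++ flatten ss -> split_out s x y v = v.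
  move=> yp vn; have sv := H _ vn; rewrite split_outE ?sv //; apply: contraNneq vn => ->;
    by rewrite mem_cat ?mem_head // yp.
set R := (\prod_(q <- ss) cat_bound (size q))%R.
have R0 : (0 <= R)%R by apply: prodr_ge0 => q _; exact: cat_bound_ge0.
have B0 : ((#|noncrossing (split_out s x x)|)%:R <= cat_bound (size p) * R)%R.
  have -> : (cat_bound (size p) * R = \prod_(q <- p :: ss) cat_bound (size q))%R by rewrite big_cons.
  apply: IH => /=.
  - move: hm; rewrite /= size_cat; clear; lia.
  - by move: us; rewrite /= => /andP[].
  - rewrite others ?mem_head // andbT.
    case: p {H hm us orbx others fixed outside dis xss} uxp hx => [|z p] //=.
    rewrite inE negb_or -andbA => /and4P[xz xp zp up] /andP[/eqP sx].
    rewrite !rcons_path => /andP[pth /eqP sl]; apply/andP; split.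
      apply: (fpath_ext pth) => v vb.
      have vzp : v \in z :: p by apply: mem_belast vb.
      have svp := fpath_mem pth vb.
      have vx : v != x.
        by apply: contraTneq vzp => ->; rewrite inE negb_or xz.
      by apply: split_outE => //; apply: contraTneq svp => ->.
    have lx : last z p != x.
      by apply: contraTneq (mem_last z p) => ->; rewrite inE negb_or xz.
    by rewrite /= /split_out !permM tperm1 perm1 sl tpermL sx.
  - move=> v vn; have [->|vx] := eqVneq v x; first by apply: fixed; exact: mem_head.
    by apply: outside; rewrite ?mem_head // mem_cat inE negb_or (negbTE vx) /= -negb_or -mem_cat.
(* Here [y] is entry [i] of [p]: the cycle falls into [x] with the part after [y], of length
   [size p - i], and the part before [y], of length [i]. *)
have B1 i : i < size p ->
    ((#|noncrossing (split_out s x (nth x p i))|)%:R <=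
      cat_bound (size p - i) * cat_bound i * R)%R.
  move=> ip; set y := nth x p i.
  have yp : y \in p by apply: mem_nth.
  have yxp : y \in x :: p by rewrite inE yp orbT.
  have pE : p = take i p ++ y :: drop i.+1 p by rewrite -drop_nth // cat_take_drop.
  set p1 := take i p in pE; set p2 := drop i.+1 p in pE.
  have s1 : size p1 = i by rewrite size_take ip.
  have s2 : size (x :: p2) = size p - i by rewrite /= size_drop; lia.
  have -> : (cat_bound (size p - i) * cat_bound i * R =
      \prod_(q <- (x :: p2) :: p1 :: ss) cat_bound (size q))%R.
    by rewrite !big_cons s2 s1 mulrA.
  move: uxp; rewrite /= {1 2}pE mem_cat inE !negb_or cat_uniq /= !negb_or -!andbA.
  move=> /and5P[xp1 xy xp2 up1 /and4P[yp1 /hasPn d12 yp2 up2]].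
  move: hx; rewrite /= pE rcons_cat /= cat_path /= => /and3P[pth1 /eqP sl pth2].
  have S0 v : v \in rcons p2 x -> v != y.
    by rewrite mem_rcons inE => /orP[/eqP -> //|vp]; apply: contraNneq yp2 => <-.
  have sx2 : split_out s x y x = s y.
    rewrite /split_out !permM tpermL tpermD //.
      rewrite eq_sym; apply: S0; case: (p2) pth2 => [|z q] /= /andP[/eqP -> _]; exact: mem_head.
    by apply: contraNneq xy => /perm_inj ->.
  apply: IH.
  - move: (congr1 size pE) hm; rewrite size_cat /= !size_cat; clear; lia.
  - rewrite /= !mem_cat !negb_or xp2 xp1 /=.
    have -> : x \notin flatten ss by apply/negP => /dis; rewrite mem_head.
    rewrite !cat_uniq up2 up1 uss /= !andbT; apply/andP; split; apply/hasPn => v; rewrite ?mem_cat.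
      move=> /orP[vp1|vs]; apply/negP => vp2; first by have := d12 _ vp2; rewrite vp1.
      by have := dis _ vs; rewrite inE pE mem_cat inE vp2 !orbT.
    by move=> vs; apply/negP => vp1; have := dis _ vs; rewrite inE pE mem_cat vp1 !orbT.
  - rewrite /= others // andbT; apply/andP; split.
      case: (p2) pth2 S0 xp2 yp2 => [|z q] /= /andP[/eqP sy pth2] S0 xp2 yp2; rewrite sx2 sy eqxx //=.
      apply: (fpath_ext pth2) => v vb; have svb := fpath_mem pth2 vb.
      move: vb; rewrite belast_rcons => vb; apply: split_outE.
      + by apply: contraNneq xp2 => <-.
      + by apply: contraNneq yp2 => <-.
      + by apply: S0; rewrite inE svb orbT.
    case: (p1) pth1 sl xp1 yp1 up1 => [|z q] //= /andP[/eqP sx pth1] sl xp1 yp1 up1.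
    rewrite rcons_path; apply/andP; split.
      apply: (fpath_ext pth1) => v vb; have svb := fpath_mem pth1 vb.
      have vq := mem_belast vb; apply: split_outE.
      + by apply: contraNneq xp1 => <-.
      + by apply: contraNneq yp1 => <-.
      + by apply: contraNneq yp1 => <-; rewrite inE svb orbT.
    have lq := mem_last z q.
    rewrite /= /split_out !permM (@tpermD _ x y (last z q)) ?sl ?tpermL ?sx //.
      by apply: contraNneq xp1 => ->.
    by apply: contraNneq yp1 => ->.
  - move=> v vn; have [->|vy] := eqVneq v y; first by apply: fixed.
    apply: outside => //; move: vn; rewrite /= pE !(inE, mem_cat) (negbTE vy) /=.
    by rewrite -!orbA; case: (v == x); case: (v \in p1); case: (v \in p2).
have := card_noncrossing_split uxp orbx; rewrite -(ler_nat rat) => h; apply: (Order.POrderTheory.le_trans h).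
rewrite big_cons natrD (big_nth x) big_mkord natr_sum big_cons -/R.
apply: (@Order.POrderTheory.le_trans _ _ (cat_bound (size p) * R +
   \sum_(i < size p) cat_bound (size p - i) * cat_bound i * R)%R).
  by apply: lerD => //; apply: ler_sum => i _; apply: B1.
rewrite -mulr_suml -mulrDl; apply: ler_wpM2r => //.
apply: Order.POrderTheory.le_trans (cat_bound_conv (size p)).
rewrite big_ord_recr /= subnn cat_bound0 mulr1 addrC; apply: lerD => //.
by apply: ler_sum => i _; rewrite mulrC.
Qed.

Lemma perm_cycles s : exists ss, [/\ uniq (flatten ss), all (fcycle s) ss &
  forall x, x \in flatten ss].
Proof.
suff H k : forall A : {set T}, (forall x, x \in A -> s x \in A) -> #|A| <= k ->
    exists ss, [/\ uniq (flatten ss), all (fcycle s) ss & flatten ss =i A].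
  have [x _|ss [h1 h2 h3]] := H n setT _ (max_card _); first by rewrite inE.
  by exists ss; split => // x; rewrite h3 in_setT.
elim: k => [|k IH] A sA cA.
  by exists [::]; split => // x; move: cA; rewrite leqn0 cards_eq0 => /eqP ->; rewrite in_set0.
have [->|[x xA]] := set_0Vmem A; first by exists [::]; split => // x; rewrite in_set0.
pose O := fingraph.orbit s x.
have OE y : (y \in O) = fconnect s x y by rewrite /O fconnect_orbit.
have OA y : y \in O -> y \in A.
  rewrite OE => /iter_findex <-; elim: (findex _ _ _) => //= i; exact: sA.
have [y||ss [h1 h2 h3]] := IH (A :\: [set y in O]).
- rewrite !inE => /andP[yO /sA ->]; rewrite andbT; apply: contra yO.
  by rewrite !OE -(same_fconnect1_r (@perm_inj _ s)).
- rewrite -ltnS; apply: leq_trans cA; apply: proper_card; apply/properP; split.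
    exact: subsetDl.
  by exists x => //; rewrite !inE OE connect0.
exists (O :: ss); split => /=.
- rewrite cat_uniq orbit_uniq h1 andbT; apply/hasPn => y; rewrite h3 !inE.
  by case/andP.
- by rewrite h2 andbT; apply: cycle_orbit; exact: perm_inj.
- move=> y; rewrite mem_cat h3 !inE; case: (boolP (y \in O)) => //= /OA -> //.
Qed.

Lemma card_noncrossing s : #|noncrossing s| <= 16 ^ n.
Proof.
have [ss [us hs al]] := perm_cycles s.
rewrite -(ler_nat rat) natrX.
apply: Order.POrderTheory.le_trans (card_noncrossing_cycles (leqnn _) us hs _) _.
  by move=> x; rewrite al.
apply: (@Order.POrderTheory.le_trans _ _ (\prod_(p <- ss) 16 ^+ size p)%R).
  by apply: ler_prod => p _; rewrite cat_bound_ge0 cat_bound_le.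
have -> : n = size (flatten ss).
  rewrite cardT -(undup_id us); apply/perm_size/uniq_perm; rewrite ?enum_uniq ?undup_uniq //.
  by move=> x; rewrite mem_enum mem_undup al.
rewrite size_flatten; elim: ss {us hs al} => [|p ss IH]; first by rewrite big_nil.
by rewrite big_cons /= exprD; apply: ler_wpM2l IH; rewrite exprn_ge0.
Qed.

End Noncrossing.

(** * Coding coloured graphs with planar triples of colours *)

Section ColouredGraphs.
Variables T I : finType.
Local Notation n := #|T|.
Implicit Types (alpha : {ffun I -> {perm T}}) (B : {set T}) (i j k : I) (v w : T).

Definition comp alpha (J : {set I}) : nat := ncomp (fun i v => alpha i v) J [set: T].

Definition bipartition alpha B := [forall i, forall v, (alpha i v \in B) == (v \notin B)].

Definition invols alpha := [forall i, forall v, alpha i (alpha i v) == v].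

(** From a black vertex along colour [i], then back along colour [j]. Bijectivity relies on the
    bipartition, hence [insub] with default 1; fixing the white vertices keeps the permutation on
    the whole vertex set. *)
Definition black_perm alpha B i j : {perm T} :=
  if (insub ([ffun v => if v \in B then alpha j (alpha i v) else v] : {ffun T -> T}) : option {perm T})
  is Some s then s else 1.

Section OneGraph.
Variables (alpha : {ffun I -> {perm T}}) (B : {set T}).
Hypothesis aB : bipartition alpha B.
Hypothesis aK : invols alpha.

Local Notation orbA := (orb (fun i v => alpha i v)).
Local Notation bp := (black_perm alpha B).

Lemma alphaB i v : (alpha i v \in B) = (v \notin B).
Proof. by apply/eqP; move/forallP: aB => /(_ i) /forallP. Qed.

Lemma alphaK i : involutive (alpha i).
Proof. by move=> v; apply/eqP; move/forallP: aK => /(_ i) /forallP. Qed.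

Lemma black_permE i j v : bp i j v = if v \in B then alpha j (alpha i v) else v.
Proof.
rewrite /black_perm.
have inj : injectiveb (fun v => if v \in B then alpha j (alpha i v) else v).
  apply/injectiveP => x y; case: ifP => xB; case: ifP => yB //.
  - by move=> /perm_inj /perm_inj.
  - by move=> e; move: yB; rewrite -e !alphaB xB.
  - by move=> e; move: xB; rewrite e !alphaB yB.
case: insubP => [s _ sE|] /=; first by rewrite -pvalE -[pval s]/(val s) sE ffunE.
by case/negP; apply/injectiveP => x y; rewrite !ffunE; exact: (injectiveP _ inj).
Qed.

Lemma black_perm_mul i j k : bp i k * bp k j = bp i j.
Proof.
apply/permP => v; rewrite permM !black_permE; case: (boolP (v \in B)) => vB.
  by rewrite !alphaB vB /= alphaK.
by rewrite (negbTE vB).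
Qed.

Lemma black_perm_div i j k : (bp i k)^-1 * bp i j = bp k j.
Proof. by rewrite -(black_perm_mul i j k) mulKg. Qed.

Lemma black_perm_id i : bp i i = 1.
Proof. by apply/permP => v; rewrite black_permE alphaK perm1; case: ifP. Qed.

(** A function on black vertices extends to white ones along colour [i], and the extension is
    invariant under all colours of [J]. *)
Lemma orb_black (X : Type) (f : T -> X) (J : {set I}) i v w : i \in J ->
  (forall k u, k \in J -> u \in B -> f (alpha k (alpha i u)) = f u) ->
  v \in B -> w \in B -> w \in orbA J v -> f w = f v.
Proof.
move=> iJ H vB wB.
pose r u := if u \in B then u else alpha i u.
move/(@orb_fun_inv _ _ _ _ (f \o r)) => /= E.
have: f (r w) = f (r v); last by rewrite /r vB wB.
apply: E => k u kJ; rewrite /r alphaB; case: (boolP (u \in B)) => /= uB.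
  by rewrite -[in LHS](H k) ?alphaB ?uB // !alphaK.
by rewrite -[in LHS](alphaK i u) H // alphaB.
Qed.

(** Its levels are the common orbits of the black permutations with colours in [J]: components, seen
    on black vertices, and single white vertices. *)
Definition kappa (J : {set I}) v : {set T} := if v \in B then orbA J v else [set v].

Lemma kappa_min (X : Type) (f : T -> X) (J : {set I}) i : i \in J ->
  (forall k u, k \in J -> f (bp i k u) = f u) ->
  forall x y, kappa J x = kappa J y -> f x = f y.
Proof.
move=> iJ H x y; rewrite /kappa; case: ifP => xB; case: ifP => yB.
- move=> e; apply/esym/(orb_black iJ) => //; last by rewrite e orb_refl.
  by move=> k u kJ uB; rewrite -[RHS](H k) // black_permE uB.
- by move/setP/(_ x); rewrite orb_refl inE => /esym/eqP e; rewrite -e xB in yB.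
- by move/setP/(_ y); rewrite orb_refl inE => /eqP e; rewrite e xB in yB.
- by move=> /set1_inj ->.
Qed.

Lemma kappa_inv (J : {set I}) i k v : i \in J -> k \in J -> kappa J (bp i k v) = kappa J v.
Proof.
move=> iJ kJ; rewrite /kappa black_permE; case: (boolP (v \in B)) => [vB|vB]; last first.
  by rewrite (negbTE vB).
rewrite !alphaB vB /=; apply: (orb_eqP (fun i => alphaK i)).
have h := @orb_step _ _ (fun i v => alpha i v).
exact: orb_trans (h _ _ _ iJ) (h _ _ _ kJ).
Qed.

Lemma card_kappa (J : {set I}) i : i \in J ->
  #|[set kappa J v | v in setT]| = comp alpha J + #|~: B|.
Proof.
move=> iJ.
have -> : [set kappa J v | v in setT] = kappa J @: B :|: kappa J @: (~: B).
  by rewrite -imsetU setUCr.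
rewrite cardsU (_ : _ :&: _ = set0) ?cards0 ?subn0; last first.
  apply/setP => K; rewrite !inE; apply/negP => /andP[/imsetP[x xB ->] /imsetP[y yB]].
  rewrite /kappa xB; move: yB; rewrite inE => yB; rewrite (negbTE yB) => /setP/(_ x).
  by rewrite orb_refl inE => /esym/eqP e; rewrite -e xB in yB.
congr (_ + _).
  rewrite /comp /ncomp; congr #|pred_of_set _|.
  apply/setP => K; apply/imsetP/imsetP => [[v vB ->]|[v _ ->]].
    by exists v => //; rewrite /kappa vB.
  have [vB|vB] := boolP (v \in B); first by exists v => //; rewrite /kappa vB.
  exists (alpha i v); first by rewrite alphaB.
  rewrite /kappa alphaB vB; apply/esym/(orb_eqP (fun i => alphaK i)).
  exact: (@orb_step _ _ (fun i v => alpha i v)).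
rewrite card_in_imset // => x y; rewrite !inE /kappa => /negbTE -> /negbTE ->.
exact: set1_inj.
Qed.

(** A cycle through black vertices is the black half of a two-coloured component, and every white
    vertex adds a fixed point. *)
Lemma cyc_black_perm i j : cyc (bp i j) = comp alpha [set i; j] + #|~: B|.
Proof.
rewrite -(@card_kappa _ i) ?inE ?eqxx //.
transitivity #|[set porbit (bp i j) x | x in setT]|.
  by apply: eq_card => K; apply/imsetP/imsetP => -[x _ ->]; exists x.
apply: card_imset_eq => x y _ _; apply/eqP/eqP => [/eqP|].
  rewrite eq_porbit_mem.
  apply: (porbit_sub (P := fun x => kappa [set i; j] x = kappa [set i; j] y)) => // z <-.
  by apply: kappa_inv; rewrite !inE eqxx ?orbT.
apply: (@kappa_min _ _ _ i); first by rewrite !inE eqxx.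
move=> k u; rewrite !inE => /orP[]/eqP ->; first by rewrite black_perm_id perm1.
by apply/eqP; rewrite eq_porbit_mem porbit_step.
Qed.

Lemma comp_le (J J' : {set I}) : J' \subset J -> comp alpha J <= comp alpha J'.
Proof.
move=> sJ; rewrite /comp /ncomp.
rewrite (_ : orbA J @: setT = (fun K : {set T} => \bigcup_(x in K) orbA J x) @: (orbA J' @: setT));
  first exact: leq_imset_card.
rewrite -imset_comp; apply: eq_imset => v /=; apply/setP => w; apply/idP/bigcupP.
  by move=> wv; exists v => //; exact: orb_refl.
by move=> [x xv]; apply: orb_trans; apply: subsetP xv; apply: orb_sub.
Qed.

(** By [black_perm_div] the quotient of the black permutations for [ij] and [ik] is the one for
    [kj], so the three-colour relation is the genus-zero equation of [planar_code]. *)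
Lemma planar_triple i j k :
  comp alpha [set i; j] + comp alpha [set i; k] + comp alpha [set k; j] =
    #|B| + 2 * comp alpha [set i; j; k] ->
  exists2 c, weight c = comp alpha [set i; j] - comp alpha [set i; j; k] &
    bp i k \in noncrossing (bp i j * decode (enum T) c).
Proof.
move=> E; pose J := [set i; j; k].
have iJ : i \in J by rewrite !inE eqxx.
have jJ : j \in J by rewrite !inE eqxx orbT.
have kJ : k \in J by rewrite !inE eqxx orbT.
have [|||||c wc cN] := @planar_code T _ (kappa J) (comp alpha J + #|~: B|) (bp i j) (bp i k).
- by move=> x; apply: kappa_inv.
- by move=> x; apply: kappa_inv.
- move=> f f1 f2; apply: (kappa_min iJ) => l u; rewrite !inE => /orP[/orP[]|]/eqP -> //.
  by rewrite black_perm_id perm1.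
- exact: card_kappa iJ.
- rewrite black_perm_div !cyc_black_perm; have := cardsC B; rewrite -/J in E; lia.
exists c => //; move: wc; rewrite cyc_black_perm -/J; lia.
Qed.

End OneGraph.

Definition planar_pair alpha i j := [forall k, (k != i) && (k != j) ==>
  (comp alpha [set i; j] + comp alpha [set i; k] + comp alpha [set k; j] ==
    n %/ 2 + 2 * comp alpha [set i; j; k])].

Definition side_of alpha : {set T} := odflt set0 [pick B | bipartition alpha B].

Lemma side_ofP alpha B : bipartition alpha B -> bipartition alpha (side_of alpha).
Proof. by rewrite /side_of; case: pickP => //= H; rewrite H. Qed.

Lemma card_side alpha B i : bipartition alpha B -> invols alpha -> #|B| = n %/ 2.
Proof.
move=> aB aK.
have : #|~: B| = #|B|.
  rewrite -(card_imset B (@perm_inj _ (alpha i))); apply: eq_card => v.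
  rewrite inE; apply/idP/imsetP => [vB|[w wB ->]]; last by rewrite alphaB ?wB.
  by exists (alpha i v); rewrite ?alphaK // alphaB.
have := cardsC B; move: #|B| #|~: B| => a b E ba.
by rewrite -E ba addnn -muln2 mulnK.
Qed.

(** A graph is recovered from its black side, colour [i0] on black vertices, and the black
    permutations from [i0]. Colour [i0] costs n^(n/2); the permutation towards [j0] has [f]
    nontrivial-side cycles besides the white points and costs n^(n/2 - f); each further colour is
    planar relative to it and costs n^(f - cc k). *)
Theorem card_planar_graphs (i0 j0 : I) (f : nat) (cc : I -> nat)
    (Omega : {set {ffun I -> {perm T}}}) : i0 != j0 ->
  (forall alpha, alpha \in Omega ->
    [/\ exists B, bipartition alpha B, invols alpha, planar_pair alpha i0 j0,
        comp alpha [set i0; j0] = f &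
        forall k, k != i0 -> k != j0 -> comp alpha [set i0; j0; k] = cc k]) ->
  #|Omega| <= 2 ^ (3 * n) * 32 ^ (n * #|I|) *
    n ^ (n %/ 2 + (n %/ 2 - f) + \sum_(k | (k != i0) && (k != j0)) (f - cc k)).
Proof.
move=> ij H.
have [->|[a0 a0O]] := set_0Vmem Omega; first by rewrite cards0.
pose Q s k := \bigcup_(c in [set c : {ffun T -> option T} | weight c == f - cc k])
   noncrossing (s * decode (enum T) c).
pose F s k : {set {perm T}} := if k == i0 then [set 1] else if k == j0 then [set s] else Q s k.
pose S := [set s : {perm T} | cyc s + (n %/ 2 - f) == n].
pose Hs : {set {ffun I -> {perm T}}} := \bigcup_(s in S) [set h | h \in family (fun k => mem (F s k))].
pose code alpha := (side_of alpha,
  [ffun v => if v \in side_of alpha then Some (alpha i0 v) else None],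
  [ffun k => black_perm alpha (side_of alpha) i0 k]).
have sideP alpha : alpha \in Omega -> bipartition alpha (side_of alpha).
  by move=> /H[[B /side_ofP]].
have code_inj : {in Omega &, injective code}.
  move=> a b aO bO [eB /ffunP ec /ffunP eh].
  have aB := sideP _ aO; have bB := sideP _ bO.
  have [_ aK _ _ _] := H _ aO; have [_ bK _ _ _] := H _ bO.
  rewrite -eB in bB ec eh; set B := side_of a in aB bB ec eh.
  have e1 v : v \in B -> a i0 v = b i0 v.
    by move=> vB; have := ec v; rewrite !ffunE vB => -[].
  have e2 k v : v \in B -> a k (a i0 v) = b k (b i0 v).
    by move=> vB; have := eh k; rewrite !ffunE => /permP/(_ v); rewrite !black_permE // vB.
  have e3 k v : v \notin B -> a k v = b k v.
    move=> vB; have := e2 k (a i0 v); rewrite (alphaB aB) vB => /(_ isT).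
    rewrite (alphaK aK) => ->; rewrite -e1 ?(alphaB aB) ?vB // (alphaK aK) //.
  apply/ffunP => k; apply/permP => v; have [vB|/e3->//] := boolP (v \in B).
  apply: (@perm_inj _ (b k)); rewrite (alphaK bK) -e3 ?(alphaK aK) // (alphaB aB) vB //.
rewrite -(card_in_imset code_inj).
apply: (@leq_trans #|setX (setX [set: {set T}] [set c : {ffun T -> option T} | weight c == n %/ 2]) Hs|).
  apply/subset_leq_card/subsetP => _ /imsetP[a aO ->].
  have aB := sideP _ aO; have [_ aK /forallP aP af ac] := H _ aO.
  have cB := card_side i0 aB aK.
  rewrite !inE /=; apply/andP; split.
    rewrite -cB /weight; apply/eqP/eq_card => v; rewrite inE ffunE; by case: ifP.
  have cs := cyc_black_perm aB aK i0 j0; rewrite af in cs.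
  have cT := cardsC (side_of a); rewrite cB in cT.
  apply/bigcupP; exists (black_perm a (side_of a) i0 j0).
    rewrite inE cs.
    have fle : f <= n %/ 2.
      have [c _] := perm_code (black_perm a (side_of a) i0 j0).
      rewrite cs; move: cT; clear; lia.
    by apply/eqP; move: cT fle; clear; lia.
  rewrite inE; apply/familyP => k; rewrite ffunE /F.
  case: eqP => [->|/eqP ki]; first by rewrite black_perm_id // inE.
  case: eqP => [->|/eqP kj]; first by rewrite inE.
  have := aP k; rewrite ki kj /= => /eqP E; rewrite -cB in E.
  have [c wc cN] := planar_triple aB aK E.
  by apply/bigcupP; exists c => //; rewrite inE wc af ac.
rewrite !cardsX.
have c1 : #|[set: {set T}]| <= 2 ^ n.
  by rewrite -(cardsT T) -card_powerset; apply/subset_leq_card/subsetP => A _; rewrite powersetE subsetT.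
have c2 := @card_codes T (n %/ 2).
have c3 : #|Hs| <= 2 ^ n * n ^ (n %/ 2 - f) *
    (32 ^ (n * #|I|) * n ^ (\sum_(k | (k != i0) && (k != j0)) (f - cc k))).
  apply: leq_trans (card_bigcup_le _ _) _.
  apply: (@leq_trans (\sum_(s in S) 32 ^ (n * #|I|) * n ^ (\sum_(k | (k != i0) && (k != j0)) (f - cc k)))).
    apply: leq_sum => s _; rewrite cardsE card_family.
    rewrite foldrE big_map big_enum /= [X in (_ * n ^ X)%N]big_mkcond /= expnM -prod_nat_const expn_sum.
    rewrite -big_split /=; apply: leq_prod => k _; rewrite /F.
    case: eqP => [_|_] /=; first by rewrite cards1 muln1 expn_gt0.
    case: eqP => [_|_] /=; first by rewrite cards1 muln1 expn_gt0.
    rewrite (_ : 32 ^ n * _ = 2 ^ n * n ^ (f - cc k) * 16 ^ n)%N; last first.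
      by rewrite (expnMn 2 16) mulnAC.
    apply: leq_trans (card_planar_le (w := f - cc k) (s := s) (card_noncrossing (T:=T)) _); first exact: leqnn.
    by move=> t /bigcupP[c]; rewrite inE => /eqP wc tc; exists c.
  by rewrite sum_nat_const leq_mul2r card_cyc orbT.
apply: (leq_trans (leq_mul (leq_mul c1 c2) c3)).
have -> : (2 ^ (3 * n) = 2 ^ n * 2 ^ n * 2 ^ n)%N by rewrite -!expnD; congr (_ ^ _)%N; lia.
rewrite [X in _ <= (_ * X)%N]expnD [X in _ <= (_ * (X * _))%N]expnD.
set A := (2 ^ n)%N; set X := (32 ^ _)%N; set N := (n ^ (n %/ 2))%N.
set N1 := (n ^ (_ - _))%N; set N2 := (n ^ _)%N.
by rewrite leq_eqVlt; apply/orP; left; apply/eqP; clear; ring.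
Qed.

End ColouredGraphs.

End PermutationCounting.

(** * Averaging over colours *)

Lemma big_subsetU1 (R : nmodType) (I : finType) (i : I) (S : {set I}) (f : {set I} -> R) :
  i \notin S ->
  \sum_(J : {set I} | J \subset i |: S) f J =
  \sum_(J : {set I} | J \subset S) f J + \sum_(J : {set I} | J \subset S) f (i |: J).
Proof.
move=> iS; rewrite (bigID (fun J : {set I} => i \in J)) /= addrC; congr (_ + _).
  apply: eq_bigl => J; apply/andP/idP => [[/subsetP sJ iJ]|sJ].
    apply/subsetP => k kJ; have := sJ _ kJ; rewrite !inE; case: eqP => // e.
    by rewrite -e kJ in iJ.
  split; first by apply: subset_trans sJ (subsetUr _ _).
  by apply: contra iS; apply: subsetP.
rewrite (reindex_onto (fun J => i |: J) (fun J => J :\ i)) /=; last first.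
  by move=> J /andP[_ iJ]; rewrite setD1K.
apply: eq_bigl => J; rewrite setU11 andbT.
apply/andP/idP => [[sJ /eqP e]|sJ].
  apply/subsetP => k kJ; have := subsetP sJ k; rewrite !inE kJ orbT => /(_ isT).
  case: eqP => // ki; by move/setP/(_ k): e; rewrite !inE kJ ki eqxx.
split; first by apply: setUS.
apply/eqP/setP => k; rewrite !inE; case: eqP => // ->.
by apply/esym/negbTE; apply: contra iS; apply: subsetP.
Qed.

Lemma big_subset0 (R : nmodType) (I : finType) (f : {set I} -> R) :
  \sum_(J : {set I} | J \subset set0) f J = f set0.
Proof. by rewrite (big_pred1 set0) // => J; rewrite subset0. Qed.

Lemma perm_extend (T : finType) (l1 l2 : seq T) : uniq l1 -> uniq l2 -> size l1 = size l2 ->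
  exists p : {perm T}, map p l1 = l2.
Proof.
elim: l1 l2 => [|x l1 IH] [|y l2] //=; first by exists 1%g.
move=> /andP[xl u1] /andP[yl u2] [sz].
have [p pE] := IH _ u1 u2 sz; exists (p * tperm (p x) y)%g; rewrite permM tpermL; congr cons.
rewrite -[RHS]pE; apply/eq_in_map => z zl; rewrite permM tpermD //.
  by apply: contraNneq xl => /perm_inj ->.
by apply: contraNneq yl => ->; rewrite -pE map_f.
Qed.

Lemma perm_imset (T : finType) (A B : {set T}) : #|A| = #|B| ->
  exists p : {perm T}, p @: A = B.
Proof.
move=> cAB.
have [|p pE] := @perm_extend T (enum A) (enum B) (enum_uniq _) (enum_uniq _).
  by rewrite -!cardE.
exists p; apply/setP => y; rewrite -[RHS]mem_enum -pE; apply/imsetP/mapP => -[x xA ->].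
  by exists x; rewrite ?mem_enum.
by exists x; rewrite // -mem_enum.
Qed.

Section Averaging.
Variables (T : finType) (d : nat) (alpha : {ffun 'I_d.+1 -> {perm T}}) (B : {set T}).
Local Notation n := #|T|.
Hypothesis d3 : (3 <= d)%N.
Hypothesis aB : bipartition alpha B.
Hypothesis aK : invols alpha.
Hypothesis euler : forall S : {set 'I_d.+1}, (#|S| <= d)%N ->
  \sum_(J : {set 'I_d.+1} | J \subset S) (-1) ^+ #|J| * (comp alpha J)%:Z = (comp alpha S)%:Z.
Implicit Types (i j k : 'I_d.+1) (s : {perm 'I_d.+1}).

Lemma comp0 : comp alpha set0 = n.
Proof.
rewrite /comp /ncomp (eq_imset (g := set1)); last by move=> v; rewrite /= orb0.
by rewrite card_imset ?cardsT //; exact: set1_inj.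
Qed.

Lemma comp1 i : 2 * (comp alpha [set i])%:Z = n%:Z.
Proof.
have := euler (S := i |: set0); rewrite cardsU1 cards0 inE => /(_ (ltnW (ltnW d3))).
rewrite big_subsetU1 ?inE // !big_subset0 setU0 cards0 cards1 comp0 expr0 expr1 mulN1r mul1r. by set c := comp alpha [set i]; clearbody c; lia.
Qed.

(** The relation for two colours is trivial once each colour is known to have n/2 edges, so this is
    the first one with content. *)
Lemma comp3 i j k : i != j -> k != i -> k != j ->
  2 * (comp alpha [set i; j])%:Z + 2 * (comp alpha [set i; k])%:Z +
  2 * (comp alpha [set k; j])%:Z = n%:Z + 4 * (comp alpha [set i; j; k])%:Z.
Proof.
move=> ij ki kj.
have cS : #|[set i; j; k]| = 3%N.
  by rewrite -setUA cardsU1 cards2 !inE negb_or ij [i == k]eq_sym ki [j == k]eq_sym kj.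
have := euler (S := [set i; j; k]); rewrite cS => /(_ d3).
have -> : [set i; j; k] = i |: (j |: (k |: set0)) by rewrite setU0 setUA.
have ni : i \notin j |: (k |: set0) by rewrite !inE orbF negb_or ij [i == k]eq_sym ki.
have nj : j \notin k |: set0 by rewrite !inE orbF [j == k]eq_sym kj.
have nk : k \notin set0 by rewrite inE.
rewrite !(big_subsetU1, big_subset0) // !setU0.
rewrite !setUA cS !cards2 ij ![_ == k]eq_sym ki kj cards0 !cards1 comp0.
have := comp1 i; have := comp1 j; have := comp1 k.
rewrite [ [set j; k] ]setUC !(exprS, expr0) !(mulN1r, mulr1, mul1r, opprK).
set c1 := comp alpha [set i]; set c2 := comp alpha [set j]; set c3 := comp alpha [set k].
set c4 := comp alpha [set i; j]; set c5 := comp alpha [set i; k]; set c6 := comp alpha [set k; j].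
set c7 := comp alpha _; clearbody c1 c2 c3 c4 c5 c6 c7; clear; lia.
Qed.

Lemma planar_pairT i j : i != j -> planar_pair alpha i j.
Proof.
move=> ij; apply/forallP => k; apply/implyP => /andP[ki kj].
have E := comp3 ij ki kj; apply/eqP.
have cB := card_side i aB aK; have := cardsC B.
have : #|~: B| = #|B|.
  rewrite -(card_imset B (@perm_inj _ (alpha i))); apply: eq_card => v.
  rewrite inE; apply/idP/imsetP => [vB|[w wB ->]]; last by rewrite alphaB ?wB.
  by exists (alpha i v); rewrite ?alphaK // alphaB.
rewrite -cB; lia.
Qed.

Let P : int := #|{perm 'I_d.+1}|%:Z.

Definition orbit_sum (J : {set 'I_d.+1}) : int := \sum_(s : {perm 'I_d.+1}) (comp alpha (s @: J))%:Z.

Lemma orbit_sumE (J J' : {set 'I_d.+1}) : #|J| = #|J'| -> orbit_sum J = orbit_sum J'.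
Proof.
move=> /perm_imset[p pE]; rewrite /orbit_sum (reindex_inj (mulgI p)) /=.
apply: eq_bigr => s _; rewrite -pE -imset_comp; congr (comp _ _)%:Z.
by apply: eq_imset => x /=; rewrite permM.
Qed.

(** The average number of components over sets of [k] colours, times (d+1)! to stay in the
    integers. *)
Definition ysum (k : nat) : int := orbit_sum [set i : 'I_d.+1 | (i < k)%N].

Lemma card_initial (k : nat) : (k <= d.+1)%N -> #|[set i : 'I_d.+1 | (i < k)%N]| = k.
Proof.
move=> kd; rewrite -sum1_card (eq_bigl (fun i : 'I_d.+1 => (i < k)%N)); last by move=> i; rewrite inE.
by rewrite -(big_ord_widen _ (fun=> 1%N) kd) sum1_card card_ord.
Qed.

Lemma orbit_sum_ysum (J : {set 'I_d.+1}) : orbit_sum J = ysum #|J|.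
Proof.
by apply: orbit_sumE; rewrite card_initial // -[X in (_ <= X)%N]card_ord max_card.
Qed.

Lemma ysum_euler m : (m <= d)%N ->
  \sum_(k < m.+1) (-1) ^+ k * ('C(m, k))%:Z * ysum k = ysum m.
Proof.
move=> md; pose S0 := [set i : 'I_d.+1 | (i < m)%N].
have cS : #|S0| = m by rewrite card_initial // ltnW.
transitivity (\sum_(J : {set 'I_d.+1} | J \subset S0) (-1) ^+ #|J| * orbit_sum J).
  rewrite (partition_big (fun J : {set 'I_d.+1} => inord #|J| : 'I_m.+1) xpredT) //=.
  apply: eq_bigr => k _.
  have E (J : {set 'I_d.+1}) : J \subset S0 -> (inord #|J| == k) = (#|J| == k).
    by move=> /subset_leq_card; rewrite cS => h; rewrite -val_eqE /= inordK.
  rewrite (eq_bigr (fun=> (-1) ^+ k * ysum k)); last first.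
    by move=> J /andP[sJ]; rewrite E // orbit_sum_ysum => /eqP ->.
  rewrite sumr_const -mulr_natl natz mulrAC [RHS]mulrC; congr (_ * Posz _).
  transitivity 'C(#|S0|, k); first by rewrite cS.
  rewrite -cards_draws; apply: eq_card => J; rewrite !inE.
  by rewrite unfold_in /=; apply/andP/andP => -[sJ]; [rewrite -E|rewrite E].
rewrite /orbit_sum; under eq_bigr do rewrite big_distrr /=.
rewrite exchange_big /=; rewrite /ysum /orbit_sum; apply: eq_bigr => s _.
rewrite -(@euler (s @: S0)); last by rewrite card_imset ?cS //; exact: perm_inj.
rewrite [RHS](reindex_onto (fun J : {set 'I_d.+1} => s @: J) (fun J => s^-1%g @: J)) /=; last first.
  by move=> J _; rewrite -imset_comp (eq_imset (g := id)) ?imset_id // => x /=; rewrite permKV.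
apply: eq_big => [J|J _]; last by rewrite card_imset //; exact: perm_inj.
rewrite -imset_comp (eq_imset (g := id)) ?imset_id ?eqxx ?andbT; last by move=> x /=; rewrite permK.
apply/idP/idP => [|h]; first exact: imsetS.
apply/subsetP => x xJ; have /imsetP[y yS /perm_inj ->] : s x \in s @: S0; last by [].
by apply: (subsetP h); apply: imset_f.
Qed.

Lemma ysum0 : ysum 0 = P * n%:Z.
Proof.
rewrite /ysum (_ : [set i | _] = set0); last by apply/setP => i; rewrite !inE.
rewrite /orbit_sum (eq_bigr (fun=> n%:Z)); last by move=> s _; rewrite imset0 comp0.
by rewrite sumr_const -mulr_natl natz.
Qed.

Lemma ysum1 : 2 * ysum 1 = P * n%:Z.
Proof.
have := @ysum_euler 1 (ltnW (ltnW d3)); rewrite !big_ord_recr big_ord0 /= ysum0.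
rewrite !(exprS, expr0) bin0 binn !(mulN1r, mulr1, mul1r, mulNr); set X := P * _; clear; lia.
Qed.

Lemma ysum3 : 6 * ysum 2 = P * n%:Z + 4 * ysum 3.
Proof.
have := @ysum_euler 3 d3; rewrite !big_ord_recr big_ord0 /= ysum0.
rewrite !(exprS, expr0) (_ : 'C(3, 0) = 1%N) // (_ : 'C(3, 1) = 3%N) //.
rewrite (_ : 'C(3, 2) = 3%N) // (_ : 'C(3, 3) = 1%N) //.
rewrite !(mulN1r, mulr1, mul1r, mulNr, opprK).
have := ysum1; set X := P * _; clear; lia.
Qed.

Lemma ysum_ge0 (k : nat) : 0 <= ysum k.
Proof. by apply: sumr_ge0. Qed.

(** Eliminating one and two colours from the relation for five leaves 2 y5 = P n / 6 - (10/3) y3 + 5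
    y4; now use y4 >= y5 >= 0. *)
Lemma ysum5 : (5 <= d)%N -> P * n%:Z <= 20 * ysum 3.
Proof.
move=> d5; have := @ysum_euler 5 d5; rewrite !big_ord_recr big_ord0 /= ysum0.
have h : ysum 5 <= ysum 4.
  apply: ler_sum => s _; rewrite lez_nat; apply: comp_le => //; apply: imsetS.
  by apply/subsetP => i; rewrite !inE => /ltnW.
rewrite !(exprS, expr0) (_ : 'C(5, 0) = 1%N) // (_ : 'C(5, 1) = 5%N) // (_ : 'C(5, 2) = 10%N) //.
rewrite (_ : 'C(5, 3) = 10%N) // (_ : 'C(5, 4) = 5%N) // (_ : 'C(5, 5) = 1%N) //.
rewrite !(mulN1r, mulr1, mul1r, mulNr, opprK).
have := ysum1; have := ysum3; have := ysum_ge0 5; move: h; set X := P * _; clear; lia.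
Qed.

Definition expo i j : nat :=
  (n %/ 2 + (n %/ 2 - comp alpha [set i; j]) +
   \sum_(k | (k != i) && (k != j)) (comp alpha [set i; j] - comp alpha [set i; j; k]))%N.

Lemma expoE i j : i != j ->
  (expo i j)%:Z = n%:Z - (comp alpha [set i; j])%:Z +
    \sum_(k | (k != i) && (k != j)) ((comp alpha [set i; j])%:Z - (comp alpha [set i; j; k])%:Z).
Proof.
move=> ij.
have le3 k : (comp alpha [set i; j; k] <= comp alpha [set i; j])%N.
  by apply: comp_le => //; apply: subsetUl.
have [c _ cn] := perm_code (black_perm alpha B i j); rewrite cyc_black_perm // in cn.
have cB := card_side i aB aK; have := cardsC B.
have cC : #|~: B| = #|B|.
  rewrite -(card_imset B (@perm_inj _ (alpha i))); apply: eq_card => v.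
  rewrite inE; apply/idP/imsetP => [vB|[w wB ->]]; last by rewrite alphaB ?wB.
  by exists (alpha i v); rewrite ?alphaK // alphaB.
rewrite cC => cT; rewrite cC in cn.
rewrite /expo -cB PoszD; congr (_ + _); first by move: cn cT; clear; lia.
rewrite -natz natr_sum; apply: eq_bigr => k _; rewrite natz subzn //.
Qed.

Let i0 : 'I_d.+1 := inord 0.
Let i1 : 'I_d.+1 := inord 1.

Lemma i01 : i0 != i1.
Proof. by rewrite -val_eqE /= !inordK //; move: d3; lia. Qed.

Lemma sum_expo : \sum_(s : {perm 'I_d.+1}) (expo (s i0) (s i1))%:Z =
  P * n%:Z + (d%:Z - 2) * ysum 2 - (d%:Z - 1) * ysum 3.
Proof.
have si s : s i0 != s i1 by rewrite (inj_eq perm_inj) i01.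
under eq_bigr do rewrite expoE //.
have E2 (J : {set 'I_d.+1}) : J = [set i0; i1] ->
    \sum_(s : {perm 'I_d.+1}) (comp alpha [set s i0; s i1])%:Z = ysum 2.
  move=> _; rewrite (_ : ysum 2 = orbit_sum [set i0; i1]); last by rewrite orbit_sum_ysum cards2 i01.
  by apply: eq_bigr => s _; rewrite imsetU1 imset_set1.
have E2' := E2 _ erefl.
have E3 k : k != i0 -> k != i1 ->
    \sum_(s : {perm 'I_d.+1}) (comp alpha [set s i0; s i1; s k])%:Z = ysum 3.
  move=> k0 k1; have -> : ysum 3 = orbit_sum [set i0; i1; k].
    by rewrite orbit_sum_ysum -setUA cardsU1 cards2 !inE negb_or i01 eq_sym k0 eq_sym k1.
  by apply: eq_bigr => s _; rewrite !imsetU !imset_set1.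
rewrite big_split big_split /= sumrN E2' sumr_const -[_ *+ _]mulr_natl natz -/P.
rewrite (eq_bigr (fun s : {perm 'I_d.+1} => \sum_(k | (k != i0) && (k != i1))
   ((comp alpha [set s i0; s i1])%:Z - (comp alpha [set s i0; s i1; s k])%:Z))); last first.
  move=> s _; rewrite (reindex_inj (@perm_inj _ s)) /=.
  by apply: eq_bigl => k; rewrite !(inj_eq perm_inj).
rewrite exchange_big /= (eq_bigr (fun=> ysum 2 - ysum 3)); last first.
  by move=> k /andP[k0 k1]; rewrite big_split /= sumrN E2' E3.
rewrite sumr_const.
have -> : #|[pred k | (k != i0) && (k != i1)]| = d.-1.
  have := cardsC [set i0; i1]; rewrite cards2 i01 card_ord.
  have -> : #|~: [set i0; i1]| = #|[pred k | (k != i0) && (k != i1)]|.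
    by apply: eq_card => k; rewrite !inE negb_or.
  by move: #|_| => X /=; clear; lia.
rewrite -[_ *+ d.-1]mulr_natl natz.
have -> : d.-1%:Z = d%:Z - 1 by move: d3; clear; lia.
ring.
Qed.

(** Some ordering of the colours does not exceed the average over all orderings. *)
Lemma exists_pair (a b : int) : 0 < a ->
  a * (P * n%:Z + (d%:Z - 2) * ysum 2 - (d%:Z - 1) * ysum 3) <= P * b ->
  exists i j, i != j /\ a * (expo i j)%:Z <= b.
Proof.
move=> a0 H; have [s hs|no] := pickP (fun s : {perm 'I_d.+1} => a * (expo (s i0) (s i1))%:Z <= b).
  by exists (s i0), (s i1); split => //; rewrite (inj_eq perm_inj) i01.
suff : P * b < a * \sum_(s : {perm 'I_d.+1}) (expo (s i0) (s i1))%:Z by rewrite sum_expo ltNge H.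
rewrite big_distrr /= (_ : P * b = \sum_(s : {perm 'I_d.+1}) b).
  apply: ltr_sum => [|s _]; last by rewrite ltNge no.
  by apply/hasP; exists 1%g => //; rewrite mem_index_enum.
by rewrite sumr_const -mulr_natl natz.
Qed.

(** The average exponent is at most 7n/6 for d = 3 and 4n/3 for d = 4, by y3 >= 0. For d >= 5,
    [ysum5] lowers it to (9d+39) n/60, which is below the bound claimed. *)
Theorem good_pair :
  exists i j, [/\ i != j, planar_pair alpha i j,
    d <> 4%N -> (60 * (expo i j) <= (9 * d + 43) * n)%N &
    d = 4%N -> (3 * (expo i j) <= 4 * n)%N].
Proof.
have y3 := ysum3; have y0 := ysum_ge0 3.
have Pn : 0 <= P * n%:Z by rewrite mulr_ge0.
have [d4|d4] := eqVneq d 4%N.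
  have [|i [j [ij h]]] := @exists_pair 3 (4 * n%:Z) isT.
    rewrite mulrCA d4; move: y3 y0 Pn; clear; lia.
  exists i, j; split; [by []|exact: planar_pairT|by move=> /(_ d4)|move=> _].
  by move: h; clear; lia.
have [|i [j [ij h]]] := @exists_pair 60 ((9 * d + 43)%:Z * n%:Z) isT; last first.
  exists i, j; split; [by []|exact: planar_pairT|move=> _|by move/eqP: d4].
  by move: h; clear; lia.
rewrite mulrCA; set X := P * n%:Z in y3 Pn *.
have [d5|] := leqP 5 d.
  have y5 := ysum5 d5; rewrite -/X in y5.
  have -> : (9 * d + 43)%:Z = 9 * d%:Z + 43 :> int by rewrite PoszD PoszM.
  have d0 : 5 <= d%:Z by rewrite lez_nat.
  move: y3 y0 Pn y5 d0; move: (ysum 2) (ysum 3) X d%:Z; clear => a b X e; nia.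
move=> dl; have -> : d = 3%N by move: d3 d4 dl; clear; lia.
move: y3 y0 Pn; clear; lia.
Qed.

End Averaging.

(** The exponent for labelled graphs; after division by n! one has (9d+43)/60 - 1 = 1/6 + (d-3) 3/20
    and 4/3 - 1 = 1/3. *)
Definition growth_exponent (d n : nat) : nat :=
  if d == 4%N then (4 * n %/ 3)%N else ((9 * d + 43) * n %/ 60)%N.

(** The graphs are sorted by a good pair and by the component counts of that pair and of its
    triples, which makes (d+1)^2 (n+1)^(d+2) classes. *)
Theorem card_euler_graphs (T : finType) (d : nat)
    (Omega : {set {ffun 'I_d.+1 -> {perm T}}}) :
  (3 <= d)%N -> (0 < #|T|)%N ->
  (forall alpha, alpha \in Omega ->
    [/\ exists B, bipartition alpha B, invols alpha &
      forall S : {set 'I_d.+1}, (#|S| <= d)%N ->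
        \sum_(J : {set 'I_d.+1} | J \subset S) (-1) ^+ #|J| * (comp alpha J)%:Z =
        (comp alpha S)%:Z]) ->
  (#|Omega| <= d.+1 ^ 2 * #|T|.+1 ^ d.+2 *
     (2 ^ (3 * #|T|) * 32 ^ (#|T| * d.+1) * #|T| ^ growth_exponent d #|T|))%N.
Proof.
move=> d3 n0 H; set n := #|T| in n0 *.
have comp_lt (alpha : {ffun 'I_d.+1 -> {perm T}}) J : (comp alpha J < n.+1)%N.
  rewrite ltnS /comp /ncomp; apply: leq_trans (leq_imset_card _ _) _.
  by rewrite cardsT.
pose X : finType := ('I_d.+1 * 'I_d.+1 * ('I_n.+1 * {ffun 'I_d.+1 -> 'I_n.+1}))%type.
pose cell (x : X) : {set {ffun 'I_d.+1 -> {perm T}}} :=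
  [set a in Omega | [&& x.1.1 != x.1.2, planar_pair a x.1.1 x.1.2,
     (expo a x.1.1 x.1.2 <= growth_exponent d n)%N,
     comp a [set x.1.1; x.1.2] == x.2.1 &
     [forall k, comp a [set x.1.1; x.1.2; k] == x.2.2 k]]].
apply: (@leq_trans (\sum_(x : X) #|cell x|)).
  apply: leq_trans (card_bigcup_le _ _); apply/subset_leq_card/subsetP => a aO.
  have [[B aB] aK aE] := H _ aO.
  have [i [j [ij pij h1 h2]]] := good_pair d3 aB aK aE.
  apply/bigcupP; exists (i, j, (Ordinal (comp_lt a [set i; j]),
    [ffun k => Ordinal (comp_lt a [set i; j; k])])) => //.
  rewrite inE aO /= ij pij eqxx /=; apply/andP; split; last first.
    by apply/forallP => k; rewrite ffunE.
  rewrite /growth_exponent; case: eqP => [/h2|/h1] h; rewrite leq_divRL //; move: h; rewrite -/n; lia.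
apply: (@leq_trans (\sum_(x : X) 2 ^ (3 * n) * 32 ^ (n * d.+1) * n ^ growth_exponent d n)%N).
  apply: leq_sum => -[[i j] [f cc]] _.
  have [->|[a0]] := set_0Vmem (cell (i, j, (f, cc))); first by rewrite cards0.
  rewrite inE /= => /andP[_ /and5P[ij _ eb /eqP fE /forallP cE]].
  have := @card_planar_graphs T _ i j f (fun k => cc k) (cell (i, j, (f, cc))) ij.
  rewrite card_ord => /(_ _)/leq_trans; apply.
    move=> a; rewrite inE /= => /andP[aO /and5P[_ pa _ /eqP fa /forallP ca]].
    have [aB aK _] := H _ aO; split => // k _ _; exact/eqP/ca.
  rewrite leq_mul2l -/n; apply/orP; right; apply: leq_pexp2l => //.
  apply: leq_trans eb; rewrite /expo fE -/n; apply: leq_add => //; apply: leq_sum => k _.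
  by have /eqP -> := cE k.
rewrite sum_nat_const leq_mul2r; apply/orP; right.
by rewrite !card_prod card_ffun !card_ord -mulnn [(_ ^ d.+2)%N]expnS.
Qed.

(** * Plugged paths *)

Section PluggedPath.
Local Open Scope nat_scope.
Variables (d N : nat).
Hypothesis d_gt2 : 2 < d.
Implicit Types (l : seq nat) (x y c k : nat).

Let d0 : 0 < d. Proof. exact: leq_trans d_gt2. Qed.

(** The nodes are 0, ..., [N] and the edge from [x] to [x.+1] has colour [x %% d]. A node without an
    edge of colour [c] is left fixed; in the double it will be joined to its own copy. *)
Definition path_nbr c x :=
  if (x %% d == c) && (x < N) then x.+1
  else if (0 < x) && (x.-1 %% d == c) then x.-1 else x.

(** Entry [k] of the code [l] is the node into which the source [d * k.+2] is plugged by the last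
    colour. *)
Definition is_source l x := [&& d %| x, 2 <= x %/ d & x %/ d < (size l).+2].

Definition plug l x :=
  if is_source l x then nth 0 l (x %/ d - 2)
  else if x \in l then d * (index x l).+2 else x.

Definition nbr l c x := if c < d then path_nbr c x else plug l x.

(** Targets are not multiples of [d], hence never sources, and the bound [d * k.+1] puts each one in
    an earlier segment than its source, whichever path colour is deleted. *)
Definition good_code l := [/\ uniq l, d * (size l).+1 <= N &
  forall k, k < size l -> nth 0 l k <= d * k.+1 /\ ~~ (d %| nth 0 l k)].

Lemma succ_mod x : x.+1 %% d <> x %% d.
Proof.
move=> e; have := eqn_modDl x 1 0 d; rewrite addn0 addn1 e eqxx mod0n modn_small //.
exact: leq_trans d_gt2.
Qed.

Lemma path_nbr_le c x : x <= N -> path_nbr c x <= N.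
Proof.
move=> xN; rewrite /path_nbr; case: ifP => [/andP[] //|_]; case: ifP => // _.
exact: leq_trans (leq_pred _) xN.
Qed.

Lemma path_nbrK c x : x <= N -> path_nbr c (path_nbr c x) = x.
Proof.
move=> xN; rewrite {2}/path_nbr; case: ifP => [/andP[/eqP xc xN']|h1].
  rewrite /path_nbr /= xc eqxx; case: eqP => //= e.
  by case: (succ_mod (x := x)); rewrite e xc.
case: ifP => [/andP[x0 /eqP xc]|h2]; last by rewrite /path_nbr h1 h2.
by rewrite /path_nbr xc eqxx prednK // xN.
Qed.

Section Code.
Variable l : seq nat.
Hypothesis gl : good_code l.

Lemma code_mem x : x \in l -> [/\ x <= d * (index x l).+1, ~~ (d %| x) & index x l < size l].
Proof.
move=> xl; have il : index x l < size l by rewrite index_mem.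
by have [_ _ /(_ _ il)] := gl; rewrite nth_index // => -[].
Qed.

Lemma source_index k : k < size l -> is_source l (d * k.+2) /\ (d * k.+2) %/ d - 2 = k.
Proof. by move=> kl; rewrite /is_source dvdn_mulr // mulKn // !ltnS kl !subSS subn0. Qed.

Lemma source_small k : k < size l -> d * k.+2 <= N.
Proof. by move=> kl; have [_ h _] := gl; apply: leq_trans h; rewrite leq_mul2l ltnS kl orbT. Qed.

Lemma plug_le x : x <= N -> plug l x <= N.
Proof.
move=> xN; rewrite /plug; case: ifP => [/and3P[_ h1 h2]|_].
  have kl : x %/ d - 2 < size l by lia.
  have [_ _ /(_ _ kl)[h _]] := gl; apply: leq_trans h _.
  by apply: leq_trans (source_small kl); rewrite leq_mul2l leqnSn orbT.
by case: ifP => // /code_mem[_ _ il]; exact: source_small.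
Qed.

Lemma plugK x : plug l (plug l x) = x.
Proof.
have [ul _ Hl] := gl.
rewrite {2}/plug; case: ifP => [/and3P[dx h1 h2]|h1].
  have kl : x %/ d - 2 < size l by lia.
  have [_ nd] := Hl _ kl.
  rewrite /plug /is_source (negbTE nd) /= mem_nth // index_uniq //.
  have -> : (x %/ d - 2).+2 = x %/ d by lia.
  by rewrite mulnC divnK.
case: ifP => h2; last by rewrite /plug h1 h2.
have [_ _ il] := code_mem h2; have [s1 s2] := source_index il.
by rewrite /plug s1 s2 nth_index.
Qed.

Lemma nbr_le c x : x <= N -> nbr l c x <= N.
Proof. by rewrite /nbr; case: ifP => _; [exact: path_nbr_le|exact: plug_le]. Qed.

Lemma nbrK c x : x <= N -> nbr l c (nbr l c x) = x.
Proof. by move=> xN; rewrite /nbr; case: (c < d); [exact: path_nbrK|exact: plugK]. Qed.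

(* Deleting the colour [j < d] cuts the path into segments, each containing a
   single multiple of [d]; [seg j] numbers them increasingly. *)
Definition seg j x := x %/ d + (j < x %% d).

Lemma seg_mul j m : seg j (d * m) = m.
Proof. by rewrite /seg mulKn // modnMr addn0. Qed.

Lemma seg_succ j x : j < d -> seg j x.+1 = seg j x + (x %% d == j).
Proof.
move=> jd; rewrite /seg {1 2}(divn_eq x d) -addnS.
have := ltn_pmod x d0; set i := x %% d; set k := x %/ d => id.
rewrite divnMDl // modnMDl; have [i1|i1] := ltnP i.+1 d.
  by rewrite divn_small // modn_small //; lia.
have -> : i.+1 = d by lia.
by rewrite divnn modnn d0; lia.
Qed.

Lemma seg_mono j x y : j < d -> x <= y -> seg j x <= seg j y.
Proof.
move=> jd /subnK <-; elim: (y - x) => //= k IH; rewrite addSn seg_succ //; exact: leq_trans (leq_addr _ _).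
Qed.

Lemma seg_plug j x : j < d -> ~~ (d %| x) -> plug l x = x \/ seg j x < seg j (plug l x).
Proof.
move=> jd nd; rewrite /plug /is_source (negbTE nd) /=; case: ifP => [|_]; last by left.
move=> /code_mem[xk _ _]; right; rewrite seg_mul.
by have := seg_mono jd xk; rewrite seg_mul ltnS.
Qed.

Lemma path_up j c x : j < d -> c != j -> seg j x = seg j (path_nbr c x).
Proof.
move=> jd cj; rewrite /path_nbr; case: ifP => [/andP[/eqP xc _]|_].
  by rewrite seg_succ // xc (negbTE cj) addn0.
case: ifP => // /andP[x0 /eqP xc]; by rewrite -{1}(prednK x0) seg_succ // xc (negbTE cj) addn0.
Qed.

Lemma path_nbr_cases c x : [\/ path_nbr c x = x, path_nbr c x = x.+1 /\ c = x %% d |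
  [/\ path_nbr c x < x & c = x.-1 %% d]].
Proof.
rewrite /path_nbr; case: ifP => [/andP[/eqP xc _]|_]; first by constructor 2.
case: ifP => [/andP[x0 /eqP xc]|_]; last by constructor 1.
by constructor 3; rewrite prednK.
Qed.

(** Acyclicity in the form needed for collapsing: without colour [j], every nonempty set of nodes
    has a member with at most one neighbour inside. For [j = d] it is the last node of the path;
    otherwise it lies in the last segment [M] meeting the set, where plugs of nodes that are not
    multiples of [d] lead to later segments. *)
Lemma nbr_degenerate j (w : pred nat) : j <= d -> (exists x, w x) -> (forall x, w x -> x <= N) ->
  exists q c, [/\ w q, c <= d & forall i, i <= d -> i != j -> i != c -> ~~ w (nbr l i q) \/ nbr l i q = q].
Proof.
move=> jd w0 wN; have [jd'|jd'] := ltnP j d; last first.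
  have ej : j = d by apply/eqP; rewrite eqn_leq jd jd'.
  case: (ex_maxnP w0 wN) => q wq qmax; exists q, (q.-1 %% d); split=> //.
    by apply: ltnW; rewrite ltn_pmod.
  move=> i id ij ic; have {}id : i < d by rewrite ltn_neqAle id -ej ij.
  rewrite /nbr id; case: (path_nbr_cases i q) => [->|[-> _]|[_ e]]; first by right.
    by left; apply/negP => /qmax; rewrite ltnn.
  by rewrite e eqxx in ic.
have [x0 wx0] := w0.
have exM : exists M, has (fun x => w x && (seg j x == M)) (iota 0 N.+1).
  by exists (seg j x0); apply/hasP; exists x0; rewrite ?mem_iota ?ltnS ?wN //= wx0 eqxx.
have bdM M : has (fun x => w x && (seg j x == M)) (iota 0 N.+1) -> M <= seg j N.
  by move=> /hasP[x _ /andP[wx /eqP <-]]; apply: seg_mono => //; exact: wN.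
case: (ex_maxnP exM bdM) => M /hasP[x1 _ x1P] Mmax.
have segM x : w x -> seg j x <= M.
  move=> wx; apply: Mmax; apply/hasP; exists x; rewrite ?mem_iota ?ltnS ?wN //= wx eqxx //.
pose wM x := w x && (seg j x == M).
have wM0 : exists x, wM x by exists x1.
have wMN x : wM x -> x <= N by move=> /andP[/wN].
case: (ex_maxnP wM0 wMN) => qa qaP qa_max; case: (ex_minnP wM0) => qi qiP qi_min.
have plug_out q : wM q -> ~~ (d %| q) -> ~~ w (plug l q) \/ plug l q = q.
  move=> /andP[_ /eqP qM] nd; case: (seg_plug jd' nd) => [|h]; first by right.
  by left; apply/negP => /segM; rewrite leqNgt -qM h.
have path_in q i : wM q -> i != j -> w (path_nbr i q) -> wM (path_nbr i q).
  by move=> /andP[_ /eqP qM] ij wp; rewrite /wM wp -path_up // qM eqxx.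
(* If the last node is not a multiple of [d], its plug leaves the set and only its predecessor can
   remain. *)
have [dqa|dqa] := boolP (d %| qa); last first.
  exists qa, (qa.-1 %% d); split; first by case/andP: qaP.
    by apply: ltnW; rewrite ltn_pmod.
  move=> i id ij ic; rewrite /nbr; case: ifP => [id'|_]; last exact: plug_out.
  have [wp|] := boolP (w (path_nbr i qa)); last by left.
  have := path_in _ _ qaP ij wp; case: (path_nbr_cases i qa) => [->|[-> _]|[_ e]]; first by right.
    by move=> /qa_max; rewrite ltnn.
  by rewrite e eqxx in ic.
(* A lone multiple of [d] keeps only its own plug, of colour [d]. *)
have [eq|neq] := eqVneq qi qa.
  exists qa, d; split=> //; first by case/andP: qaP.
  move=> i id ij ic; have id' : i < d by rewrite ltn_neqAle ic.
  rewrite /nbr id'; have [wp|] := boolP (w (path_nbr i qa)); last by left.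
  have := path_in _ _ qaP ij wp; case: (path_nbr_cases i qa) => [->|[-> _]|[h e]]; first by right.
    by move=> /qa_max; rewrite ltnn.
  by move=> /qi_min; rewrite eq leqNgt h.
(* A segment contains only one multiple of [d], so the first node is not one, and only its successor
   can remain. *)
have nd : ~~ (d %| qi).
  apply: contra neq => dqi; case/andP: qiP => _ /eqP e1; case/andP: qaP => _ /eqP e2.
  rewrite -(divnK dqi) -(divnK dqa) ![_ * d]mulnC.
  by rewrite -(divnK dqi) mulnC seg_mul in e1; rewrite -(divnK dqa) mulnC seg_mul in e2; rewrite e1 e2.
exists qi, (qi %% d); split; first by case/andP: qiP.
  by apply: ltnW; rewrite ltn_pmod.
move=> i id ij ic; rewrite /nbr; case: ifP => [id'|_]; last exact: plug_out.
have [wp|] := boolP (w (path_nbr i qi)); last by left.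
have := path_in _ _ qiP ij wp; case: (path_nbr_cases i qi) => [->|[_ e]|[h _]]; first by right.
  by rewrite e eqxx in ic.
by move=> /qi_min; rewrite leqNgt h.
Qed.

End Code.

Lemma plug_inj l l' : good_code l -> good_code l' -> size l = size l' ->
  (forall x, x <= N -> plug l x = plug l' x) -> l = l'.
Proof.
move=> gl gl' sl H; apply: (@eq_from_nth _ 0) => // k kl.
have := H _ (source_small gl kl).
have [s1 e1] := source_index kl; rewrite sl in kl; have [s2 e2] := source_index kl.
by rewrite /plug s1 s2 e1.
Qed.

Definition avail m l := [seq b <- iota 0 (d * m.+1).+1 | ~~ (d %| b) && (b \notin l)].

Fixpoint codes m : seq (seq nat) :=
  if m is m'.+1 then [seq rcons l b | l <- codes m', b <- avail m' l] else [:: [::]].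

(** The residues 1 and 2, distinct from 0 since [2 < d], give [2 * m.+1] admissible targets, of
    which at most [m] are taken. *)
Lemma size_avail m l : size l = m -> m.+2 <= size (avail m l).
Proof.
move=> sl; pose T := [seq d * k + e | k <- iota 0 m.+1, e <- [:: 1; 2]].
have e12 e : e \in [:: 1; 2] -> 0 < e < d.
  by rewrite !inE => /orP[/eqP ->|/eqP ->] //=; apply: ltnW.
have uT : uniq T.
  apply: allpairs_uniq; rewrite ?iota_uniq // => -[k e] [k' e'] /allpairsP[[k1 e1] [_ h1 []]] -> -> /allpairsP[[k2 e2] [_ h2 []]] -> -> h.
  have /andP[_ l1] := e12 _ h1; have /andP[_ l2] := e12 _ h2.
  have kk : k1 = k2.
    have := congr1 (fun x => x %/ d) h; by rewrite /= ![d * _]mulnC !divnMDl // !divn_small // !addn0.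
  by rewrite kk in h *; move/addnI: h => ->.
have sub : {subset [seq b <- T | b \notin l] <= avail m l}.
  move=> b; rewrite mem_filter => /andP[bl /allpairsP[[k e] [hk he bE]]].
  have /andP[e0 ed] : 0 < e < d by exact: e12.
  have {}hk : k < m.+1 by move: hk; rewrite mem_iota add0n.
  rewrite /avail mem_filter bl andbT mem_iota add0n ltnS leq0n andTb bE [(k, e).1]/= [(k, e).2]/=.
  rewrite /dvdn mulnC modnMDl modn_small // -lt0n e0 andTb mulnC.
  apply: leq_trans (_ : d * k.+1 <= _); last by rewrite leq_mul2l hk orbT.
  by rewrite mulnS addnC leq_add2r ltnW.
apply: leq_trans (uniq_leq_size (filter_uniq _ uT) sub).
have sT : size T = m.+1 * 2 by rewrite size_allpairs size_iota.
have c1 : count (mem l) T <= m.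
  rewrite -sl -size_filter; apply: uniq_leq_size; first exact: filter_uniq.
  by move=> b; rewrite mem_filter => /andP[].
rewrite size_filter; have := count_predC (mem l) T; rewrite sT.
have -> : count (predC (mem l)) T = count (fun b => b \notin l) T by apply: eq_count.
lia.
Qed.

Lemma codesP m l : l \in codes m -> [/\ size l = m, uniq l &
  forall k, k < m -> nth 0 l k <= d * k.+1 /\ ~~ (d %| nth 0 l k)].
Proof.
elim: m l => [|m IH] l /=; first by rewrite inE => /eqP ->.
move=> /allpairsPdep[l' [b [/IH[sl ul Hl] bA ->]]].
move: bA; rewrite mem_filter mem_iota /= add0n ltnS => /andP[/andP[nd bl] bd].
rewrite size_rcons sl rcons_uniq bl ul; split=> // k; rewrite ltnS nth_rcons sl => km.
case: ltnP => [/Hl //|mk]; have -> : k = m by apply/eqP; rewrite eqn_leq km mk.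
by rewrite eqxx.
Qed.

Lemma codes_good m l : d * m.+1 <= N -> l \in codes m -> good_code l.
Proof. by move=> mN /codesP[sl ul Hl]; split; rewrite ?sl // => k; rewrite sl; exact: Hl. Qed.

Lemma codes_uniq m : uniq (codes m).
Proof.
elim: m => //= m IH; apply: allpairs_uniq_dep => //.
  by move=> l _; apply: filter_uniq; exact: iota_uniq.
move=> [l b] [l' b'] _ _ /= /rcons_inj[-> ->] //.
Qed.

Lemma size_codes m : (m.+1)`! <= size (codes m).
Proof.
elim: m => // m IH; rewrite [codes _]/= size_allpairs_dep factS mulnC.
apply: leq_trans (_ : size (codes m) * m.+2 <= _); first by rewrite leq_mul2r IH orbT.
rewrite sumnE big_map -sum1_size big_distrl /= big_seq [X in _ <= X]big_seq.
by apply: leq_sum => l /codesP[sl _ _]; rewrite mul1n; exact: size_avail.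
Qed.

End PluggedPath.

(** * Restriction to one component, and the reflected complex *)

Section AdditiveComponents.
Variables (V I : finType) (g : I -> V -> V).
Hypothesis gK : forall i, involutive (g i).

Lemma ncomp_sum (S T : {set I}) : T \subset S ->
  ncomp g T [set: V] = (\sum_(H in [set orb g S v | v in [set: V]]) ncomp g T H)%N.
Proof.
move=> sTS; rewrite /ncomp -sum1_card.
pose phi (K : {set V}) : {set V} := \bigcup_(v in K) orb g S v.
have phiE v : phi (orb g T v) = orb g S v.
  apply/setP => w; apply/bigcupP/idP => [[u uv wu]|wv]; last by exists v => //; exact: orb_refl.
  by apply: orb_trans wu; exact: (subsetP (orb_sub g v sTS)).
rewrite (partition_big phi (mem [set orb g S v | v in [set: V]])) /=; last first.
  by move=> K /imsetP[v _ ->]; rewrite phiE; apply/imsetP; exists v; rewrite ?inE.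
apply: eq_bigr => H /imsetP[h _ ->]; rewrite sum1dep_card; congr #|pred_of_set _|.
apply/setP => K; rewrite inE; apply/andP/imsetP => [[/imsetP[v _ ->] /eqP]|[v vh ->]].
  by rewrite phiE => e; exists v => //; rewrite -e orb_refl.
by rewrite phiE imset_f ?inE //; split => //; rewrite (orb_eqP gK vh).
Qed.

Lemma ncomp_self (S : {set I}) v : ncomp g S (orb g S v) = 1%N.
Proof.
rewrite /ncomp; apply/eqP/cards1P; exists (orb g S v); apply/setP => K; rewrite inE.
apply/imsetP/eqP => [[w wv ->]|->]; last by exists v => //; exact: orb_refl.
exact: orb_eqP.
Qed.

End AdditiveComponents.

(* The transverse directions of a face are doubled by reflections, so that the
   neighbourhood of an interior point of a face becomes a full cone over a cube. *)
Lemma sum_subset_sign (J : finType) (B : {set J}) :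
  \sum_(Q : {set J} | Q \subset B) (-1) ^+ #|Q| * 2 ^+ (#|B| - #|Q|) = 1 :> int.
Proof.
have [m] := ubnP #|B|; elim: m B => // m IH B Bm.
have [->|[i iB]] := set_0Vmem B; first by rewrite big_subset0 cards0.
have iBi : i \notin B :\ i by rewrite !inE eqxx.
rewrite -(setD1K iB) big_subsetU1 // -[RHS](IH (B :\ i)); last first.
  by move: Bm; rewrite (cardsD1 i) iB.
rewrite -big_split /=; apply: eq_bigr => Q sQ; rewrite !cardsU1 iBi /=.
have -> : i \notin Q by apply: contra iBi; exact: (subsetP sQ).
rewrite subSS subSn ?subset_leq_card // exprS [in X in _ + X]exprS; ring.
Qed.

Section Doubling.
Variables (V I : finType) (d : nat) (g : I -> V -> V) (S : {set I}) (c : 'I_d -> I).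
Hypothesis gK : forall i, involutive (g i).
Hypothesis c_inj : injective c.
Hypothesis S_c : forall i, i \in S -> exists k, i = c k.
Local Notation V' := (V * {ffun 'I_d -> bool})%type.
Implicit Types (T : {set 'I_d}) (x y : V').

Definition flip (k : 'I_d) (e : {ffun 'I_d -> bool}) : {ffun 'I_d -> bool} :=
  [ffun i => (i == k) (+) e i].

(** Directions with colour in [S] cross a real facet; in the others the orthant is reflected. All
    [d] directions then behave like walls of an orthant. *)
Definition doubled (k : 'I_d) (x : V') : V' :=
  if c k \in S then (g (c k) x.1, x.2) else (x.1, flip k x.2).

Lemma doubledK k : involutive (doubled k).
Proof.
move=> [v e]; rewrite /doubled /=; case: ifP => kS /=; rewrite kS /= ?gK //.
by congr pair; apply/ffunP => i; rewrite !ffunE addKb.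
Qed.

Lemma doubled_neq k x : (forall i v, g i v != v) -> doubled k x != x.
Proof.
case: x => v e g_neq; rewrite /doubled /=; case: ifP => _; rewrite xpair_eqE.
  by rewrite (negbTE (g_neq _ _)).
rewrite eqxx /=; apply/eqP => /ffunP/(_ k); rewrite ffunE eqxx.
by case: (e k).
Qed.

Definition real_dirs T : {set I} := [set i in S | [exists k in T, c k == i]].

Lemma real_dirsE T k : c k \in S -> (c k \in real_dirs T) = (k \in T).
Proof.
move=> kS; rewrite inE kS /=; apply/existsP/idP => [[k' /andP[kT /eqP/c_inj <-]] //|kT].
by exists k; rewrite kT eqxx.
Qed.

(** Real and reflected directions act independently, so a component is a product. *)
Lemma orb_doubled T x y : (y \in orb doubled T x) =
  (y.1 \in orb g (real_dirs T) x.1) && [forall k, ((k \notin T) || (c k \in S)) ==> (x.2 k == y.2 k)].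
Proof.
apply/idP/andP => [|[]].
  apply: (@orb_ind _ _ doubled T x y (fun y => y.1 \in orb g (real_dirs T) x.1 /\
     [forall k, ((k \notin T) || (c k \in S)) ==> (x.2 k == y.2 k)])); last first.
    by split; [exact: orb_refl|apply/forallP => k; rewrite eqxx implybT].
  move=> k [u e] kT [/= ux /forallP ex]; rewrite /doubled /=; case: ifPn => kS /=; split => //.
  - by apply: orb_trans ux _; apply: orb_step; rewrite real_dirsE.
  - exact/forallP.
  apply/forallP => i; have := ex i; rewrite ffunE.
  have := ex i; rewrite /flip ?ffunE; have [->|//] := eqVneq i k.
  by rewrite (negbTE kS) orbF => _; move: (kT : is_true (k \in T)) => ->.
case: x y => [v e] [w e'] /= wv /forallP ee.
apply: (@orb_trans _ _ _ _ _ (w, e)).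
  apply: (@orb_ind _ _ g (real_dirs T) v w (fun w => (w, e) \in orb doubled T (v, e))) => //; last exact: orb_refl.
  move=> i u iT IH; apply: orb_trans IH _.
  move: iT; rewrite inE => /andP[iS /existsP[k /andP[kT /eqP ki]]].
  have -> : (g i u, e) = doubled k (u, e) by rewrite /doubled ki iS.
  exact: orb_step.
suff H (A : {set 'I_d}) : (w, [ffun k => if k \in A then e' k else e k]) \in orb doubled T (w, e).
  by have := H setT; rewrite (_ : [ffun k => _] = e') //; apply/ffunP => k; rewrite ffunE inE.
have [m] := ubnP #|A|; elim: m A => // m IH A; rewrite ltnS => Am.
have [->|[k kA]] := set_0Vmem A.
  rewrite (_ : [ffun k => _] = e) ?orb_refl //; apply/ffunP => k; by rewrite ffunE inE.
have {}IH := IH (A :\ k) _; rewrite (cardsD1 k) kA in Am; have {IH Am} IH := IH Am.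
set e1 := [ffun k => _] in IH *.
have [eq_e|neq_e] := eqVneq (e k) (e' k).
  rewrite (_ : [ffun k => _] = e1) //; apply/ffunP => i; rewrite !ffunE !inE.
  by case: (eqVneq i k) => [->|_]; rewrite ?kA //=.
have := ee k; rewrite (negbTE neq_e) implybF negb_or negbK => /andP[kT kS].
apply: orb_trans IH _.
rewrite (_ : (w, _) = doubled k (w, e1)); first exact: orb_step.
rewrite /doubled /= (negbTE kS); congr pair; apply/ffunP => i; rewrite !ffunE !inE.
case: (eqVneq i k) => [->|_] //=; rewrite kA.
by move: neq_e; case: (e k); case: (e' k).
Qed.


Definition zero_bits : {ffun 'I_d -> bool} := [ffun=> false].
Definition clear_bits T (e : {ffun 'I_d -> bool}) : {ffun 'I_d -> bool} :=
  [ffun k => (k \notin T) && (c k \notin S) && e k].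

(** Each reflected direction outside [T] doubles the number of components, while one in [T]
    identifies the two sides. Components are told apart by [clear_bits], which forgets the
    identified bits. *)
Lemma ncomp_doubled T v0 : ncomp doubled T (orb doubled setT (v0, zero_bits)) =
  (ncomp g (real_dirs T) (orb g S v0) * 2 ^ #|[set k | (k \notin T) && (c k \notin S)]|)%N.
Proof.
set C := orb doubled _ _.
have SE : real_dirs setT = S.
  apply/setP => i; rewrite inE; case iS: (i \in S) => //=; have [k ->] := S_c iS.
  by apply/existsP; exists k; rewrite inE eqxx.
have CE x : (x \in C) = (x.1 \in orb g S v0) && [forall k, (c k \in S) ==> ~~ x.2 k].
  rewrite orb_doubled SE /=; congr andb; apply: eq_forallb => k.
  by rewrite inE /= ffunE eq_sym eqbF_neg.
rewrite /ncomp.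
rewrite (@card_imset_eq _ _ _ _ (fun x : V' => (orb g (real_dirs T) x.1, clear_bits T x.2))); last first.
  move=> x y; rewrite !CE => /andP[_ /forallP ex] /andP[_ /forallP ey].
  rewrite (orb_eq doubledK) xpair_eqE (orb_eq gK) orb_doubled; congr andb.
  apply/forallP/eqP => [H|/ffunP H k].
    apply/ffunP => k; rewrite !ffunE; have := H k.
    by case: (k \in T); case: (c k \in S) => //= /eqP ->.
  apply/implyP; have := H k; rewrite !ffunE.
  have := ex k; have := ey k; case: (k \in T); case: (c k \in S) => //=.
  - by move=> /negbTE -> /negbTE ->.
  - by move=> /negbTE -> /negbTE ->.
  - by move=> _ _ ->.
rewrite (_ : [set _ | _ in _] = setX [set orb g (real_dirs T) v | v in orb g S v0]
   [set e : {ffun 'I_d -> bool} | [forall k, e k ==> ((k \notin T) && (c k \notin S))]]); last first.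
  apply/setP => -[K e]; rewrite inE /=; apply/imsetP/andP => [[[v e'] vC [-> ->]]|[/imsetP[v vS ->]]].
    split; first by apply: imset_f; move: vC; rewrite CE => /andP[].
    rewrite inE; apply/forallP => k; rewrite ffunE.
    by case: (k \in T); case: (c k \in S) => //=; rewrite implybT.
  rewrite inE => /forallP ek; exists (v, e).
    rewrite CE vS; apply/forallP => k; have := ek k.
    by case: (c k \in S) => //=; rewrite andbF implybF.
  congr pair; apply/ffunP => k; rewrite ffunE; have := ek k.
  by case: (e k) => /= [->|_]; rewrite ?andbF.
rewrite cardsX; congr muln; rewrite -card_powerset.
set P := [set k | _].
have inj : injective (fun e : {ffun 'I_d -> bool} => [set k | e k]).
  by move=> e e' /setP H; apply/ffunP => k; have := H k; rewrite !inE.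
rewrite -(card_imset _ inj); congr #|pred_of_set _|; apply/setP => A; rewrite inE.
apply/imsetP/subsetP => [[e]|sA].
  by rewrite inE => /forallP H -> k; rewrite !inE => ek; have := H k; rewrite ek.
exists [ffun k => k \in A].
  by rewrite inE; apply/forallP => k; rewrite ffunE; apply/implyP => /sA; rewrite inE.
by apply/setP => k; rewrite inE ffunE.
Qed.

(** Splitting [T] into directions with colour in [S] and reflected ones, the latter contribute (2 -
    1)^m = 1. *)
Lemma euler_doubled v0 :
  \sum_(T : {set 'I_d}) (-1) ^+ #|T| * (ncomp doubled T (orb doubled setT (v0, zero_bits)))%:Z =
  \sum_(J : {set I} | J \subset S) (-1) ^+ #|J| * (ncomp g J (orb g S v0))%:Z.
Proof.
pose A := [set k | c k \in S].
under eq_bigr do rewrite ncomp_doubled.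
pose F T := (-1) ^+ #|T| * (ncomp g (real_dirs T) (orb g S v0) * 2 ^ #|[set k | (k \notin T) && (c k \notin S)]|)%:Z.
rewrite (reindex_onto (fun P : {set 'I_d} * {set 'I_d} => P.1 :|: P.2) (fun T => (T :&: A, T :\: A))) /=; last first.
  by move=> T _; exact: setID.
rewrite (eq_bigl (fun P : {set 'I_d} * {set 'I_d} => (P.1 \subset A) && (P.2 \subset ~: A))); last first.
  move=> [P Q] /=; rewrite xpair_eqE; apply/andP/andP => [[/eqP <- /eqP <-]|[sP sQ]].
    by rewrite subsetIr; split => //; rewrite setDE subsetIr.
  split; apply/eqP/setP => k; have := subsetP sP k; have := subsetP sQ k; rewrite !inE;
    case: (k \in P); case: (k \in Q); case: (c k \in S) => //= h1 h2; by [have := h1 isT|have := h2 isT].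
rewrite -(pair_big (fun P : {set 'I_d} => P \subset A) (fun Q : {set 'I_d} => Q \subset ~: A)
  (fun P Q => (-1) ^+ #|P :|: Q| * (ncomp g (real_dirs (P :|: Q)) (orb g S v0) *
    2 ^ #|[set k | (k \notin P :|: Q) && (c k \notin S)]|)%:Z)) /=.
rewrite (reindex_onto real_dirs (fun J => [set k | c k \in J])) /=; last first.
  move=> J sJ; apply/setP => i; rewrite inE; apply/andP/idP => [[_ /existsP[k]]|iJ].
    by rewrite inE => /andP[h /eqP <-].
  have iS := subsetP sJ _ iJ; split => //; have [k ik] := S_c iS.
  by apply/existsP; exists k; rewrite inE -ik iJ eqxx.
have bij (P : {set 'I_d}) : P \subset A -> [set k | c k \in real_dirs P] = P.
  move=> sP; apply/setP => k; rewrite inE; case kS: (c k \in S); first by rewrite real_dirsE.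
  rewrite inE kS /=; apply/esym/negbTE; apply: contraFN kS => kP.
  by have := subsetP sP k kP; rewrite inE.
rewrite [RHS](eq_bigl (fun P : {set 'I_d} => P \subset A)); last first.
  move=> P; apply/andP/idP => [[_ /eqP <-]|sP]; last by rewrite bij // eqxx; split=> //; apply/subsetP => i; rewrite inE => /andP[].
  by apply/subsetP => k; rewrite !inE => /andP[].
apply: eq_bigr => P sP.
have cP : #|real_dirs P| = #|P|.
  rewrite -(card_imset _ c_inj); congr #|pred_of_set _|; apply/setP => i.
  rewrite inE; apply/andP/imsetP => [[_ /existsP[k /andP[kP /eqP <-]]]|[k kP ->]]; first by exists k.
  have := subsetP sP k kP; rewrite inE => kS; split => //.
  by apply/existsP; exists k; rewrite kP eqxx.
transitivity (\sum_(Q : {set 'I_d} | Q \subset ~: A) (-1) ^+ #|P| * (ncomp g (real_dirs P) (orb g S v0))%:Z *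
    ((-1) ^+ #|Q| * 2 ^+ #|~: A :\: Q|)).
  apply: eq_bigr => Q sQ.
  have dPQ : [disjoint P & Q].
    by rewrite disjoints_subset; apply: subset_trans sP _; rewrite -[A]setCK setCS.
  have -> : #|P :|: Q| = (#|P| + #|Q|)%N by rewrite cardsU disjoint_setI0 // cards0 subn0.
  have -> : real_dirs (P :|: Q) = real_dirs P.
    apply/setP => i; rewrite !inE; case iS: (i \in S) => //=; have [k ik] := S_c iS.
    have kQ : k \notin Q by apply/negP => /(subsetP sQ); rewrite !inE -ik iS.
    apply/existsP/existsP => -[k' /andP[k'P /eqP e]]; exists k'; rewrite -e eqxx andbT ?inE ?k'P //.
    by move: k'P; rewrite inE; case/orP => // k'Q; move: e kQ; rewrite ik => /c_inj <-; rewrite k'Q.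
  have -> : [set k | (k \notin P :|: Q) && (c k \notin S)] = ~: A :\: Q.
    apply/setP => k; have := subsetP sP k; rewrite !inE.
    by case: (k \in P) => [/(_ isT) ->|_] //=; rewrite !andbF.
  by rewrite exprD PoszM -[Posz (2 ^ _)]natz natrX; ring.
rewrite -mulr_sumr cP; suff -> : \sum_(Q : {set 'I_d} | Q \subset ~: A) (-1) ^+ #|Q| * 2 ^+ #|~: A :\: Q| = 1 :> int.
  by rewrite mulr1.
rewrite -[RHS](sum_subset_sign (~: A)); apply: eq_bigr => Q sQ.
by rewrite cardsDS.
Qed.

End Doubling.

From mathcomp Require Import generic_quotient.
From mathcomp Require Import all_classical all_reals all_analysis.
From mathcomp Require Import Rstruct Rstruct_topology.
Require Import Defs.

Import Order.TTheory GRing.Theory Num.Theory.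
Import numFieldNormedType.Exports.
Local Open Scope classical_set_scope.
Local Open Scope ring_scope.

(** * Row vectors and interpolation *)

Section RowVectors.
Variable R : realType.

Lemma row_norm_leP d (x : 'rV[R]_d) (e : R) : 0 <= e ->
  (`|x| <= e) <-> (forall i, `|x ord0 i| <= e).
Proof.
move=> e0; rewrite /Num.Def.normr /= mx_normrE; split => [H i|H].
  apply: le_trans H; exact: (le_bigmax _ (fun ij : 'I_1 * 'I_d => `|x ij.1 ij.2|) (ord0, i)).
by apply/bigmax_leP; split => // -[i j] _ /=; rewrite (ord1 i); exact: H.
Qed.

Lemma row_coord_le d (x : 'rV[R]_d) i : `|x ord0 i| <= `|x|.
Proof. exact: (proj1 (row_norm_leP x (normr_ge0 x)) (lexx _) i). Qed.

Lemma row_nbhsP d (z : 'rV[R]_d) (A : set 'rV[R]_d) :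
  nbhs z A <-> exists2 e, 0 < e & forall y, `|y - z| < e -> A y.
Proof.
split=> [/nbhs_ballP[e /= e0 H]|[e e0 H]].
  by exists e => // y yz; apply: H; rewrite -ball_normE /= distrC.
by apply/nbhs_ballP; exists e => //= y; rewrite -ball_normE /= distrC; exact: H.
Qed.

Lemma row_continuousP d (W : normedModType R) (f : 'rV[R]_d -> W) z :
  {for z, continuous f} <->
  (forall e, 0 < e -> exists2 e', 0 < e' & forall y, `|y - z| < e' -> `|f y - f z| < e).
Proof.
split=> [cf e e0|H].
  have /row_nbhsP[e' e'0 He'] : nbhs z (f @^-1` ball (f z) e) by apply: cf; exact: nbhsx_ballx.
  by exists e' => // y /He' /=; rewrite -ball_normE /= distrC.
move=> A /nbhs_ballP[e /= e0 eA]; have [e' e'0 He'] := H _ e0.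
apply/row_nbhsP; exists e' => // y /He' h; apply: eA.
by rewrite -ball_normE /= distrC.
Qed.

Lemma compact_unif d (Q : set 'rV[R]_d) (P : R -> 'rV[R]_d -> Prop) : compact Q ->
  (forall e e' z, 0 < e' -> e' <= e -> P e z -> P e' z) ->
  (forall z, Q z -> exists2 e, 0 < e & forall z', `|z' - z| < e -> P e z') ->
  exists2 e, 0 < e & forall z, Q z -> P e z.
Proof.
move=> /compact_near_coveringP cQ Pmono Ploc.
have := cQ R (0^'+)%classic P _.
move=> /(_ _) H.
have : \forall i \near (0^'+ : set_system R), Q `<=` P i.
  apply: H => z /Ploc[e e0 He].
  exists (ball z e, [set x : R | 0 < x <= e]).
    split => /=; first exact: nbhsx_ballx.
    near=> x; apply/andP; split; first by near: x; exact: nbhs_right_gt.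
    by near: x; exact: nbhs_right_le.
  move=> [z' x] /= [bz /andP[x0 xe]]; apply: (Pmono e) => //; apply: He.
  by move: bz; rewrite -ball_normE /= distrC.
move=> near0.
have [x [Qx x0]] := @filter_ex _ _ (at_right_proper_filter (0 : R)) _
  (@filterI _ _ (at_right_proper_filter (0 : R)) _ _ near0 (nbhs_right_gt (0 : R))).
by exists x.
Unshelve. all: by end_near. Qed.

Lemma compact_row_le d (a : 'rV[R]_d) (c e : R) : compact [set z : 'rV[R]_d | c <= `|z - a| <= e].
Proof.
apply: bounded_closed_compact.
  exists (e + `|a|); split; first exact: num_real.
  move=> M HM z /= /andP[_ ze]; rewrite -(subrK a z).
  by apply: le_trans (ler_normD _ _) _; apply: le_trans (lerD ze (lexx _)) _; exact: ltW.
have cont : continuous (fun z : 'rV[R]_d => `|z - a|).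
  move=> z; apply/row_continuousP => e0 e0p; exists e0 => // y yz.
  by apply: le_lt_trans (ler_dist_dist _ _) _; rewrite opprB addrA subrK.
rewrite (_ : [set z | _] = (fun z => `|z - a|) @^-1` [set x | c <= x] `&`
   (fun z => `|z - a|) @^-1` [set x | x <= e]).
  by apply: closedI; apply: (continuous_closedP _).1 => //.
by apply/seteqP; split => z /=; [move=> /andP[]|move=> [-> ->]].
Qed.

End RowVectors.

Section Interpolation.
Variable R : realType.

(** The tent function: its integer translates form a partition of unity, and products of them
    interpolate multilinearly on a grid. *)
Definition hat (u : R) : R := Num.max 0 (1 - `|u|).

Lemma hat_ge0 u : 0 <= hat u.
Proof. by rewrite /hat le_max lexx. Qed.

Lemma hat_le1 u : hat u <= 1.
Proof. by rewrite /hat ge_max ler01 gerBl normr_ge0. Qed.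

Lemma hat_eq0 u : 1 <= `|u| -> hat u = 0.
Proof. by move=> h; rewrite /hat max_l // subr_le0. Qed.

Lemma hat_lipschitz u v : `|hat u - hat v| <= `|u - v|.
Proof.
rewrite /hat; apply: (@le_trans _ _ (`| `|u| - `|v| |)); last exact: ler_dist_dist.
move: (`|u|) (`|v|) => a b.
by case: (leP 0 (1 - a)) => h1; case: (leP 0 (1 - b)) => h2; rewrite ler_norml; apply/andP; split;
  case: (lerP 0 (a - b)) => h3; rewrite ?(ger0_norm h3) ?(ltr0_norm h3); lra.
Qed.

Lemma hat_partition M u : 0 <= u <= M%:R -> \sum_(k < M.+1) hat (u - k%:R) = 1.
Proof.
elim: M => [|M IH] /andP[u0 uM].
  have -> : u = 0 by apply/eqP; rewrite eq_le uM u0.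
  by rewrite big_ord1 subr0 /hat normr0 subr0 max_r.
rewrite big_ord_recr /=; have [uM'|uM'] := leP u M%:R.
  rewrite IH ?u0 // hat_eq0 ?addr0 // distrC ger0_norm ?subr_ge0 //.
  by move: uM'; rewrite -[in X in _ -> X](natr1 M); lra.
rewrite big_ord_recr /= big1 ?add0r => [|k _]; last first.
  apply: hat_eq0; have kM : k.+1%:R <= M%:R :> R by rewrite ler_nat ltn_ord.
  by rewrite ger0_norm; rewrite -natr1 in kM; lra.
rewrite -natr1 in uM *; rewrite /hat ger0_norm ?subr_ge0 ?(ltW uM') //.
rewrite [ `|u - _| ]ler0_norm ?subr_le0 // !max_r; lra.
Qed.

Lemma prod_lipschitz (I : finType) (x y : I -> R) :
  (forall i, 0 <= x i <= 1) -> (forall i, 0 <= y i <= 1) ->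
  `|\prod_i x i - \prod_i y i| <= \sum_i `|x i - y i|.
Proof.
move=> Hx Hy.
suff [_ _ //] : [/\ 0 <= \prod_i x i <= 1, 0 <= \prod_i y i <= 1 &
  `|\prod_i x i - \prod_i y i| <= \sum_i `|x i - y i|].
apply: (big_rec3 (fun X Y S => [/\ 0 <= X <= 1, 0 <= Y <= 1 & `|X - Y| <= S])).
  by rewrite subrr normr0 lexx ler01.
move=> i X Y S _ [/andP[X0 X1] /andP[Y0 Y1] XY].
have /andP[x0 x1] := Hx i; have /andP[y0 y1] := Hy i.
split; rewrite ?mulr_ge0 ?mulr_ile1 //.
have -> : x i * X - y i * Y = (x i - y i) * X + y i * (X - Y) by ring.
apply: le_trans (ler_normD _ _) _; rewrite !normrM (ger0_norm X0) (ger0_norm y0).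
apply: lerD; first by rewrite ler_piMr.
by apply: le_trans XY; rewrite ler_piMl.
Qed.

Section Interp.
Variables (d M : nat) (r : R).
Hypothesis r0 : 0 < r.
Hypothesis M0 : (0 < M)%N.
Implicit Types (k : {ffun 'I_d -> 'I_M.+1}) (t : 'rV[R]_d).

Definition in_box (r : R) t := forall i, 0 <= t ord0 i <= r.

Let h := r / M%:R.

Let h0 : 0 < h.
Proof. by rewrite divr_gt0 // ltr0n. Qed.

Definition node k : 'rV[R]_d := \row_i (h * (k i)%:R).

Definition node_weight k t : R := \prod_i hat (t ord0 i / h - (k i)%:R).

Definition interp (W : normedModType R) (f : 'rV[R]_d -> W) t : W :=
  \sum_(k : {ffun 'I_d -> 'I_M.+1}) node_weight k t *: f (node k).

Lemma node_weight_ge0 k t : 0 <= node_weight k t.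
Proof. by apply: prodr_ge0 => i _; exact: hat_ge0. Qed.

Lemma node_box k : in_box r (node k).
Proof.
move=> i; rewrite mxE mulr_ge0 ?(ltW h0) //= /h -mulrA ler_piMr ?(ltW r0) //.
by rewrite mulrC ler_pdivrMr ?ltr0n // mul1r ler_nat -ltnS.
Qed.

Lemma node_weight_sum t : in_box r t -> \sum_k node_weight k t = 1.
Proof.
move=> tb; rewrite /node_weight.
rewrite -(bigA_distr_bigA (fun i (k : 'I_M.+1) => hat (t ord0 i / h - k%:R))) big1 // => i _.
apply: hat_partition; have /andP[t0 tr] := tb i; rewrite divr_ge0 ?(ltW h0) //=.
by rewrite ler_pdivrMr // /h mulrCA divff ?mulr1 // pnatr_eq0 -lt0n.
Qed.

Lemma node_weight_near k t : node_weight k t != 0 -> `|node k - t| <= h.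
Proof.
move=> /prodf_neq0 H; apply/(row_norm_leP _ (ltW h0)) => i.
have := H i isT; rewrite !mxE; apply: contraTT; rewrite -ltNge => hi.
rewrite negbK hat_eq0 //.
have -> : t ord0 i / h - (k i)%:R = - (h * (k i)%:R - t ord0 i) / h.
  by field; rewrite gt_eqF.
by rewrite normrM normrN normfV (gtr0_norm h0) ler_pdivlMr // mul1r ltW.
Qed.

Lemma interp_close (W : normedModType R) (f : 'rV[R]_d -> W) e t : in_box r t ->
  (forall t', in_box r t' -> `|t' - t| <= h -> `|f t' - f t| <= e) ->
  `|interp f t - f t| <= e.
Proof.
move=> tb H.
have -> : interp f t - f t = \sum_k node_weight k t *: (f (node k) - f t).
  rewrite -[X in _ - X = _]scale1r -(node_weight_sum tb) scaler_suml /interp -sumrB.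
  by apply: eq_bigr => k _; rewrite scalerBr.
apply: le_trans (ler_norm_sum _ _ _) _.
rewrite -[e]mul1r -(node_weight_sum tb) mulr_suml; apply: ler_sum => k _.
rewrite normrZ (ger0_norm (node_weight_ge0 k t)).
have [->|/node_weight_near nk] := eqVneq (node_weight k t) 0; first by rewrite !mul0r.
by apply: ler_wpM2l; [exact: node_weight_ge0|apply: H => //; exact: node_box].
Qed.

(** No regularity of [f] is needed, as only its values at the nodes enter. This turns a continuous
    chart into one to which a pigeonhole argument applies. *)
Lemma interp_lipschitz (W : normedModType R) (f : 'rV[R]_d -> W) t t' :
  `|interp f t - interp f t'| <=
  (\sum_k `|f (node k)|) * (d%:R / h) * `|t - t'|.
Proof.
rewrite /interp -sumrB -mulrA mulr_suml.
apply: le_trans (ler_norm_sum _ _ _) _; apply: ler_sum => k _.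
rewrite -scalerBl normrZ mulrC; apply: ler_wpM2l => //.
apply: le_trans (prod_lipschitz _ _) _ => [i|i|]; rewrite ?hat_ge0 ?hat_le1 //.
apply: (@le_trans _ _ (\sum_(i < d) `|t - t'| / h)).
  apply: ler_sum => i _; apply: le_trans (hat_lipschitz _ _) _.
  rewrite (_ : _ - _ - _ = (t - t') ord0 i / h); last by rewrite !mxE; ring.
  by rewrite normrM normfV (gtr0_norm h0) ler_pM2r ?invr_gt0 // row_coord_le.
rewrite sumr_const card_ord [X in X <= _](_ : _ = d%:R / h * `|t - t'|) //; by rewrite -[LHS]mulr_natl; ring.
Qed.

(** Nodes off a wall have weight 0 on it, so gluing along walls survives interpolation. *)
Lemma interp_eq (W : normedModType R) (f f' : 'rV[R]_d -> W) t i : t ord0 i = 0 ->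
  (forall t', in_box r t' -> t' ord0 i = 0 -> f t' = f' t') -> interp f t = interp f' t.
Proof.
move=> ti H; apply: eq_bigr => k _.
have [ki|ki] := eqVneq (k i : nat) 0%N.
  by congr (_ *: _); apply: H; [exact: node_box|rewrite mxE ki mulr0].
rewrite /node_weight (bigD1 i) //= ti mul0r sub0r hat_eq0 ?mul0r ?scale0r //.
by rewrite normrN ger0_norm // ler1n lt0n.
Qed.

End Interp.

(* Pigeonhole: a Lipschitz image of finitely many facets of a cube cannot meet
   every cell of a fine grid of the ambient space. *)
Lemma miss_point (d : nat) (V : finType) (C : {set V}) (f : V -> 'rV[R]_d.+1 -> 'rV[R]_d.+1)
    (L r e : R) (a0 : 'rV[R]_d.+1) : 0 < r -> 0 < e -> 0 <= L ->
  (forall v t t', v \in C -> in_box r t -> in_box r t' -> `|f v t - f v t'| <= L * `|t - t'|) ->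
  exists q c, [/\ `|q - a0| <= e, 0 < c &
    forall v t i, v \in C -> in_box r t -> t ord0 i = 0 -> c <= `|f v t - q|].
Proof.
move=> r0 e0 L0 fL.
(* The candidates [q l] form a grid of P^(d+1) points with spacing [s], and the facets are sampled
   at |V| (d+1) (A P + 1)^d points. [A] is chosen so that one sampling step moves the image by at
   most [s / 4], and [P] exceeds |V| (d+1) (A+1)^d, so there are too few samples. *)
have [A HA] : exists A : nat, 8 * L * r / e < A%:R.
  exists (Num.bound (8 * L * r / e)); apply: archi_boundP.
  by rewrite !mulr_ge0 ?invr_ge0 ?(ltW r0) ?(ltW e0).
pose P := (#|V| * d.+1 * A.+1 ^ d).+1.
pose s := e / P%:R.
have P0 : (0 : R) < P%:R by rewrite ltr0n.
have s0 : 0 < s by rewrite divr_gt0.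
have A0 : (0 < A)%N.
  by rewrite -(ltr_nat R); apply: le_lt_trans HA; rewrite !mulr_ge0 ?invr_ge0 ?(ltW r0) ?(ltW e0).
pose m := (A * P)%N.
have m0 : (0 < m)%N by rewrite muln_gt0 A0.
pose q (l : {ffun 'I_d.+1 -> 'I_P}) : 'rV[R]_d.+1 := a0 + \row_i (s * (l i)%:R).
have qa l : `|q l - a0| <= e.
  rewrite addrC addKr; apply/(row_norm_leP _ (ltW e0)) => i.
  have sl : 0 <= s * (l i)%:R by rewrite mulr_ge0 // ltW.
  rewrite mxE (ger0_norm sl) /s mulrAC ler_pdivrMr // ler_pM2l // ler_nat ltnW //.
have [[l Hl]|no] := pselect (exists l, forall v t i, v \in C -> in_box r t -> t ord0 i = 0 ->
    s / 4 <= `|f v t - q l|).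
  by exists (q l), (s / 4); split => //; rewrite divr_gt0.
have hit l : exists x : V * 'I_d.+1 * {ffun 'I_d -> 'I_m.+1},
    `|f x.1.1 (\row_j (if unlift x.1.2 j is Some j' then r / m%:R * (x.2 j')%:R else 0)) - q l| < s / 2.
  have {no} := (forallNP _).2 no l; move=> /existsNP[v] /existsNP[t] /existsNP[i] /not_implyP[vC] /not_implyP[tb].
  move=> /not_implyP[ti /negP]; rewrite -ltNge => near.
  have hm : 0 < r / m%:R by rewrite divr_gt0 // ltr0n.
  have kP j : (Num.truncn (t ord0 j / (r / m%:R)) < m.+1)%N.
    have /andP[t0 tr] := tb j; rewrite ltnS -(ler_nat R).
    have h1 : 0 <= t ord0 j / (r / m%:R) by rewrite divr_ge0 // ltW.
    apply: le_trans (_ : t ord0 j / (r / m%:R) <= _); first by rewrite truncn_le.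
    rewrite ler_pdivrMr // mulrCA divff ?mulr1 // pnatr_eq0 -lt0n //.
  exists (v, i, [ffun j => Ordinal (kP (lift i j))]) => /=.
  set t' := \row_j _.
  have t'E j : t' ord0 j <= t ord0 j < t' ord0 j + r / m%:R /\ 0 <= t' ord0 j.
    rewrite mxE; case: unliftP => [j' ->|->]; last by rewrite ti add0r hm lexx.
    rewrite ffunE /=; have /andP[t0 _] := tb (lift i j').
    set u := t ord0 _ / _; have u0 : 0 <= u by rewrite divr_ge0 // ltW.
    have uE : t ord0 (lift i j') = r / m%:R * u by rewrite mulrC divfK // gt_eqF.
    have /andP[u1 u2] := truncn_itv u0.
    rewrite uE mulr_ge0 ?(ltW hm) // -[X in _ + X]mulr1 -mulrDr ler_pM2l // ltr_pM2l // u1.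
    by rewrite -natr1 in u2; rewrite u2.
  have t'b : in_box r t'.
    move=> j; have [/andP[h1 _] ->] := t'E j; have /andP[_ tr] := tb j; exact: le_trans h1 tr.
  have tt : `|t' - t| <= r / m%:R.
    apply/(row_norm_leP _ (ltW hm)) => j.
    have -> : (t' - t) ord0 j = t' ord0 j - t ord0 j by rewrite [LHS]mxE [(- t) _ _]mxE.
    by have [/andP[h1 h2] _] := t'E j; rewrite ler_norml; apply/andP; split; lra.
  have -> : f v t' - q l = (f v t' - f v t) + (f v t - q l) by rewrite addrA subrK.
  apply: le_lt_trans (ler_normD _ _) _.
  have h1 : `|f v t' - f v t| <= s / 4.
    apply: le_trans (fL _ _ _ vC t'b tb) _; apply: le_trans (ler_wpM2l L0 tt) _.
    have mR : (0 : R) < m%:R by rewrite ltr0n.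
    rewrite /s /m natrM in mR *; have AR : (0 : R) < A%:R by rewrite ltr0n.
    rewrite [X in X <= _](_ : _ = (L * r / A%:R) / P%:R); last by field; rewrite !gt_eqF.
    rewrite [X in _ <= X](_ : _ = (e / 4) / P%:R); last by field; rewrite !gt_eqF.
    rewrite ler_pM2r ?invr_gt0 // ler_pdivrMr //.
    move: HA; rewrite ltr_pdivrMr // => HA.
    by move: HA; move: (A%:R : R) => x; nra.
  by rewrite [X in _ < X](_ : _ = s / 4 + s / 4); [exact: ler_ltD|field].
have [F HF] := choice hit.
(* A sample within [s / 2] of two candidates puts them closer than [s], the spacing of the grid. *)
have Finj : injective F.
  move=> l l' e12; apply/ffunP => i; apply/val_inj/eqP; apply: contraT => nll.
  have h1 := HF l; have h2 := HF l'; rewrite e12 in h1.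
  set X := f _ _ in h1 h2.
  have : `|q l - q l'| < s.
    have -> : q l - q l' = (X - q l') - (X - q l) by rewrite opprB [RHS]addrC addrA subrK.
    apply: le_lt_trans (ler_normB _ _) _.
    by rewrite [X in _ < X](_ : _ = s / 2 + s / 2); [exact: ltrD|field].
  rewrite ltNge => /negP[]; apply: le_trans (row_coord_le _ i).
  rewrite !mxE (_ : _ - _ = s * ((l i)%:R - (l' i)%:R)); last by ring.
  rewrite normrM (gtr0_norm s0) ler_peMr ?(ltW s0) //.
  rewrite -[(l i)%:R]/((l i : nat)%:Z%:~R) -[(l' i)%:R]/((l' i : nat)%:Z%:~R) -intrB -intr_norm ler1z.
  by move/eqP: nll; rewrite -[X in X -> _]/((l i : nat) <> l' i); lia.
have := leq_card _ Finj; rewrite card_ffun !card_prod card_ffun !card_ord expnS.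
have mP : (m.+1 ^ d <= A.+1 ^ d * P ^ d)%N.
  rewrite -expnMn; have le : (m.+1 <= A.+1 * P)%N by rewrite /m mulSn addnC -addn1 leq_add2l.
  by elim: (d) => // d' IH; rewrite !expnS leq_mul.
move=> h1; have : (P * P ^ d <= #|V| * d.+1 * A.+1 ^ d * P ^ d)%N.
  by apply: leq_trans h1 _; rewrite -[X in (_ <= X)%N]mulnA leq_mul.
by rewrite leq_pmul2r ?expn_gt0 //; rewrite /P ltnn.
Qed.

End Interpolation.

Lemma eq_first_max (d1 d2 : Order.disp_t) (R1 : orderType d1) (R2 : orderType d2) (d : nat)
    (f1 : 'I_d -> R1) (f2 : 'I_d -> R2) :
  (forall i j, (f1 i <= f1 j)%O = (f2 i <= f2 j)%O) -> first_max f1 = first_max f2.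
Proof.
move=> H; apply: eq_pick => i; apply: eq_forallb => j.
by rewrite !ltNge !H.
Qed.

Lemma in_cube_near (I : finType) (p q q' : {ffun I -> nat}) (A : {set I}) :
  in_cube p A q -> in_cube p A q' -> forall i, (q i <= (q' i).+1)%N.
Proof.
move=> /forallP h /forallP h' i; have := h i; have := h' i.
by case: (i \in A); lia.
Qed.

Section Uniform.
Variable R : realType.
Implicit Types x y z e c : R.

Lemma le_half2 x e c : x <= 2 * e -> e <= c / 2 -> x <= c.
Proof. by move=> *; lra. Qed.

Lemma dist_le1 x y : x <= y + 1 -> y <= x + 1 -> `|y - x| <= 1.
Proof. by move=> *; rewrite ler_norml; apply/andP; split; lra. Qed.

Lemma sum_lt_eps e x y : 0 < e -> x < e / 8 -> y <= e / 4 + e / 8 + e / 4 -> x + y < e.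
Proof. by move=> *; lra. Qed.

Lemma lower_third x y z c : x <= y + z -> 2 * c <= x -> z <= c -> c <= y.
Proof. by move=> *; lra. Qed.

Lemma near_half x y e : `|y - x| <= e / 2 -> e <= y -> e / 2 <= x.
Proof. by rewrite ler_norml => /andP[] *; lra. Qed.

Lemma le_sum4 (x y z w : R) : 0 <= x -> 0 <= y -> 0 <= z -> 0 <= w ->
  let s := x + y + z + w in [/\ x <= s, y <= s, z <= s & w <= s].
Proof. by move=> x0 y0 z0 w0 s; rewrite /s; split; lra. Qed.

Lemma fin_unif (V : finType) (P : V -> R -> Prop) :
  (forall v e e', 0 < e' -> e' <= e -> P v e -> P v e') ->
  (forall v, exists2 e, 0 < e & P v e) -> exists2 e, 0 < e & forall v, P v e.
Proof.
move=> Pm /(_ _)/cid2 H; pose e v := projT1 (H v).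
have eP v : 0 < e v /\ P v (e v) by rewrite /e; case: (H v).
exists (\big[Num.min/1]_v e v).
  by apply/bigmin_gtP; split => // v _; case: (eP v).
move=> v; apply: (Pm v (e v)); [|exact: bigmin_le_cond|by case: (eP v)].
by apply/bigmin_gtP; split => // w _; case: (eP w).
Qed.

Lemma compact_box d (r : R) : compact [set t : 'rV[R]_d | in_box r t].
Proof.
have [r0|r0] := ltP r 0.
  case: d => [|d].
    have -> : [set t : 'rV[R]_0 | in_box r t] = [set t | 0 <= `|t - 0| <= 0]; last exact: compact_row_le.
    by apply/seteqP; split => t /= _; [rewrite (_ : t = 0) ?subrr ?normr0 ?lexx //; apply/rowP => -[]|case].
  rewrite (_ : [set t | _] = set0); first exact: compact0.
  by apply/seteqP; split => t //= /(_ ord0)/andP[t0 tr]; have := lt_le_trans r0 (le_trans t0 tr); rewrite ltxx.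
rewrite (_ : [set t | _] = [set t | 0 <= `|t - const_mx (r / 2)| <= r / 2]); first exact: compact_row_le.
have r20 : 0 <= r / 2 by rewrite divr_ge0.
apply/seteqP; split => t /= H.
  rewrite normr_ge0; apply/(row_norm_leP _ r20) => i; have /andP[h1 h2] := H i.
  by rewrite !mxE ler_norml; apply/andP; split; lra.
move: H => /andP[_ /(row_norm_leP _ r20) H] i; have := H i.
by rewrite !mxE ler_norml => /andP[h1 h2]; apply/andP; split; lra.
Qed.

Definition box_continuous d (r : R) (a : 'rV[R]_d -> 'rV[R]_d) :=
  forall t, in_box r t -> forall e, 0 < e ->
    exists2 e', 0 < e' & forall t', in_box r t' -> `|t' - t| < e' -> `|a t' - a t| < e.

Lemma box_unif_continuous d (r : R) (a : 'rV[R]_d -> 'rV[R]_d) e : box_continuous r a -> 0 < e ->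
  exists2 e', 0 < e' & forall t t', in_box r t -> in_box r t' -> `|t' - t| < e' -> `|a t' - a t| < e.
Proof.
move=> ca e0.
have := @compact_unif R d _ (fun x t => in_box r t ->
  forall t', in_box r t' -> `|t' - t| < x -> `|a t' - a t| < e) (@compact_box d r).
case.
- move=> x x' t x'0 x'x H tb t' tb' tt'; apply: H => //; exact: lt_le_trans tt' _.
- move=> t tb; have [x x0 Hx] := ca t tb (e / 2) ltac:(lra).
  exists (x / 2) => [|t1 t1t t1b t' tb' tt']; first lra.
  have -> : a t' - a t1 = (a t' - a t) - (a t1 - a t) by rewrite opprB addrA subrK.
  apply: le_lt_trans (ler_normB _ _) _.
  have h1 : `|a t1 - a t| < e / 2 by apply: Hx => //; lra.
  have h2 : `|a t' - a t| < e / 2.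
    apply: Hx => //; rewrite -(subrK t1 t') -addrA.
    apply: le_lt_trans (ler_normD _ _) _; lra.
  lra.
move=> x x0 Hx; exists x => // t t' tb tb'; exact: Hx.
Qed.

End Uniform.

(** * Exactness for a continuous chart of a cone over orthants *)

Section ChartExact.
Variables (R : realType) (d' : nat).
Local Notation d := d'.+1.
Variables (V : finType) (g : 'I_d -> V -> V) (v0 : V).
Hypothesis gK : forall i, involutive (g i).
Let C := orb g [set: 'I_d]%SET v0.
(** [a v] embeds the box of orthant [v], [a0] is the image of the apex, and [th] and [nu] read off
    the coordinates and an orthant of a point of [U]. The orthant is meaningful only up to the
    directions in which the coordinates vanish. *)
Variables (r : R) (a : V -> 'rV[R]_d -> 'rV[R]_d) (U : set 'rV[R]_d) (a0 : 'rV[R]_d).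
Variables (nu : 'rV[R]_d -> V) (th : 'rV[R]_d -> 'rV[R]_d).
Hypothesis r_gt0 : 0 < r.
Hypothesis openU : open U.
Hypothesis a_in : forall v t, v \in C -> in_box r t -> U (a v t).
Hypothesis a_cont : forall v, v \in C -> box_continuous r (a v).
Hypothesis a_glue : forall v t i, v \in C -> in_box r t -> t ord0 i = 0 -> a (g i v) t = a v t.
Hypothesis th_a : forall v t, v \in C -> in_box r t -> th (a v t) = t.
Hypothesis nu_a : forall v t, v \in C -> in_box r t ->
  nu (a v t) \in orb g [set i | t ord0 i == 0] v.
Hypothesis th_ge0 : forall z i, U z -> 0 <= th z ord0 i.
Hypothesis th_eq0 : forall z, U z -> th z = 0 -> z = a0.
Hypothesis th_cont : forall z, U z -> forall e, 0 < e ->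
  exists2 e', 0 < e' & forall z', `|z' - z| < e' -> `|th z' - th z| < e.
Hypothesis nu_loc : forall z (T : {set 'I_d}), U z -> (forall i, i \notin T -> 0 < th z ord0 i) ->
  exists2 e, 0 < e & forall z', `|z' - z| < e -> nu z' \in orb g T (nu z).

Let v0C : v0 \in C. Proof. exact: orb_refl. Qed.

Let in_box0 s : 0 <= s -> in_box s (0 : 'rV[R]_d).
Proof. by move=> s0 i; rewrite mxE lexx. Qed.

Let a_0 v : v \in C -> a v 0 = a0.
Proof. by move=> vC; apply: th_eq0; [apply: a_in => //|apply: th_a => //]; apply: in_box0; exact: ltW. Qed.

Let Ua0 : U a0.
Proof. by rewrite -(a_0 v0C); apply: a_in => //; apply: in_box0; exact: ltW. Qed.

Let th_a0 : th a0 = 0.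
Proof. by rewrite -(a_0 v0C) th_a //; apply: in_box0; exact: ltW. Qed.

Lemma chart_ball : exists2 rho, 0 < rho & forall z, `|z - a0| <= 2 * rho -> U z.
Proof.
have /row_nbhsP[e e0 He] : nbhs a0 U by exact: open_nbhs_nbhs.
by exists (e / 3) => [|z h]; [lra|apply: He; lra].
Qed.

Lemma chart_shrink rho : 0 < rho -> exists2 s, 0 < s <= r &
  forall v t, v \in C -> in_box s t -> `|a v t - a0| <= rho.
Proof.
move=> rho0.
have [||s s0 Hs] := @fin_unif R V (fun v e => v \in C -> forall t, in_box r t -> `|t| < e -> `|a v t - a0| <= rho).
- by move=> v e e' _ le H vC t tb te; apply: H => //; exact: lt_le_trans te le.
- move=> v; have [vC|vC] := boolP (v \in C); last by exists 1.
  have [e e0 He] := a_cont vC (in_box0 (ltW r_gt0)) rho0.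
  by exists e => // _ t tb te; rewrite -(a_0 vC) ltW // He // subr0.
exists (Num.min (s / 2) r).
  by rewrite lt_min r_gt0 divr_gt0 //= ge_min lexx orbT.
move=> v t vC tb; apply: Hs => //.
  by move=> i; have /andP[-> h] := tb i; apply: le_trans h _; rewrite ge_min lexx orbT.
apply: le_lt_trans (_ : s / 2 < _); last lra.
apply/row_norm_leP => [|i]; first by rewrite divr_ge0 // ltW.
have /andP[t0 h] := tb i; rewrite ger0_norm //; apply: le_trans h _.
by rewrite ge_min lexx.
Qed.

(** Only the apex has all coordinates 0, so on a compact annulus around it the coordinates are
    bounded below. *)
Lemma chart_annulus c rho : 0 < c -> (forall z, `|z - a0| <= 2 * rho -> U z) ->
  exists2 e, 0 < e & forall z, c <= `|z - a0| <= 2 * rho -> e <= `|th z|.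
Proof.
move=> c0 HU.
apply: (@compact_unif R d [set z | c <= `|z - a0| <= 2 * rho] (fun e z => e <= `|th z|) (@compact_row_le R _ _ _ _)).
  by move=> e e' z _ h; exact: le_trans.
move=> z /= /andP[cz zr]; have Uz := HU _ zr.
have thz : 0 < `|th z|.
  rewrite normr_gt0; apply: contraTneq cz => /(th_eq0 Uz) ->.
  by rewrite subrr normr0 -ltNge.
have [e e0 He] := th_cont Uz (divr_gt0 thz (ltr0Sn R 1)).
exists (Num.min e (`|th z| / 2)); first by rewrite lt_min e0 divr_gt0.
move=> z' z'z; have h : `|th z' - th z| < `|th z| / 2.
  by apply: He; apply: lt_le_trans z'z _; rewrite ge_min lexx.
apply: le_trans (_ : `|th z| / 2 <= _); first by rewrite ge_min lexx orbT.
have := ler_normB (th z') (th z' - th z); rewrite opprB addrC subrK => h2; lra.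
Qed.

(** Near a point [nu] changes only across walls where a coordinate vanishes. Compactness makes the
    neighbourhoods uniform, and a coordinate of at least [eta] at [z] stays positive at the centre
    of the neighbourhood. *)
Lemma chart_coherent eta rho : 0 < eta -> (forall z, `|z - a0| <= 2 * rho -> U z) ->
  exists2 e, 0 < e & forall z, `|z - a0| <= 2 * rho -> forall z', `|z' - z| < e ->
    `|th z' - th z| < eta /\
    (forall T : {set 'I_d}, (forall i, i \notin T -> eta <= th z ord0 i) -> nu z' \in orb g T (nu z)).
Proof.
move=> eta0 HU.
have [||e e0 He] := @compact_unif R d [set z | 0 <= `|z - a0| <= 2 * rho] (fun e z => forall z', `|z' - z| < e ->
    `|th z' - th z| < eta /\
    (forall T : {set 'I_d}, (forall i, i \notin T -> eta <= th z ord0 i) -> nu z' \in orb g T (nu z)))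
    (@compact_row_le R _ _ _ _).
- by move=> e e' z _ h H z' z'z; apply: H; exact: lt_le_trans h.
- move=> z /= /andP[_ zr]; have Uz := HU _ zr.
  have [e1 e10 He1] := th_cont Uz (divr_gt0 eta0 (ltr0Sn R 1)).
  pose T0 : {set 'I_d} := [set i | th z ord0 i == 0]%SET.
  have [|e2 e20 He2] := @nu_loc z T0 Uz.
    by move=> i; rewrite inE => h; rewrite lt_neqAle eq_sym h th_ge0.
  exists (Num.min e1 e2 / 2); first by rewrite divr_gt0 // lt_min e10.
  move=> z1 z1z z' z'z1.
  have m1 : Num.min e1 e2 <= e1 by rewrite ge_min lexx.
  have m2 : Num.min e1 e2 <= e2 by rewrite ge_min lexx orbT.
  have zz' : `|z' - z| < Num.min e1 e2.
    rewrite -(subrK z1 z') -addrA; apply: le_lt_trans (ler_normD _ _) _; lra.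
  have m0 := normr_ge0 (z1 - z).
  have h1 : `|th z1 - th z| < eta / 2 by apply: He1; lra.
  have h2 : `|th z' - th z| < eta / 2 by apply: He1; lra.
  split.
    have -> : th z' - th z1 = (th z' - th z) - (th z1 - th z) by rewrite opprB addrA subrK.
    apply: le_lt_trans (ler_normB _ _) _; lra.
  move=> T HT; have sT : T0 \subset T.
    apply/fintype.subsetP => i; rewrite inE => /eqP thi; apply: contraT => /HT h3.
    have := le_trans (row_coord_le (th z1 - th z) i) (ltW h1).
    rewrite !mxE thi subr0 => h4; have := ler_norm (th z1 ord0 i); lra.
  have i1 : nu z1 \in orb g T (nu z) by apply: (fintype.subsetP (orb_sub g _ sT)) _ _; apply: He2; lra.
  have i2 : nu z' \in orb g T (nu z) by apply: (fintype.subsetP (orb_sub g _ sT)) _ _; apply: He2; lra.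
  by apply: orb_trans i2; rewrite orb_sym.
by exists e => // z zr; apply: He => /=; rewrite normr_ge0.
Qed.

Lemma chart_modulus s e : s <= r -> 0 < e -> exists2 e', 0 < e' & forall v, v \in C ->
  forall t t', in_box s t -> in_box s t' -> `|t' - t| < e' -> `|a v t' - a v t| < e.
Proof.
move=> sr e0.
have sub t : in_box s t -> in_box r t.
  by move=> tb i; have /andP[-> h] := tb i; exact: le_trans h sr.
apply: (@fin_unif R V (fun v e' => v \in C -> forall t t', in_box s t -> in_box s t' ->
  `|t' - t| < e' -> `|a v t' - a v t| < e)).
  move=> v x x' _ le H vC t t' tb tb' tt; apply: H => //; exact: lt_le_trans tt le.
move=> v; have [vC|vC] := boolP (v \in C); last by exists 1.
have [x x0 Hx] := box_unif_continuous (a_cont vC) e0.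
by exists x => // _ t t' tb tb'; apply: Hx; exact: sub.
Qed.

(* The Sperner labelling is the largest coordinate of the point
   [(1 - s) a + s gg], where [gg] is an interpolation of the chart [a]: at
   [s = 0] it reads off the parameter itself, and at [s = 1] the faces miss
   [a0], so that no point of theirs is unlabelled. *)
Lemma chart_exact j : (0 < j)%N -> exact_at g v0 j.
Proof.
have [rho rho0 HU] := chart_ball.
have [s /andP[s0 sr] Hs] := chart_shrink rho0.
have sub t : in_box s t -> in_box r t.
  by move=> tb i; have /andP[-> h] := tb i; exact: le_trans h sr.
(* Points whose coordinates reach [s] stay at distance at least [2 * c0] from the apex; this takes
   care of the far sides. *)
have [c0' c0'0 Hc0'] := th_cont Ua0 s0; pose c0 := c0' / 2.
have c00 : 0 < c0 by rewrite divr_gt0.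
have Hc0 z : s <= `|th z| -> 2 * c0 <= `|z - a0|.
  rewrite (_ : 2 * c0 = c0'); last by rewrite /c0; field.
  by apply: contraTT; rewrite -!ltNge => /Hc0'; rewrite th_a0 subr0.
(* The perturbed map will differ from [a] by at most [2 * e]: at most [c0], so the far sides still
   avoid the apex, and at most [rho], so the deformation stays in the ball. *)
pose e := Num.min (c0 / 2) (rho / 2).
have e0 : 0 < e by rewrite lt_min !divr_gt0.
have ec : e <= c0 / 2 by rewrite ge_min lexx.
have er : e <= rho / 2 by rewrite ge_min lexx orbT.
have [dl dl0 Hdl] := chart_modulus sr e0.
pose M := (Num.bound (s / dl)).+1.
have M0 : (0 < M)%N by [].
have MR : (0 : R) < M%:R by rewrite ltr0n.
have hM : s / M%:R < dl.
  rewrite ltr_pdivrMr // mulrC -ltr_pdivrMr //.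
  apply: lt_le_trans (archi_boundP _) _; first by rewrite divr_ge0 // ltW.
  by rewrite ler_nat.
pose f v t := interp M s (a v) t.
have fa v t : v \in C -> in_box s t -> `|f v t - a v t| <= e.
  move=> vC tb; apply: interp_close => // t' tb' tt'; apply/ltW/Hdl => //; exact: le_lt_trans tt' hM.
pose L0 v : R := (\sum_(k : {ffun 'I_d -> 'I_M.+1}) `|a v (node s k)|) * (d%:R / (s / M%:R)).
have L0_ge0 v : 0 <= L0 v.
  by rewrite mulr_ge0 ?sumr_ge0 // divr_ge0 // divr_ge0 // ltW.
pose L := \sum_v L0 v.
have L_ge0 : 0 <= L by apply: sumr_ge0.
have fL v t t' : `|f v t - f v t'| <= L * `|t - t'|.
  apply: le_trans (interp_lipschitz s0 M0 (a v) t t') _; apply: ler_wpM2r => //.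
  by rewrite /L (bigD1 v) //= lerDl sumr_ge0.
have [q [c [qa c_gt0 Hq]]] := @miss_point R _ V C f L s e a0 s0 e0 L_ge0 (fun v t t' _ _ _ => fL v t t').
(* Translating by [q - a0] turns the missed point [q] into the apex [a0]. *)
pose gg v t := f v t - (q - a0).
have gga v t : v \in C -> in_box s t -> `|gg v t - a v t| <= 2 * e.
  move=> vC tb; rewrite /gg addrAC; apply: le_trans (ler_normB _ _) _.
  by rewrite mulr_natl mulr2n lerD // fa.
pose c1 := Num.min c0 c.
have c10 : 0 < c1 by rewrite lt_min c00.
have [eta0 eta00 Heta0] := chart_annulus c10 HU.
(* A point of the ball at distance at least [c1] from the apex has a coordinate of size at least
   [eta], so it is not labelled [None]. *)
pose eta := Num.min eta0 (s / 2).
have eta_gt0 : 0 < eta by rewrite lt_min eta00 divr_gt0.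
have eta_s : eta <= s / 2 by rewrite ge_min lexx orbT.
have Heta z : c1 <= `|z - a0| <= 2 * rho -> eta <= `|th z|.
  by move=> /Heta0; apply: le_trans; rewrite ge_min lexx.
have [eps eps0 Heps] := @chart_coherent (eta / 2) rho ltac:(by rewrite divr_gt0) HU.
have [dl1 dl10 Hdl1] := @chart_modulus s (eps / 8) sr ltac:(by rewrite divr_gt0).
(* [N] exceeds this bound. The first three terms make the variations of [a], of its interpolation
   and of the time between grid neighbours small against [eps]; the last gives [2 * h < eta], which
   makes the threshold [A] positive. *)
pose B := s / dl1 + 4 * L * s / eps + 4 * rho / eps + 2 * s / eta.
have B1 : 0 <= s / dl1 by rewrite divr_ge0 // ltW.
have B2 : 0 <= 4 * L * s / eps by rewrite divr_ge0 ?mulr_ge0 // ltW.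
have B3 : 0 <= 4 * rho / eps by rewrite divr_ge0 ?mulr_ge0 // ltW.
have B4 : 0 <= 2 * s / eta by rewrite divr_ge0 ?mulr_ge0 // ltW.
pose N := Num.bound B.
have NB : B < N%:R by apply: archi_boundP; rewrite !addr_ge0.
have N0 : (0 : R) < N%:R by apply: le_lt_trans NB; rewrite !addr_ge0.
have Nlt x y : 0 < y -> x / y <= B -> x / N%:R < y.
  by move=> y0 xy; rewrite ltr_pdivrMr // mulrC -ltr_pdivrMr //; exact: le_lt_trans NB.
have [le1 le2 le3 le4] := le_sum4 B1 B2 B3 B4.
have N1 : s / N%:R < dl1 by apply: Nlt.
have N2 : 4 * L * s / N%:R < eps by apply: Nlt.
have N3 : 4 * rho / N%:R < eps by apply: Nlt.
have N4 : 2 * s / N%:R < eta by apply: Nlt.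
pose h := s / N%:R.
have h0 : 0 < h by rewrite divr_gt0.
pose y (p : {ffun option 'I_d -> nat}) : 'rV[R]_d := \row_i (h * (p (Some i))%:R).
pose sg (p : {ffun option 'I_d -> nat}) : R := (p None)%:R / N%:R.
pose Z u p := a u (y p) + sg p *: (gg u (y p) - a u (y p)).
pose lab u p := if [forall i, th (Z u p) ord0 i < eta] then None else first_max (fun i => th (Z u p) ord0 i).
have y_box p : valid N p -> in_box s (y p).
  move=> /forallP vp i; rewrite mxE mulr_ge0 ?(ltW h0) //= /h mulrAC ler_pdivrMr // ler_pM2l // ler_nat //.
have sg01 p : valid N p -> 0 <= sg p <= 1.
  by move=> /forallP vp; rewrite divr_ge0 //= ler_pdivrMr // mul1r ler_nat vp.
have Z_in u p : u \in C -> valid N p -> `|Z u p - a0| <= 2 * rho.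
  move=> uC vp; have /andP[g0 g1] := sg01 p vp.
  rewrite /Z addrAC; apply: le_trans (ler_normD _ _) _.
  have h1 := Hs u (y p) uC (y_box p vp); have h2 := gga u (y p) uC (y_box p vp).
  rewrite normrZ ger0_norm //.
  have h3 : sg p * `|gg u (y p) - a u (y p)| <= `|gg u (y p) - a u (y p)| by rewrite ler_piMl.
  by rewrite [2 * rho]mulr_natl mulr2n lerD // (le_trans h3) // (le_half2 h2).
have lab_some u p i : lab u p = Some i -> u \in C -> valid N p -> eta <= th (Z u p) ord0 i.
  rewrite /lab; case: ifPn => // /forallPn[k]; rewrite -leNgt => ek e1 uC vp.
  have [i' e2 Hi] := first_max_some (fun i => th (Z u p) ord0 i) k.
  by rewrite e1 in e2; case: e2 => ->; apply: le_trans ek (Hi k).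
have far u p : u \in C -> valid N p -> c1 <= `|Z u p - a0| -> lab u p != None.
  move=> uC vp cz; have Uz := HU _ (Z_in u p uC vp).
  have := Heta (Z u p); rewrite cz Z_in // => /(_ isT) en; rewrite /lab.
  case: ifPn => [/forallP all_lt|/forallPn[k _]]; last by have [i' -> _] := first_max_some (fun i => th (Z u p) ord0 i) k.
  suff : `|th (Z u p)| < eta by rewrite ltNge en.
  have [i _ Hi] := first_max_some (fun i => th (Z u p) ord0 i) ord0.
  apply: le_lt_trans (all_lt i); apply/row_norm_leP => [|k]; first exact: th_ge0.
  by rewrite ger0_norm ?th_ge0 //; exact: Hi.
have Z_glue u k (p : {ffun option 'I_d -> nat}) : u \in C -> valid N p -> p (Some k) = 0%N -> Z (g k u) p = Z u p.
  move=> uC vp pk; have yk : y p ord0 k = 0 by rewrite mxE pk mulr0.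
  have e1 : a (g k u) (y p) = a u (y p) by apply: a_glue => //; apply: sub; exact: y_box.
  have e2 : f (g k u) (y p) = f u (y p).
    by apply: (interp_eq s0 M0 yk) => t tb tk; apply: a_glue => //; exact: sub.
  by rewrite /Z /gg e1 e2.
have Z_base u (p : {ffun option 'I_d -> nat}) : p None = 0%N -> Z u p = a u (y p).
  by move=> p0; rewrite /Z /sg p0 mul0r scale0r addr0.
have Z_lip u (p p' : {ffun option 'I_d -> nat}) : u \in C -> valid N p -> valid N p' ->
    (forall i, (p i <= (p' i).+1)%N /\ (p' i <= (p i).+1)%N) -> `|Z u p' - Z u p| < eps.
  move=> uC vp vp' pp.
  have near1 i : `|(p' i)%:R - (p i)%:R| <= 1 :> R.
    have [h1 h2] := pp i.
    have h1' : (p i)%:R <= (p' i)%:R + 1 :> R by rewrite natr1 ler_nat.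
    have h2' : (p' i)%:R <= (p i)%:R + 1 :> R by rewrite natr1 ler_nat.
    exact: dist_le1.
  have yy : `|y p' - y p| <= h.
    apply/(row_norm_leP _ (ltW h0)) => i; rewrite !mxE -mulrBr normrM (gtr0_norm h0).
    by rewrite ler_piMr ?(ltW h0).
  have da : `|a u (y p') - a u (y p)| < eps / 8.
    by apply: (Hdl1 u uC _ _ (y_box p vp) (y_box p' vp')); apply: le_lt_trans yy _; exact: N1.
  have df : `|f u (y p') - f u (y p)| <= eps / 4.
    apply: le_trans (fL _ _ _) _; apply: le_trans (ler_wpM2l L_ge0 yy) _.
    have N2' : 4 * (L * h) < eps by rewrite /h !mulrA.
    by rewrite ler_pdivlMr // mulrC ltW.
  have ds : `|sg p' - sg p| <= N%:R^-1.
    rewrite /sg -mulrBl normrM [ `|N%:R^-1|]ger0_norm ?invr_ge0 ?(ltW N0) //.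
    by rewrite ler_piMl ?invr_ge0 ?(ltW N0).
  have /andP[g0 g1] := sg01 p' vp'.
  have -> : Z u p' - Z u p = (a u (y p') - a u (y p)) + (sg p' *: ((f u (y p') - f u (y p)) - (a u (y p') - a u (y p)))
      + (sg p' - sg p) *: (gg u (y p) - a u (y p))).
    rewrite /Z /gg; move: (a u (y p')) (a u (y p)) (f u _) (f u _) => x1 x2 x3 x4.
    by apply/rowP => i; rewrite !mxE; ring.
  have m1 : `|sg p' *: ((f u (y p') - f u (y p)) - (a u (y p') - a u (y p)))| <= eps / 4 + eps / 8.
    rewrite normrZ ger0_norm //; apply: le_trans (ler_piMl _ g1) _ => //.
    by apply: le_trans (ler_normB _ _) _; apply: lerD => //; exact: ltW.
  have m2 : `|(sg p' - sg p) *: (gg u (y p) - a u (y p))| <= eps / 4.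
    rewrite normrZ; have h1 := gga u (y p) uC (y_box p vp).
    apply: le_trans (ler_wpM2r _ ds) _ => //.
    have h2 : N%:R^-1 * `|gg u (y p) - a u (y p)| <= N%:R^-1 * rho.
      by rewrite ler_pM2l ?invr_gt0 // (le_half2 h1).
    have h3 : 4 * (N%:R^-1 * rho) < eps by rewrite (_ : _ * _ = 4 * rho / N%:R) //; ring.
    by apply: le_trans h2 _; rewrite ler_pdivlMr // mulrC ltW.
  apply: le_lt_trans (ler_normD _ _) _; exact: sum_lt_eps eps0 da (le_trans (ler_normD _ _) (lerD m1 m2)).
(* [A] is the largest integer with [A%:R * h < eta]: the threshold [eta] in grid units. *)
have [A [A0 A1 A2]] : exists A : nat, [/\ (0 < A)%N, A%:R * h < eta & eta <= A.+1%:R * h].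
  have ex : exists k : nat, eta <= k.+1%:R * h.
    exists N; apply: (@le_trans _ _ (N%:R * h)); last by rewrite ler_pM2r // ler_nat.
    by rewrite /h mulrCA divff ?gt_eqF // mulr1 (le_trans eta_s) // ler_pdivrMr // ler_peMr ?ler1n // ltW.
  case: (ex_minnP ex) => A HA Amin.
  have N4' : 2 * h < eta by rewrite /h mulrA.
  have Apos : (0 < A)%N.
    by rewrite lt0n; apply: contraTneq HA => ->; rewrite -ltNge mul1r (le_lt_trans _ N4') // ler_peMl ?ler1n // ltW.
  exists A; split => //; rewrite ltNge; apply/negP; rewrite -(prednK Apos) => /Amin.
  by rewrite -ltnS prednK // ltnn.
have AN : (A < N)%N.
  rewrite -(ltr_nat R) -(ltr_pM2r h0); apply: lt_le_trans A1 _.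
  by rewrite [X in _ <= X]mulrCA divff ?gt_eqF // mulr1 (le_trans eta_s) // ler_pdivrMr // ler_peMr ?ler1n // ltW.
move=> j0; apply: (@sperner_exact d V g v0 N A gK lab (fun u p => nu (Z u p)) A0 AN _ _ _ _ _ j j0).
- by move=> u k p uC vp pk; rewrite /lab !Z_glue.
- move=> u p uC vp /existsP[i /eqP pi] pN; apply: far => //.
  have yi : y p ord0 i = 0 by rewrite mxE pi mulr0.
  have -> : Z u p = gg u (y p).
    by rewrite /Z /sg pN divff ?gt_eqF // scale1r addrC subrK.
  have -> : gg u (y p) - a0 = f u (y p) - q.
    by rewrite /gg; move: (f u (y p)) => x; apply/rowP => k; rewrite !mxE; ring.
  by apply: le_trans (Hq u _ i uC (y_box p vp) yi); rewrite ge_min lexx orbT.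
- move=> u p k uC vp fp pN; apply: far => //.
  have hN : h * N%:R = s by rewrite /h divfK // gt_eqF.
  have yk : s <= `|y p|.
    by apply: le_trans (row_coord_le _ k); rewrite mxE pN hN gtr0_norm.
  have h1 : 2 * c0 <= `|a u (y p) - a0|.
    have tb := sub _ _ (y_box p vp); have e1 := th_a uC tb.
    by apply: Hc0; rewrite e1.
  have /andP[g0 g1] := sg01 p vp.
  have h2 : `|sg p *: (gg u (y p) - a u (y p))| <= c0.
    rewrite normrZ ger0_norm //; apply: le_trans (ler_piMl _ g1) _ => //.
    exact: le_half2 (gga u (y p) uC (y_box p vp)) ec.
  apply: (@le_trans _ _ c0); first by rewrite ge_min lexx.
  have := ler_normB (Z u p - a0) (sg p *: (gg u (y p) - a u (y p))).
  have -> : Z u p - a0 - sg p *: (gg u (y p) - a u (y p)) = a u (y p) - a0.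
    by rewrite /Z; move: (gg u _) (a u _) => x z; apply/rowP => i; rewrite !mxE; ring.
  by move=> h3; apply: lower_third h3 h1 h2.
- move=> u p uC vp fp p0; rewrite Z_base //.
  have yb := sub _ _ (y_box p vp); split; last first.
    have -> : [set i | p (Some i) == 0%N]%SET = [set i | y p ord0 i == 0]%SET; last exact: nu_a.
    apply/setP => i; have yE : y p ord0 i = h * (p (Some i))%:R by rewrite mxE.
    by rewrite !inE yE mulf_eq0 (gt_eqF h0) pnatr_eq0.
  rewrite /lab Z_base // th_a // /base_label.
  have -> : [forall i, y p ord0 i < eta] = [forall i, (p (Some i) <= A)%N].
    apply: eq_forallb => i; rewrite mxE; apply/idP/idP => [|pA].
      apply: contraTT; rewrite -ltnNge -leNgt => pA; apply: le_trans A2 _.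
      by rewrite mulrC ler_pM2l // ler_nat.
    by apply: le_lt_trans A1; rewrite mulrC ler_pM2r // ler_nat.
  case: ifP => // _; apply: eq_first_max => i k; rewrite !mxE ler_pM2l // ler_nat //.
(* Each direction outside [T] is the label of some point of the cube, where that coordinate is at
   least [eta]; it is thus at least [eta / 2] at every other point of the cube, as coherence
   requires. *)
- move=> u p E T l uC /allP vl /allP cl colT x x' xl x'l.
  have [vx _] := andP (vl x xl); have [vx' _] := andP (vl x' x'l).
  have cube w1 w2 : w1 \in l -> w2 \in l -> forall i, (w1 i <= (w2 i).+1)%N /\ (w2 i <= (w1 i).+1)%N.
    by move=> /cl c1' /cl c2' i; split; [exact: in_cube_near c1' c2' i|exact: in_cube_near c2' c1' i].
  have := Heps (Z u x) (Z_in u x uC vx) (Z u x') (Z_lip u x x' uC vx vx' (cube _ _ xl x'l)).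
  case=> _; apply => i /colT/mapP[w wl /esym lw].
  have [vw _] := andP (vl w wl).
  have h1 := lab_some u w i lw uC vw.
  have [h2 _] := Heps (Z u x) (Z_in u x uC vx) (Z u w) (Z_lip u x w uC vx vw (cube _ _ xl wl)).
  have := le_trans (row_coord_le (th (Z u w) - th (Z u x)) i) (ltW h2).
  by rewrite !mxE => h3; exact: near_half h3 h1.
Qed.

End ChartExact.

(** * The complex of a coloured graph *)

Section Complex.
Variables (d n : nat) (G : colgraph d n).
Hypothesis GK : forall i, involutive (G i).
Local Notation row := 'rV[R]_d.+1.
Local Notation X := (XG G).
Local Notation gr := (fun (i : 'I_d.+1) (v : 'I_n) => G i v).
Local Notation std := (std_simplex d).

(** Serves only as the default value of [to_simplex] outside the simplex. *)
Definition barycentre : row := const_mx (d.+1%:R^-1).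

Lemma barycentre_std : std barycentre.
Proof.
split=> [j|]; first by rewrite mxE invr_ge0.
under eq_bigr do rewrite mxE.
by rewrite sumr_const card_ord -[_ *+ _]mulr_natl divff.
Qed.

Definition to_simplex (t : row) : set_type std :=
  insubd (exist _ barycentre (mem_set barycentre_std)) t.

Lemma to_simplexK t : std t -> set_val (to_simplex t) = t.
Proof. by move=> /mem_set st; rewrite /to_simplex /insubd insubT. Qed.

Definition zeros (t : row) : {set 'I_d.+1} := [set i | t ord0 i == 0]%SET.

Definition point_of v t : X := (\pi_(X) (((v : discrete_topology 'I_n), to_simplex t) : cells d n))%qT.
Definition coords (x : X) : row := set_val (repr x).2.
Definition cell_of (x : X) : 'I_n := (repr x).1.

Lemma glue_orb (u v : 'I_n) t : connect (glue_adj G t) u v = (v \in orb gr (zeros t) u).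
Proof.
rewrite inE; apply: eq_connect => {u v} u v; apply/existsP/existsP => -[i].
  move=> /andP[ti /orP[/eqP e|/eqP e]]; exists i; rewrite inE ti /=; apply/eqP => //.
  by rewrite -e GK.
by move=> /andP[]; rewrite inE => ti e; exists i; rewrite ti e.
Qed.

Lemma point_of_eq v w t s : std t -> std s ->
  (point_of v t = point_of w s) <-> (t = s /\ w \in orb gr (zeros t) v).
Proof.
move=> st ss; have -> : (point_of v t = point_of w s) <->
    glue G (v, to_simplex t) (w, to_simplex s).
  by split => [/eqmodP //|h]; apply/eqmodP.
rewrite /glue /= !to_simplexK // glue_orb.
by split => [/andP[/eqP <- ->]|[<- ->]]; rewrite ?eqxx.
Qed.

Lemma coords_std x : std (coords x).
Proof. exact: set_valP. Qed.

Lemma point_of_coords x : point_of (cell_of x) (coords x) = x.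
Proof.
rewrite -[RHS]reprK /point_of /cell_of /coords; congr (\pi_X _)%qT.
case: (repr x) => v t /=; congr pair; apply/val_inj; exact/to_simplexK/set_valP.
Qed.

Lemma coordsK v t : std t -> coords (point_of v t) = t.
Proof.
move=> st; have := point_of_coords (point_of v t).
by move=> /(point_of_eq _ _ (coords_std _) st)[].
Qed.

Lemma cell_ofK v t : std t -> cell_of (point_of v t) \in orb gr (zeros t) v.
Proof.
move=> st; have := esym (point_of_coords (point_of v t)).
by move=> /(point_of_eq _ _ st (coords_std _))[].
Qed.

Lemma coords_inj x y : coords x = coords y -> cell_of y \in orb gr (zeros (coords x)) (cell_of x) -> x = y.
Proof.
move=> e h; rewrite -(point_of_coords x) -(point_of_coords y).
by apply/(point_of_eq _ _ (coords_std _) (coords_std _)).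
Qed.

(** The quotient topology unfolded into an epsilon condition on every simplex, in which form
    openness is checked from here on. *)
Lemma open_XG (W : set X) : open W <-> (forall v t, std t -> W (point_of v t) ->
  exists2 e, 0 < e & forall t', std t' -> `|t' - t| < e -> W (point_of v t')).
Proof.
have piE (p : cells d n) : (\pi_(X) p)%qT = point_of p.1 (set_val p.2).
  case: p => v t; rewrite /point_of /=; congr (\pi_X _)%qT; congr pair.
  by apply/val_inj/esym; exact/to_simplexK/set_valP.
split=> [oW v t st Wt|H].
  have o : open ((\pi_(X))%qT @^-1` W : set (cells d n)) by exact: oW.
  have : nbhs ((v : discrete_topology 'I_n), to_simplex t) ((\pi_(X))%qT @^-1` W : set (cells d n)).
    by apply: open_nbhs_nbhs; split.
  move=> [[A B] /= [nA nB] AB].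
  have [C oC [Ct CB]] : exists2 C : set row, open C & C t /\ set_val @^-1` C `<=` B.
    move: nB; rewrite nbhsE /= => -[D [[C oC DC] Dt] DB]; exists C => //; split.
      by move: Dt; rewrite -DC /= to_simplexK.
    by rewrite DC.
  have /row_nbhsP[e e0 He] : nbhs t C by exact: open_nbhs_nbhs.
  exists e => // t' st' tt'; have := AB (v, to_simplex t'); apply; split => /=; first exact: nbhs_singleton.
  by apply: CB; rewrite /= to_simplexK //; exact: He.
suff : open ((\pi_(X))%qT @^-1` W : set (cells d n)) by [].
rewrite openE => -[v s] /= Ws; rewrite /interior.
have [e e0 He] := H v (set_val s) (set_valP s) ltac:(by rewrite piE in Ws).
exists ([set v], set_val @^-1` [set t' | `|t' - set_val s| < e]).
  split => /=; first by rewrite nbhs_principalE.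
  rewrite nbhsE /=; exists (set_val @^-1` (ball (set_val s : row) e)).
    split; last by rewrite /=; exact: ballxx.
    exists (ball (set_val s : row) e) => //; exact: ball_open.
  by move=> s' /=; rewrite -ball_normE /= distrC.
move=> [v' s'] /= [-> ss']; rewrite piE /=; apply: He => //; exact: set_valP.
Qed.

Lemma point_of_continuous v (W : set X) t : open W -> std t -> W (point_of v t) ->
  exists2 e, 0 < e & forall t', std t' -> `|t' - t| < e -> W (point_of v t').
Proof. by move=> /open_XG; apply. Qed.

Lemma coords_continuous (x : X) e : 0 < e -> nbhs x [set y | `|coords y - coords x| < e].
Proof.
move=> e0; apply: open_nbhs_nbhs; split; last by rewrite /= subrr normr0.
apply/open_XG => v t st /=; rewrite coordsK // => h.
exists (e - `|t - coords x|); first by rewrite subr_gt0.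
move=> t' st' tt'; rewrite /= coordsK // -(subrK t t') -addrA.
apply: le_lt_trans (ler_normD _ _) _; lra.
Qed.

(** Positive coordinates stay positive nearby, so a small move crosses only facets with colour in
    [T]. *)
Lemma open_star (T : {set 'I_d.+1}) v : open [set y : X |
  (forall i, i \notin T -> 0 < coords y ord0 i) /\ cell_of y \in orb gr T v].
Proof.
apply/open_XG => w t st /=; rewrite coordsK // => -[tT wT].
have [e e0 He] : exists2 e, 0 < e & forall i, i \notin T -> e <= t ord0 i.
  exists (\big[Num.min/1]_(i | i \notin T) t ord0 i).
    by apply/bigmin_gtP.
  by move=> i iT; apply: bigmin_le_cond.
have zT (t' : row) : (forall i, i \notin T -> 0 < t' ord0 i) -> zeros t' \subset T.
  move=> h; apply/fintype.subsetP => i; rewrite inE => /eqP ti.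
  by apply: contraT => /h; rewrite ti ltxx.
have wv : w \in orb gr T v.
  apply: orb_trans wT _; rewrite (orb_sym GK).
  by apply: (fintype.subsetP (orb_sub gr w (zT _ tT))); exact: cell_ofK.
exists e => // t' st' tt'; rewrite /= coordsK //.
have tT' i : i \notin T -> 0 < t' ord0 i.
  move=> iT; have := le_lt_trans (row_coord_le _ i) tt'; rewrite !mxE => h.
  by have := He i iT; have := ler_norm (t ord0 i - t' ord0 i); rewrite distrC => h1; lra.
split => //; apply: orb_trans wv _.
by apply: (fintype.subsetP (orb_sub gr w (zT _ tT'))); exact: cell_ofK.
Qed.

Lemma cell_of_star (x : X) (T : {set 'I_d.+1}) : (forall i, i \notin T -> 0 < coords x ord0 i) ->
  nbhs x [set y | cell_of y \in orb gr T (cell_of x)].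
Proof.
move=> h; apply: filterS (_ : nbhs x [set y : X | (forall i, i \notin T -> 0 < coords y ord0 i) /\ cell_of y \in orb gr T (cell_of x)]).
  by move=> y [].
by apply: open_nbhs_nbhs; split; [exact: open_star|split => //; exact: orb_refl].
Qed.

Lemma compact_simplex : compact (std : set row).
Proof.
have cl : closed (std : set row).
  have cc i : continuous (fun t : row => t ord0 i) by exact: coord_continuous.
  rewrite (_ : std = (\bigcap_i [set t : row | 0 <= t ord0 i]) `&` [set t : row | \sum_j t ord0 j = 1]).
    apply: closedI; first by apply: closed_bigI => i _; exact: (continuous_closedP _).1 (cc i) _ (@closed_ge _ 0).
    have cs : continuous (fun t : row => \sum_j t ord0 j).
      move=> t A /nbhs_ballP[e /= e0 eA]; apply/row_nbhsP.
      exists (e / d.+1%:R); first by rewrite divr_gt0.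
      move=> y yt; apply: eA; change (`|\sum_j t ord0 j - \sum_j y ord0 j| < e); rewrite distrC -sumrB; apply: le_lt_trans (ler_norm_sum _ _ _) _.
      apply: (@le_lt_trans _ _ (\sum_(i < d.+1) `|y - t|)).
        by apply: ler_sum => i _; apply: le_trans (row_coord_le _ i); rewrite !mxE.
      by rewrite sumr_const card_ord -[_ *+ _]mulr_natr -ltr_pdivlMr.
    exact: (continuous_closedP _).1 cs _ (@closed_eq _ 1).
  by apply/seteqP; split => t /= [h1 h2]; split => // i; [move=> _; exact: h1|exact: h1 i I].
apply: bounded_closed_compact => //.
exists 1; split; first exact: num_real.
move=> M M1 t [t0 t1]; apply/(row_norm_leP _ (ltW (lt_trans ltr01 M1))) => i.
rewrite ger0_norm //; apply: le_trans (ltW M1); rewrite -t1 (bigD1 i) //= lerDl; exact: sumr_ge0.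
Qed.

Lemma XG_compact : compact [set: X].
Proof.
have -> : [set: X] = \big[setU/set0]_(v : 'I_n) (point_of v @` std).
  rewrite -(bigcup_seq (index_enum _)).
  apply/seteqP; split => // x _; exists (cell_of x); first by rewrite /= mem_index_enum.
  by exists (coords x); [exact: coords_std|exact: point_of_coords].
apply: bigsetU_compact => v _; apply: continuous_compact; last exact: compact_simplex.
apply/subspace_continuousP => t st W; rewrite nbhsE /= => -[W' [oW' W't] W'W].
have [e e0 He] := point_of_continuous oW' st W't.
rewrite /= /within /=; apply/row_nbhsP; exists e => // t' tt' st'; exact/W'W/He.
Qed.

(** Points with different coordinates are separated by them; points with equal coordinates lie in
    the disjoint open stars of two different components. *)
Lemma XG_hausdorff : hausdorff_space X.
Proof.
rewrite open_hausdorff => x y xy.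
have [e|/eqP e] := eqVneq (coords x) (coords y).
  have nxy : cell_of y \notin orb gr (zeros (coords x)) (cell_of x).
    by apply: contraNN xy => /(coords_inj e) ->.
  pose S z := [set y : X | (forall i, i \notin zeros (coords x) -> 0 < coords y ord0 i) /\
    cell_of y \in orb gr (zeros (coords x)) (cell_of z)].
  have pos i : i \notin zeros (coords x) -> 0 < coords x ord0 i.
    by rewrite inE => h; rewrite lt_neqAle eq_sym h /=; have [] := coords_std x.
  exists (S x, S y); last first.
    split; [exact: open_star|exact: open_star|].
    apply/eqP/seteqP; split => // z [[_ h1] [_ h2]] /=; move/negP: nxy; apply.
    by apply: orb_trans h1 _; rewrite (orb_sym GK).
  split => /=; rewrite inE; split => //; try exact: orb_refl.
  by move=> i; rewrite -e; exact: pos.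
have r0 : 0 < `|coords x - coords y| by rewrite normr_gt0 subr_eq0; exact/eqP.
set r := `|_ - _| in r0; have r20 : 0 < r / 2 by rewrite divr_gt0.
pose S z := interior [set y : X | `|coords y - coords z| < r / 2].
exists (S x, S y).
  by split => /=; rewrite inE; apply: coords_continuous.
split; [exact: open_interior|exact: open_interior|].
apply/eqP/seteqP; split => // z [/interior_subset /= h1 /interior_subset /= h2].
suff : r < r by rewrite ltxx.
rewrite {1}/r -(subrK (coords z) (coords x)) -addrA; apply: le_lt_trans (ler_normD _ _) _.
rewrite distrC; lra.
Qed.

End Complex.

Lemma Posz_sum (I : finType) (P : pred I) (F : I -> nat) :
  (\sum_(i | P i) F i)%N%:Z = \sum_(i | P i) (F i)%:Z.
Proof. exact: (big_morph Posz PoszD). Qed.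

Lemma lt_near (x y z : R) : `|y - x| < `|x - z| -> (x < z) = (y < z).
Proof.
case: (ltP x z) => h1; case: (ltP y z) => h2 //.
  rewrite [X in _ < X]distrC [X in _ < X]gtr0_norm ?subr_gt0 // => h.
  by have := ler_norm (y - x); lra.
rewrite distrC [X in _ < X]ger0_norm ?subr_ge0 // => h.
by have := ler_norm (x - y); lra.
Qed.

(** * The reflected chart around the centre of a face *)

Section FaceChart.
Variables (d' n : nat).
Local Notation d := d'.+1.
Variables (G : colgraph d n) (S : {set 'I_d.+1}) (js : 'I_d.+1) (v0 : 'I_n).
Hypothesis GK : forall i, involutive (G i).
Hypothesis Gneq : forall i v, G i v != v.
Hypothesis jsS : js \notin S.
Local Notation row := 'rV[R]_d.+1.
Local Notation X := (XG G).
Local Notation gr := (fun (i : 'I_d.+1) (v : 'I_n) => G i v).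
Local Notation bits := {ffun 'I_d -> bool}.
Local Notation c := (lift js).

Definition face_weight : R := (#|~: S|%:R)^-1.
Local Notation w := face_weight.

Definition face_centre : row := \row_i (if i \in S then 0 else w).
Local Notation t0 := face_centre.

Lemma face_weight_gt0 : 0 < w.
Proof. by rewrite invr_gt0 ltr0n card_gt0; apply/set0Pn; exists js; rewrite inE. Qed.

Lemma face_centre_std : std_simplex d t0.
Proof.
split=> [i|]; first by rewrite mxE; case: ifP => // _; exact: ltW face_weight_gt0.
rewrite (bigID (mem S)) /= big1 ?add0r => [|i iS]; last by rewrite mxE iS.
rewrite (eq_bigr (fun=> w)) => [|i iS]; last by rewrite mxE (negbTE iS).
rewrite sumr_const -[_ *+ _]mulr_natl /face_weight (_ : #|_| = #|~: S|) ?divff //.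
  by have := face_weight_gt0; rewrite invr_gt0 => /gt_eqF ->.
by apply: eq_card => i; rewrite !inE.
Qed.

Lemma zeros_centre : zeros t0 = S.
Proof.
apply/setP => i; rewrite !inE mxE; case: ifP => _; first by rewrite eqxx.
by rewrite gt_eqF // face_weight_gt0.
Qed.

(** A colour outside [S] has a positive coordinate at the face centre, which may move both ways; the
    bit chooses the way. *)
Definition tilt (e : bits) (k : 'I_d) (x : R) : R := if (c k \notin S) && e k then - x else x.

(** The coordinate [js], outside [S], is the slack that keeps the sum equal to 1; the other colours
    are indexed by [lift js]. *)
Definition spread (e : bits) (t : 'rV[R]_d) : row :=
  \row_i (if unlift js i is Some k then t0 ord0 i + tilt e k (t ord0 k)
          else w - \sum_k tilt e k (t ord0 k)).

Lemma spreadE e t k : spread e t ord0 (c k) = t0 ord0 (c k) + tilt e k (t ord0 k).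
Proof. by rewrite mxE liftK. Qed.

Lemma spread_js e t : spread e t ord0 js = w - \sum_k tilt e k (t ord0 k).
Proof. by rewrite mxE unlift_none. Qed.

Lemma tilt_dist e k x y : `|tilt e k x - tilt e k y| = `|x - y|.
Proof. by rewrite /tilt; case: ifP => // _; rewrite -opprD normrN. Qed.

Lemma tilt_norm e k x : `|tilt e k x| = `|x|.
Proof. by rewrite /tilt; case: ifP => // _; rewrite normrN. Qed.

Lemma spread0 e : spread e 0 = t0.
Proof.
have t00 k : tilt e k ((0 : 'rV[R]_d) ord0 k) = 0 by rewrite mxE /tilt oppr0 if_same.
apply/rowP => i; rewrite [LHS]mxE; case: unliftP => [k ->|->]; first by rewrite t00 addr0.
by rewrite big1 => [|k _]; rewrite ?t00 // subr0 mxE (negbTE jsS).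
Qed.

Lemma spread_dist e t t' : `|spread e t' - spread e t| <= d%:R * `|t' - t|.
Proof.
apply/row_norm_leP => [|i]; first by rewrite mulr_ge0.
have h k : `|tilt e k (t' ord0 k) - tilt e k (t ord0 k)| <= `|t' - t|.
  by rewrite tilt_dist; apply: le_trans (row_coord_le _ k); rewrite !mxE.
have -> : (spread e t' - spread e t) ord0 i = spread e t' ord0 i - spread e t ord0 i by rewrite !mxE.
case: (unliftP js i) => [k ->|->].
  rewrite !spreadE opprD addrACA subrr add0r; apply: le_trans (h k) _.
  by rewrite ler_peMl // ler1n.
rewrite !spread_js opprB addrC addrA subrK -sumrB.
apply: le_trans (ler_norm_sum _ _ _) _.
apply: le_trans (_ : \sum_(k < d) `|t' - t| <= _); first by apply: ler_sum => k _; rewrite distrC.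
by rewrite sumr_const card_ord -[_ *+ _]mulr_natl.
Qed.

Lemma spread_std e t r : d.+1%:R * r <= w -> in_box r t -> std_simplex d (spread e t) /\
  (0 < r -> forall i, i \notin S -> 0 < spread e t ord0 i).
Proof.
move=> rw tb.
have tn k : `|tilt e k (t ord0 k)| <= r.
  by rewrite tilt_norm; have /andP[h0 h1] := tb k; rewrite ger0_norm.
have r0 : 0 <= r by have /andP[h0 h1] := tb ord0; exact: le_trans h0 h1.
have dr : d%:R * r + r <= w by rewrite -[X in _ + X]mul1r -mulrDl natr1.
have d1 : r <= d%:R * r by rewrite ler_peMl // ler1n.
have sn : `|\sum_k tilt e k (t ord0 k)| <= d%:R * r.
  apply: le_trans (ler_norm_sum _ _ _) _; apply: le_trans (_ : \sum_(k < d) r <= _).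
    exact: ler_sum.
  by rewrite sumr_const card_ord -[_ *+ _]mulr_natl.
have sn' := le_trans (ler_norm _) sn.
have pos i : i \notin S -> r <= spread e t ord0 i.
  case: (unliftP js i) => [k ->|->] iS; last by rewrite spread_js; lra.
  rewrite spreadE mxE (negbTE iS).
  have := ler_norm (- tilt e k (t ord0 k)); rewrite normrN; have := tn k; lra.
split; last by move=> rp i /pos; exact: lt_le_trans.
split=> [i|].
  have [iS|/pos] := boolP (i \in S); last exact: le_trans.
  case: (unliftP js i) iS => [k ->|->] iS; last by move: (jsS); rewrite iS.
  by rewrite spreadE mxE iS add0r /tilt iS /=; have /andP[] := tb k.
rewrite (bigD1_ord js) //= spread_js.
under eq_bigr do rewrite spreadE.
rewrite big_split /= [X in _ + X]addrC addrA subrK.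
have [_] := face_centre_std; rewrite (bigD1_ord js) //= => <-.
by rewrite mxE (negbTE jsS).
Qed.

Variables (UM : set X) (VM : set 'rV[R]_d) (f : X -> 'rV[R]_d) (g : 'rV[R]_d -> X).
Hypothesis openUM : open UM.
Hypothesis UMx : UM (point_of G v0 t0).
Hypothesis openVM : open VM.
Hypothesis f_cont : {within UM, continuous f}.
Hypothesis g_cont : {within VM, continuous g}.
Hypothesis fK : forall y, UM y -> VM (f y) /\ g (f y) = y.
Hypothesis gfK : forall z, VM z -> UM (g z) /\ f (g z) = z.

Let fc y : UM y -> {for y, continuous f}.
Proof. by move=> Uy; have := f_cont; rewrite continuous_open_subspace // => /(_ y); apply; rewrite inE. Qed.

Let gc z : VM z -> {for z, continuous g}.
Proof. by move=> Uy; have := g_cont; rewrite continuous_open_subspace // => /(_ z); apply; rewrite inE. Qed.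

Let star := [set y : X | (forall i, i \notin S -> 0 < coords y ord0 i) /\ cell_of y \in orb gr S v0].
Let U := [set z | VM z /\ star (g z)].
(** [th] forgets the signs of the displacements from the centre, which identifies the reflected
    orthants, and the bits of [nu] remember them. *)
Let th (z : 'rV[R]_d) : 'rV[R]_d := \row_k `|coords (g z) ord0 (c k) - t0 ord0 (c k)|.
Let nu (z : 'rV[R]_d) : 'I_n * bits :=
  (cell_of (g z), [ffun k => coords (g z) ord0 (c k) < t0 ord0 (c k)]).
Let a (v : 'I_n * bits) (t : 'rV[R]_d) := f (point_of G v.1 (spread v.2 t)).
Local Notation dbl := (@doubled _ _ d gr S c).
Let C := orb dbl [set: 'I_d]%SET (v0, zero_bits d).

Let openU : open U.
Proof.
rewrite openE => z [Vz sz]; rewrite /interior; apply: filterI; first exact: open_nbhs_nbhs.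
by apply: gc => //; apply: open_nbhs_nbhs; split; [exact: open_star|].
Qed.

Let CE v e : (v, e) \in C -> v \in orb gr S v0 /\ forall k, c k \in S -> e k = false.
Proof.
rewrite (@orb_doubled _ _ d gr S c (@lift_inj _ js)) => /andP[/= vS /forallP ek].
split; last by move=> k kS; have := ek k; rewrite kS orbT ffunE /= => /eqP.
apply: (fintype.subsetP (orb_sub gr v0 _)) vS.
by apply/fintype.subsetP => i; rewrite inE => /andP[].
Qed.

Let centreE v : v \in orb gr S v0 -> point_of G v t0 = point_of G v0 t0.
Proof.
move=> vS; apply/(point_of_eq GK _ _ face_centre_std face_centre_std); split=> //.
by rewrite zeros_centre (orb_sym GK).
Qed.

Let zeros_dirs (t : row) (T : {set 'I_d}) : (forall i, i \notin S -> t ord0 i != 0) ->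
  (forall k, c k \in S -> t ord0 (c k) = 0 -> k \in T) -> zeros t \subset @real_dirs _ d S c T.
Proof.
move=> pos HT; apply/fintype.subsetP => i; rewrite inE => ti.
have iS : i \in S by apply: contraTT ti; exact: pos.
case: (unliftP js i) iS ti => [k ->|->] iS ti; last by move: (jsS); rewrite iS.
by rewrite real_dirsE //; [apply: HT => //; exact/eqP|exact: lift_inj].
Qed.

(** The manifold chart [f] composed with the reflected orthants satisfies the hypotheses of
    [chart_exact], with the star of the face, seen through [g], as domain. *)
Lemma face_chart_exact j : (0 < j)%N -> exact_at dbl (v0, zero_bits d) j.
Proof.
have [e1 e10 He1] : exists2 e1, 0 < e1 & forall v, v \in orb gr S v0 ->
    forall t, std_simplex d t -> `|t - t0| < e1 -> UM (point_of G v t).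
  apply: (@fin_unif R _ (fun v e => v \in orb gr S v0 ->
    forall t, std_simplex d t -> `|t - t0| < e -> UM (point_of G v t))).
    by move=> v e e' _ le H vS t st tt; apply: H => //; exact: lt_le_trans le.
  move=> v; have [vS|vS] := boolP (v \in orb gr S v0); last by exists 1.
  have Uv : UM (point_of G v t0) by rewrite centreE.
  by have [e e0 He] := point_of_continuous openUM face_centre_std Uv; exists e.
(* Small enough for the spread box to stay in the simplex, with positive coordinates off [S], and
   within [e1] of the centre. *)
pose r := Num.min (w / d.+1%:R) (e1 / d.+1%:R).
have r0 : 0 < r by rewrite lt_min !divr_gt0 // face_weight_gt0.
have rw : d.+1%:R * r <= w.
  by rewrite mulrC -ler_pdivlMr // ge_min lexx.
have re : d%:R * r < e1.
  have : d.+1%:R * r <= e1 by rewrite mulrC -ler_pdivlMr // ge_min lexx orbT.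
  by rewrite -natr1 mulrDl mul1r; lra.
have Ua v e t : (v, e) \in C -> in_box r t -> UM (point_of G v (spread e t)).
  move=> /CE[vS _] tb; have [st _] := spread_std e rw tb; apply: He1 => //.
  rewrite -(spread0 e); apply: le_lt_trans (spread_dist _ _ _) _; apply: le_lt_trans re.
  rewrite ler_pM2l ?ltr0n // subr0; apply/(row_norm_leP _ (ltW r0)) => k.
  by have /andP[h0 h1] := tb k; rewrite ger0_norm.
have gaE v e t : (v, e) \in C -> in_box r t ->
    [/\ g (a (v, e) t) = point_of G v (spread e t), std_simplex d (spread e t) &
       forall i, i \notin S -> 0 < spread e t ord0 i].
  move=> vC tb; have [_ h] := fK (Ua v e t vC tb).
  by have [st /(_ r0) pos] := spread_std e rw tb.
have pos_neq (t : row) : (forall i, i \notin S -> 0 < t ord0 i) -> forall i, i \notin S -> t ord0 i != 0.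
  by move=> h i /h; rewrite lt0r => /andP[].
apply: (@chart_exact R d' _ dbl (v0, zero_bits d) (@doubledK _ _ d gr S c GK) r a U (f (point_of G v0 t0)) nu th) => //.
- move=> [v e] t vC tb; have [gE st pos] := gaE v e t vC tb; split.
    by have [] := fK (Ua v e t vC tb).
  rewrite gE; split=> [i iS|]; first by rewrite coordsK // pos.
  have [vS _] := CE vC; apply: orb_trans vS _.
  apply: (fintype.subsetP (orb_sub gr v _)) (cell_ofK GK v st).
  by apply/fintype.subsetP => i; rewrite inE; apply: contraTT; exact: pos_neq.
- move=> [v e] vC t tb x x0; have Uy := Ua v e t vC tb.
  have [_ st _] := gaE v e t vC tb.
  have : nbhs (point_of G v (spread e t)) (f @^-1` [set z | `|z - a (v, e) t| < x]).
    by apply: (fc Uy); apply/row_nbhsP; exists x.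
  rewrite nbhsE /= => -[W [oW Wt] WW].
  have [x1 x10 Hx1] := point_of_continuous oW st Wt.
  exists (x1 / d%:R) => [|t' tb' tt']; first by rewrite divr_gt0.
  have [_ st' _] := gaE v e t' vC tb'.
  apply: (WW (point_of G v (spread e t'))); apply: Hx1 => //.
  by apply: le_lt_trans (spread_dist _ _ _) _; rewrite mulrC -ltr_pdivlMr.
- move=> [v e] t k vC tb tk; rewrite /a /doubled /=; case: ifPn => kS /=.
    have [_ st _] := gaE v e t vC tb; congr f.
    apply/(point_of_eq GK _ _ st st); split=> //; rewrite (orb_sym GK).
    by apply: (orb_step gr); rewrite inE spreadE tk mxE kS /tilt oppr0 if_same addr0.
  congr (f (point_of G v _)).
  have tE k' : tilt (flip k e) k' (t ord0 k') = tilt e k' (t ord0 k').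
    rewrite /tilt ffunE; have [->|//] := eqVneq k' k.
    by rewrite tk oppr0 !if_same.
  apply/rowP => i; case: (unliftP js i) => [k' ->|->]; first by rewrite !spreadE tE.
  by rewrite !spread_js; congr (_ - _); apply: eq_bigr.
- move=> [v e] t vC tb; have [gE st _] := gaE v e t vC tb.
  apply/rowP => k; rewrite [LHS]mxE gE coordsK // spreadE addrC addKr tilt_norm ger0_norm //.
  by have /andP[] := tb k.
- move=> [v e] t vC tb; have [gE st pos] := gaE v e t vC tb; have [vS eS] := CE vC.
  rewrite (@orb_doubled _ _ d gr S c (@lift_inj _ js)); apply/andP; split=> /=.
    rewrite gE; apply: (fintype.subsetP (orb_sub gr v _)) (cell_ofK GK v st).
    apply: zeros_dirs => [|k kS]; first exact: pos_neq.
    by rewrite spreadE mxE kS add0r /tilt kS /= inE => ->.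
  apply/forallP => k; rewrite inE ffunE gE coordsK // spreadE; apply/implyP.
  rewrite -[X in _ < X]addr0 ltrD2l /tilt; have /andP[t_ge0 _] := tb k.
  have [kS|kS] /= := boolP (c k \in S); first by rewrite (eS k kS) ltNge t_ge0.
  rewrite orbF => tk; case: (e k); last by rewrite ltNge t_ge0.
  by rewrite oppr_lt0 lt0r tk t_ge0.
- by move=> z k _; rewrite mxE.
- move=> z [Vz [pos cS]] thz; have [_ <-] := gfK Vz; congr f.
  have ck k : coords (g z) ord0 (c k) = t0 ord0 (c k).
    by move/rowP/(_ k): thz; rewrite mxE [RHS]mxE => /eqP; rewrite normr_eq0 subr_eq0 => /eqP.
  have ct : coords (g z) = t0.
    apply/rowP => i; case: (unliftP js i) => [k ->|->] //.
    have [_ s1] := coords_std (g z); have [_ s0] := face_centre_std.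
    move: s1; rewrite -s0 (bigD1_ord js) // [RHS](bigD1_ord js) //=.
    by under eq_bigr do rewrite ck; move/addIr.
  rewrite -(centreE cS) -ct; exact/esym/point_of_coords.
- move=> z [Vz _] x x0.
  have : nbhs z (g @^-1` [set y | `|coords y - coords (g z)| < x / 2]).
    by apply: (gc Vz); apply: (coords_continuous GK); rewrite divr_gt0.
  move=> /row_nbhsP[x1 x10 Hx1]; exists x1 => // z' /Hx1 /= h.
  apply: (@le_lt_trans _ _ (x / 2)); last by lra.
  apply/row_norm_leP => [|k]; first by rewrite divr_ge0 // ltW.
  rewrite !mxE; apply: le_trans (ler_dist_dist _ _) _; rewrite opprB addrA subrK.
  by apply: le_trans (ltW h); apply: le_trans (row_coord_le _ (c k)); rewrite !mxE.
- move=> z T [Vz [pos cS]] thT.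
  pose eta := \big[Num.min/1]_(k | k \notin T) th z ord0 k.
  have eta0 : 0 < eta by apply/bigmin_gtP; split=> // k /thT.
  have n1 : nbhs z (g @^-1` [set y | `|coords y - coords (g z)| < eta]).
    by apply: (gc Vz); exact: (coords_continuous GK).
  have n2 : nbhs z (g @^-1` [set y | cell_of y \in orb gr (zeros (coords (g z))) (cell_of (g z))]).
    apply: (gc Vz); apply: (cell_of_star GK) => i; rewrite inE => h.
    by rewrite lt_neqAle eq_sym h /=; have [] := coords_std (g z).
  move/row_nbhsP: n1 => [x1 x10 Hx1]; move/row_nbhsP: n2 => [x2 x20 Hx2].
  exists (Num.min x1 x2) => [|z']; first by rewrite lt_min x10.
  rewrite lt_min => /andP[/Hx1 /= h1 /Hx2 /= h2].
  rewrite (@orb_doubled _ _ d gr S c (@lift_inj _ js)); apply/andP; split=> /=.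
    apply: (fintype.subsetP (orb_sub gr _ _)) h2; apply: zeros_dirs; first exact: pos_neq.
    move=> k kS ck; apply: contraT => /thT; rewrite mxE ck mxE kS subrr normr0 ltxx //.
  apply/forallP => k; rewrite !ffunE; apply/implyP.
  have [kS|kS] /= := boolP (c k \in S).
    have [p1 _] := coords_std (g z); have [p2 _] := coords_std (g z').
    by rewrite mxE kS !ltNge p1 p2.
  rewrite orbF => kT.
  (* A displacement of size at least [eta] cannot change sign under a move smaller than [eta], so
     this bit is constant near [z]. *)
  have hk : eta <= `|coords (g z) ord0 (c k) - t0 ord0 (c k)|.
    have <- : th z ord0 k = `|coords (g z) ord0 (c k) - t0 ord0 (c k)| by rewrite mxE.
    exact: (bigmin_le_cond _ (fun k => th z ord0 k) kT).
  have := le_lt_trans (row_coord_le _ (c k)) h1; rewrite [X in `|X|]mxE [X in _ + X]mxE => h3.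
  by rewrite (lt_near (lt_le_trans h3 hk)) mxE.
Qed.

Lemma face_chart_euler :
  \sum_(J : {set 'I_d.+1} | J \subset S) (-1) ^+ #|J| * (ncomp gr J (orb gr S v0))%:Z = 1.
Proof.
rewrite -(@euler_doubled _ _ d gr S c GK (@lift_inj _ js)); last first.
  move=> i iS; case: (unliftP js i) iS => [k ->|->] iS; first by exists k.
  by move: (jsS); rewrite iS.
have neq k v : dbl k v != v by apply: doubled_neq => i u; exact: Gneq.
exact: (euler_of_exact (@doubledK _ _ d gr S c GK) neq face_chart_exact).
Qed.

End FaceChart.

Lemma colourfulP d n (G : colgraph d n) : colourful G ->
  [/\ forall i, involutive (G i), forall i v, G i v != v,
      invols G & exists B, bipartition G B].
Proof.
move=> /andP[/forallP H /existsP[side /forallP sideP]].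
have GK i : involutive (G i) by move=> v; have /forallP/(_ v)/andP[/eqP] := H i.
split=> // [i v||]; first by have /forallP/(_ v)/andP[] := H i.
  by apply/forallP => i; apply/forallP => v; rewrite GK.
exists [set v | side v]%SET; apply/forallP => i; apply/forallP => v; rewrite !inE.
by have /forallP/(_ v) := sideP i; case: (side v); case: (side _).
Qed.

(** Each component for [S] is a face of the complex, and the chart at its centre gives 1. The bound
    on the size of [S] leaves a colour for the slack coordinate. *)
Theorem manifold_euler d' n (G : colgraph d'.+1 n) (S : {set 'I_d'.+2}) :
  colourful G -> is_manifold (XG G) d'.+1 -> (#|S| <= d'.+1)%N ->
  \sum_(J : {set 'I_d'.+2} | J \subset S) (-1) ^+ #|J| * (comp G J)%:Z = (comp G S)%:Z.
Proof.
move=> /colourfulP[GK Gneq _ _] [_ [_ charts]] Sd.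
have [js jsS] : exists js, js \notin S.
  apply/existsP; rewrite -negb_forall; apply: contraL Sd => /forallP h; rewrite -ltnNge.
  by rewrite (eq_card (B := 'I_d'.+2)) ?card_ord // => i; rewrite inE h.
rewrite /comp; under eq_bigr => J sJ do rewrite (ncomp_sum GK sJ) Posz_sum mulr_sumr.
rewrite exchange_big /= (ncomp_sum GK (subxx S)) Posz_sum; apply: eq_bigr => _ /imsetP[v0 _ ->].
rewrite (ncomp_self GK).
have [UM [VM [f [g [oU [Ux [oV [fc [gc [fK gK]]]]]]]]]] := charts (point_of G v0 (face_centre S)).
exact: (face_chart_euler GK Gneq jsS oU Ux oV fc gc fK gK).
Qed.

(** * Charts of doubled trees *)

Section RowMin.
Variables (R : realType) (d : nat) (P : pred 'I_d) (k0 : 'I_d).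
Hypothesis Pk0 : P k0.
Implicit Types t s : 'rV[R]_d.

Definition row_min t : R := \big[Num.min/t ord0 k0]_(k | P k) t ord0 k.

Lemma row_min_le t k : P k -> row_min t <= t ord0 k.
Proof. exact: bigmin_le_cond. Qed.

Lemma row_min_ex t : exists2 k, P k & row_min t = t ord0 k.
Proof.
rewrite /row_min; apply: (big_ind (fun x => exists2 k, P k & x = t ord0 k)).
- by exists k0.
- by move=> x y [k Pk ->] [l Pl ->]; rewrite /Num.min; case: ifP; [exists k|exists l].
by move=> k Pk; exists k.
Qed.

Lemma row_min_unique t x : (forall k, P k -> x <= t ord0 k) -> (exists2 k, P k & x = t ord0 k) ->
  row_min t = x.
Proof.
move=> H [k Pk e]; apply/le_anti; rewrite {1}e row_min_le //=.
by have [l Pl ->] := row_min_ex t; exact: H.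
Qed.

Lemma row_min_ge0 t : (forall i, 0 <= t ord0 i) -> 0 <= row_min t.
Proof. by move=> t0; have [k _ ->] := row_min_ex t. Qed.

Lemma row_min_lipschitz t s : `|row_min t - row_min s| <= `|t - s|.
Proof.
suff H (x y : 'rV[R]_d) : row_min x - row_min y <= `|x - y|.
  rewrite ler_norml H andbT lerNl opprB distrC; exact: H.
have [k Pk ->] := row_min_ex y; have := row_min_le x Pk.
have := row_coord_le (x - y) k; rewrite !mxE => h1 h2; have := ler_norm (x ord0 k - y ord0 k).
lra.
Qed.

End RowMin.

Section TreeChart.
Variables (R : realType) (d' : nat).
Local Notation d := d'.+2.
Variables (P : finType) (a : 'I_d -> P -> P).
Hypothesis aK : forall i, involutive (a i).
Implicit Types (U : {set P}) (p q : P) (e : bool) (s t : 'rV[R]_d) (i k : 'I_d).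

(** A neighbour outside [U] is replaced by the vertex itself, so that in the double the free facet
    is glued to its mirror image. *)
Definition restr U i p := if (p \in U) && (a i p \in U) then a i p else p.

Lemma restrK U i : involutive (restr U i).
Proof.
move=> p; rewrite /restr; case h: ((p \in U) && (a i p \in U)); last by rewrite h.
by case/andP: h => h1 h2; rewrite h2 aK h1.
Qed.

Definition mirror U i (x : P * bool) := (restr U i x.1, ~~ x.2).

Lemma mirrorK U i : involutive (mirror U i).
Proof. by move=> [p e]; rewrite /mirror /= restrK negbK. Qed.

Definition nonneg t := forall i, 0 <= t ord0 i.
Definition zero_set t : {set 'I_d} := [set i | t ord0 i == 0]%SET.

(** A homeomorphism of the glued orthants onto R^d, given on the pieces: Lipschitz, compatible with
    gluing, onto, injective up to gluing, and proper through a linear norm bound. *)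
Definition is_chart U (Phi : P * bool -> 'rV[R]_d -> 'rV[R]_d) :=
  [/\ exists2 L, 0 <= L & forall x s t, `|Phi x s - Phi x t| <= L * `|s - t|,
      forall x t i, x.1 \in U -> nonneg t -> t ord0 i = 0 -> Phi (mirror U i x) t = Phi x t,
      forall y, exists x t, [/\ x.1 \in U, nonneg t & Phi x t = y],
      forall x x' t t', x.1 \in U -> x'.1 \in U -> nonneg t -> nonneg t' ->
        Phi x t = Phi x' t' -> t = t' /\ x' \in orb (mirror U) (zero_set t) x
    & exists2 K, 0 <= K & forall x t, x.1 \in U -> nonneg t -> `|t| <= K * `|Phi x t|].

Definition tree_connected U := forall p q, p \in U -> q \in U -> q \in orb (restr U) [set: 'I_d]%SET p.

Definition low t := row_min predT ord0 t.

Lemma low_le t k : low t <= t ord0 k.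
Proof. exact: row_min_le. Qed.

Lemma low_ex t : exists k, low t = t ord0 k.
Proof. by have [k _ e] := @row_min_ex _ _ predT ord0 isT t; exists k. Qed.

Lemma low_ge0 t : nonneg t -> 0 <= low t.
Proof. exact: row_min_ge0. Qed.

(** One copy of the orthant stays in place. The other is pushed through the boundary along the
    diagonal, t - 2 min(t), which fixes the boundary and reverses the sign of the least coordinate,
    so it fills the complement. *)
Lemma chart1 p : exists Phi, is_chart [set p]%SET Phi.
Proof.
pose Phi (x : P * bool) t := if x.2 then t else \row_k (t ord0 k - 2 * low t).
have loD t x : low (\row_k (t ord0 k + x)) = low t + x.
  apply: row_min_unique => // [k _|]; first by rewrite mxE lerD2r row_min_le.
  by have [k _ e] := @row_min_ex _ _ predT ord0 isT t; exists k => //; rewrite mxE -e.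
have PhiF (x : P * bool) t : x.2 = false -> Phi x t = \row_k (t ord0 k - 2 * low t).
  by rewrite /Phi => ->.
have PhiT (x : P * bool) t : x.2 = true -> Phi x t = t by rewrite /Phi => ->.
have lowF x t : x.2 = false -> low (Phi x t) = - low t.
  by move=> /PhiF ->; rewrite loD; ring.
have mir i x : x.1 \in [set p]%SET -> mirror [set p]%SET i x = (x.1, ~~ x.2).
  rewrite /mirror /restr !inE => /eqP ->; rewrite eqxx /=.
  by case: eqP => [->|].
have ex0 t : low t = 0 -> exists2 k, k \in zero_set t & True.
  by move=> l0; have [k e] := low_ex t; exists k => //; rewrite inE -e l0.
exists Phi; split.
- exists 3 => // x s t; rewrite /Phi; case: x.2.
    by rewrite ler_peMl //; lra.
  apply/row_norm_leP => [|k]; first by rewrite mulr_ge0.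
  rewrite !mxE (_ : _ - _ - _ = (s - t) ord0 k - 2 * (low s - low t)); last by rewrite !mxE; ring.
  apply: le_trans (ler_normB _ _) _; rewrite normrM ger0_norm //.
  have := row_min_lipschitz (P := predT) (k0 := ord0) isT s t; have := row_coord_le (s - t) k.
  rewrite -/(low s) -/(low t); lra.
- move=> x t i xp nt ti; have l0 : low t = 0.
    by apply: row_min_unique => //; exists i.
  rewrite mir // /Phi /=; case: x.2 => /=; apply/rowP => k; by rewrite !mxE l0 mulr0 subr0.
- move=> y; have [l0|l0] := leP 0 (low y).
    exists (p, true), y; split; rewrite ?inE //.
    by move=> i; apply: le_trans l0 _; exact: row_min_le.
  exists (p, false), (\row_k (y ord0 k - 2 * low y)); split; rewrite ?inE //.
    move=> i; rewrite mxE; have := low_le y i; lra.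
  by rewrite PhiF // loD; apply/rowP => k; rewrite !mxE; ring.
- move=> [q e] [q' e'] t t' /=; rewrite [q \in _]inE [q' \in _]inE => /eqP -> /eqP -> nt nt'.
  have lt := low_ge0 nt; have lt' := low_ge0 nt'.
  have flip_orb u b : low u = 0 -> (p, ~~ b) \in orb (mirror [set p]%SET) (zero_set u) (p, b).
    move=> /ex0[k kz _]; have := orb_step (mirror [set p]%SET) (p, b) kz.
    by rewrite mir ?inE.
  case: e; case: e' => h.
  + by move: h; rewrite !PhiT // => ->; split=> //; exact: orb_refl.
  + have l0 : low t' = 0 /\ low t = 0.
      have := lowF (p, false) t' erefl; rewrite -h PhiT //;
      by move=> e; split; lra.
    have tt : t = t'.
      by move: h; rewrite PhiT // PhiF // => ->; apply/rowP => k; rewrite !mxE l0.1 mulr0 subr0.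
    by split=> //; exact: (flip_orb t true l0.2).
  + have l0 : low t' = 0 /\ low t = 0.
      have := lowF (p, false) t erefl; rewrite h PhiT //;
      by move=> e; split; lra.
    have tt : t = t'.
      by move: h; rewrite PhiF // PhiT // => <-; apply/rowP => k; rewrite !mxE l0.2 mulr0 subr0.
    by split=> //; exact: (flip_orb t false l0.2).
  + have ll : low t = low t'.
      by apply: oppr_inj; rewrite -(lowF (p, false) t erefl) h lowF.
    split; last exact: orb_refl.
    move: h; rewrite !PhiF // => /rowP h; apply/rowP => k; have := h k.
    by rewrite !mxE ll => /addIr.
- exists 3 => // -[q e] t _ nt; rewrite /Phi /=; case: e; first by rewrite ler_peMl //; lra.
  set y := \row_k _.
  have ly : low y = - low t by rewrite /y loD; ring.
  have lt := low_ge0 nt; have [k lk] := low_ex y.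
  have h1 := row_coord_le y k; rewrite -lk ly normrN ger0_norm // in h1.
  apply/row_norm_leP => [|i]; first by rewrite mulr_ge0.
  have h2 := row_coord_le y i; rewrite mxE in h2.
  have -> : t ord0 i = (t ord0 i - 2 * low t) + 2 * low t by ring.
  apply: le_trans (ler_normD _ _) _; rewrite [X in _ + X]ger0_norm ?mulr_ge0 //; lra.
Qed.

Section Collapse.
Variables (i0 : 'I_d).
(** The least coordinate in the directions other than [i0]; the dimension is at least 2, so there is
    one. *)
Definition rest t := row_min (fun k => k != i0) (lift i0 (ord0 : 'I_d'.+1)) t.
Let k0 : lift i0 (ord0 : 'I_d'.+1) != i0. Proof. by rewrite eq_sym neq_lift. Qed.

(* Two orthants glued along their [i0]-faces are mapped onto the near one; the
   other faces of the far one all land on the [i0]-face. *)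
Definition collapse_near t : 'rV[R]_d := \row_k (if k == i0 then t ord0 k + rest t else t ord0 k).
Definition collapse_far t : 'rV[R]_d := \row_k (if k == i0 then rest t else t ord0 k + t ord0 i0).

Lemma rest_le t k : k != i0 -> rest t <= t ord0 k.
Proof. exact: row_min_le. Qed.

Lemma rest_ex t : exists2 k, k != i0 & rest t = t ord0 k.
Proof. exact: (row_min_ex k0). Qed.

Lemma rest_ge0 t : nonneg t -> 0 <= rest t.
Proof. exact: row_min_ge0. Qed.

Lemma rest_eq0 t k : nonneg t -> k != i0 -> t ord0 k = 0 -> rest t = 0.
Proof. by move=> nt ki tk; apply/le_anti; rewrite rest_ge0 // -tk rest_le. Qed.

Lemma rest_near t : rest (collapse_near t) = rest t.
Proof.
apply: row_min_unique => // [k ki|]; first by rewrite mxE (negbTE ki) rest_le.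
by have [k ki e] := rest_ex t; exists k => //; rewrite mxE (negbTE ki).
Qed.

Lemma rest_far t : rest (collapse_far t) = rest t + t ord0 i0.
Proof.
apply: row_min_unique => // [k ki|]; first by rewrite mxE (negbTE ki) lerD2r rest_le.
by have [k ki e] := rest_ex t; exists k => //; rewrite mxE (negbTE ki) e.
Qed.

Lemma near_nonneg t : nonneg t -> nonneg (collapse_near t).
Proof. by move=> nt i; rewrite mxE; case: ifP => // _; rewrite addr_ge0 // rest_ge0. Qed.

Lemma far_nonneg t : nonneg t -> nonneg (collapse_far t).
Proof. by move=> nt i; rewrite mxE; case: ifP => _; rewrite ?addr_ge0 // rest_ge0. Qed.

Lemma near_id t k : nonneg t -> k != i0 -> t ord0 k = 0 -> collapse_near t = t.
Proof.
move=> nt ki tk; apply/rowP => i; rewrite mxE (rest_eq0 nt ki tk) addr0; by case: ifP.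
Qed.

Lemma near_far t : t ord0 i0 = 0 -> collapse_near t = collapse_far t.
Proof. by move=> ti; apply/rowP => k; rewrite !mxE ti; case: eqP => [->|_]; rewrite ?ti ?add0r ?addr0. Qed.

Lemma near_inj t t' : collapse_near t = collapse_near t' -> t = t'.
Proof.
move=> h; have rr : rest t = rest t' by rewrite -rest_near h rest_near.
move/rowP: h => h; apply/rowP => k; have := h k; rewrite !mxE rr; by case: ifP => // _ /addIr.
Qed.

Lemma far_inj t t' : collapse_far t = collapse_far t' -> t = t'.
Proof.
move=> h; have e1 : rest t = rest t' by move/rowP/(_ i0): h; rewrite !mxE eqxx.
have e2 : t ord0 i0 = t' ord0 i0.
  by have := rest_far t; rewrite h rest_far e1 => /addrI.
move/rowP: h => h; apply/rowP => k; have := h k; rewrite !mxE e2.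
by case: eqP => [->|_ /addIr].
Qed.

Lemma near_far_inj t t' : nonneg t -> nonneg t' -> collapse_far t = collapse_near t' ->
  t = t' /\ t ord0 i0 = 0.
Proof.
move=> nt nt' h; have e1 : rest t = t' ord0 i0 + rest t' by move/rowP/(_ i0): h; rewrite !mxE eqxx.
have e2 : rest t + t ord0 i0 = rest t' by rewrite -rest_far h rest_near.
have z1 := nt i0; have z2 := nt' i0.
have z3 : t ord0 i0 = 0 by lra.
by split=> //; apply: near_inj; rewrite near_far.
Qed.

Lemma far_zero t k : nonneg t -> collapse_far t ord0 k = 0 -> exists2 l, l != i0 & t ord0 l = 0.
Proof.
move=> nt; rewrite mxE; case: ifP => [_ r0|/negbT ki h].
  by have [l li e] := rest_ex t; exists l => //; rewrite -e.
by exists k => //; have := nt k; have := nt i0; lra.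
Qed.

Lemma collapse_lipschitz t s :
  `|collapse_near t - collapse_near s| <= 2 * `|t - s| /\
  `|collapse_far t - collapse_far s| <= 2 * `|t - s|.
Proof.
have h1 := @row_min_lipschitz _ _ (fun k => k != i0) _ k0 t s; rewrite -/(rest t) -/(rest s) in h1.
have h2 k : `|t ord0 k - s ord0 k| <= `|t - s|.
  by apply: le_trans (row_coord_le _ k); rewrite !mxE.
split; apply/row_norm_leP => [|k]; rewrite ?mulr_ge0 // !mxE; case: ifP => _.
- rewrite opprD addrACA; apply: le_trans (ler_normD _ _) _; have := h2 k; lra.
- have := h2 k; have := normr_ge0 (t - s); lra.
- have := normr_ge0 (t - s); lra.
- rewrite opprD addrACA; apply: le_trans (ler_normD _ _) _; have := h2 k; have := h2 i0; lra.
Qed.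

Lemma collapse_norm t : nonneg t ->
  `|t| <= `|collapse_near t| /\ `|t| <= `|collapse_far t|.
Proof.
move=> nt; have r0 := rest_ge0 nt; split; apply/row_norm_leP => // k; rewrite ger0_norm //.
  apply: le_trans (row_coord_le _ k); apply: le_trans (ler_norm _); rewrite mxE.
  by case: ifP => // _; rewrite lerDl.
have [->|ki] := eqVneq k i0.
  have [l li _] := rest_ex t; apply: le_trans (row_coord_le _ l); apply: le_trans (ler_norm _).
  by rewrite mxE (negbTE li) lerDr.
apply: le_trans (row_coord_le _ k); apply: le_trans (ler_norm _).
by rewrite mxE (negbTE ki) lerDl.
Qed.

(** The near image is the region where coordinate [i0] is at least [rest], the far image where it is
    at most [rest]; both maps are inverted explicitly. *)
Lemma collapse_onto s : nonneg s -> exists2 t, nonneg t & collapse_near t = s \/ collapse_far t = s.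
Proof.
move=> ns; have [h|h] := leP (rest s) (s ord0 i0).
  pose t : 'rV[R]_d := \row_k (if k == i0 then s ord0 k - rest s else s ord0 k).
  have rt : rest t = rest s.
    apply: row_min_unique => // [k ki|]; first by rewrite mxE (negbTE ki) rest_le.
    by have [k ki e] := rest_ex s; exists k => //; rewrite mxE (negbTE ki).
  exists t; first by move=> k; rewrite mxE; case: eqP => [->|]; rewrite ?subr_ge0.
  by left; apply/rowP => k; rewrite !mxE rt; case: (k == i0) => //; rewrite subrK.
pose x := rest s - s ord0 i0.
pose t : 'rV[R]_d := \row_k (if k == i0 then x else s ord0 k - x).
have ti : t ord0 i0 = x by rewrite mxE eqxx.
have rt : rest t = s ord0 i0.
  apply: row_min_unique => // [k ki|]; first by rewrite mxE (negbTE ki) /x; have := rest_le s ki; lra.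
  by have [k ki e] := rest_ex s; exists k => //; rewrite mxE (negbTE ki) -e /x; ring.
exists t; last first.
  by right; apply/rowP => k; rewrite mxE rt ti; case: eqP => [->|/eqP ki] //; rewrite mxE (negbTE ki) subrK.
move=> k; rewrite mxE; case: ifP => [_|/negbT ki]; first by rewrite /x; lra.
by have := rest_le s ki; have := ns i0; rewrite /x; lra.
Qed.


Section Leaf.
Variables (U : {set P}) (q p : P).
Hypothesis qU : q \notin U.
Hypothesis pU : p \in U.
Hypothesis apq : a i0 p = q.
Let U' := (q |: U)%SET.
Hypothesis leaf : forall i, i != i0 -> a i q \notin U' \/ a i q = q.

Let qU' : q \in U'. Proof. by rewrite setU11. Qed.
Let subU' r : r \in U -> r \in U'. Proof. by move=> rU; rewrite inE rU orbT. Qed.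
Let neq_q r : r \in U -> r != q. Proof. by apply: contraTneq => ->. Qed.

Let caseU' r : r \in U' -> r = q \/ r \in U.
Proof. by rewrite !inE => /orP[/eqP|]; [left|right]. Qed.

Lemma restr_in (W : {set P}) i r : r \in W -> restr W i r \in W.
Proof. by rewrite /restr; case: ifP => // /andP[]. Qed.

Lemma restr_p : restr U i0 p = p.
Proof. by rewrite /restr apq (negbTE qU) andbF. Qed.

Lemma restr'_p : restr U' i0 p = q.
Proof. by rewrite /restr apq qU' subU'. Qed.

Lemma restr'_q0 : restr U' i0 q = p.
Proof. by rewrite /restr qU' -apq aK subU'. Qed.

Lemma restr'_q i : i != i0 -> restr U' i q = q.
Proof. by move=> /leaf[h|h]; rewrite /restr qU' ?h ?if_same // (negbTE h). Qed.

Lemma restr'E i r : r \in U -> (r != p) || (i != i0) -> restr U' i r = restr U i r.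
Proof.
move=> rU h; rewrite /restr rU subU' //=.
have -> : (a i r \in U') = (a i r == q) || (a i r \in U) by rewrite !inE.
have [e|//] := eqVneq (a i r) q; rewrite orTb.
have rE : r = a i q by rewrite -e aK.
have [ii|ii] := eqVneq i i0; first by move: h; rewrite ii eqxx orbF rE ii -apq aK eqxx.
by case: (leaf ii); rewrite -rE => h1; [rewrite subU' in h1|rewrite h1 (negbTE qU) in rU].
Qed.

(** In [U] the facet [i0] of [p] is folded onto its mirror. In [U'] the same identification runs
    through the leaf: cross [i0] to [q], cross [k] to the mirror of [q], cross [i0] back. A second
    vanishing direction [k] is what makes this possible. *)
Lemma orb_leaf_good (Z : {set 'I_d}) x y : x.1 \in U -> (i0 \in Z -> exists2 k, k \in Z & k != i0) ->
  y \in orb (mirror U) Z x -> y \in orb (mirror U') Z x.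
Proof.
move=> xU good yo.
suff [] : y.1 \in U /\ y \in orb (mirror U') Z x by [].
apply: (@orb_ind _ _ (mirror U) Z x y (fun y => y.1 \in U /\ y \in orb (mirror U') Z x)) yo; last first.
  by split=> //; exact: orb_refl.
move=> i [r e] iZ [/= rU ro]; split; first exact: restr_in.
apply: orb_trans ro _; have [h|] := boolP ((r != p) || (i != i0)).
  by rewrite /mirror /= -restr'E //; have := orb_step (mirror U') (r, e) iZ.
rewrite negb_or !negbK => /andP[/eqP rp /eqP ii]; rewrite {}rp {}ii in iZ rU *.
have [k kZ ki] := good iZ.
have s1 : (q, ~~ e) \in orb (mirror U') Z (p, e).
  by have := orb_step (mirror U') (p, e) iZ; rewrite /mirror /= restr'_p.
have s2 : (q, e) \in orb (mirror U') Z (q, ~~ e).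
  by have := orb_step (mirror U') (q, ~~ e) kZ; rewrite /mirror /= restr'_q // negbK.
have s3 : (p, ~~ e) \in orb (mirror U') Z (q, e).
  by have := orb_step (mirror U') (q, e) iZ; rewrite /mirror /= restr'_q0.
have -> : mirror U i0 (p, e) = (p, ~~ e) by rewrite /mirror /= restr_p.
exact: orb_trans s1 (orb_trans s2 s3).
Qed.

(** With [i0] the only vanishing direction, [p] is never entered, since its partner in [U] is
    itself. *)
Lemma orb_leaf_away (Z : {set 'I_d}) x y : x.1 \in U -> x.1 != p -> (forall k, k \in Z -> k = i0) ->
  y \in orb (mirror U) Z x -> y.1 != p /\ y \in orb (mirror U') Z x.
Proof.
move=> xU xp HZ yo.
suff [_] : y.1 \in U /\ (y.1 != p /\ y \in orb (mirror U') Z x) by [].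
apply: (@orb_ind _ _ (mirror U) Z x y (fun y => y.1 \in U /\ (y.1 != p /\ y \in orb (mirror U') Z x))) yo; last first.
  by split=> //; split=> //; exact: orb_refl.
move=> i [r e] iZ [/= rU [rp ro]]; split; first exact: restr_in.
split; last first.
  apply: orb_trans ro _; rewrite /mirror /= -restr'E ?rp //.
  by have := orb_step (mirror U') (r, e) iZ.
by rewrite (HZ _ iZ); apply: contraNneq rp => e1; rewrite -(restrK U i0 r) e1 restr_p.
Qed.

Lemma orb_leaf_p (Z : {set 'I_d}) e y : (forall k, k \in Z -> k = i0) ->
  y \in orb (mirror U) Z (p, e) -> y.1 = p.
Proof.
move=> HZ; apply: (@orb_ind _ _ (mirror U) Z (p, e) y (fun y => y.1 = p)) => // i [r e'] iZ /= ->.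
by rewrite (HZ _ iZ) restr_p.
Qed.

Lemma orb_empty (Z : {set 'I_d}) x y : (forall k, k \notin Z) -> y \in orb (mirror U) Z x -> y = x.
Proof.
move=> HZ; apply: (@orb_ind _ _ (mirror U) Z x y (fun y => y = x)) => // i u iZ.
by have := HZ i; rewrite iZ.
Qed.

(** Across [i0] the orthant of [(q, e)] meets that of [(p, ~~ e)], so it is collapsed into the
    latter. *)
Definition leaf_node (x : P * bool) := if x.1 == q then (p, ~~ x.2) else x.
Definition leaf_coord (x : P * bool) t :=
  if x.1 == q then collapse_far t else if x.1 == p then collapse_near t else t.

Lemma leaf_coord_nonneg x t : nonneg t -> nonneg (leaf_coord x t).
Proof.
move=> nt; rewrite /leaf_coord; case: ifP => _; first exact: far_nonneg.
by case: ifP => _ //; exact: near_nonneg.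
Qed.

Lemma leaf_node_in x : x.1 \in U' -> (leaf_node x).1 \in U.
Proof. by rewrite /leaf_node !inE; case: eqP. Qed.

Lemma mirror_q0 e t : t ord0 i0 = 0 -> (p, ~~ e) \in orb (mirror U') (zero_set t) (q, e).
Proof.
move=> ti; have iZ : i0 \in zero_set t by rewrite inE ti.
by have := orb_step (mirror U') (q, e) iZ; rewrite /mirror /= restr'_q0.
Qed.

Lemma mirror_q l e t : l != i0 -> t ord0 l = 0 -> (q, ~~ e) \in orb (mirror U') (zero_set t) (q, e).
Proof.
move=> li tl; have lZ : l \in zero_set t by rewrite inE tl.
by have := orb_step (mirror U') (q, e) lZ; rewrite /mirror /= restr'_q.
Qed.

(** Injectivity is split by whether the points lie in the leaf. Here both do: a zero of the far
    image comes from a zero of [t] off [i0], and there [q] is glued to its mirror. *)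
Lemma leaf_inj_QQ e e' t t' : nonneg t -> nonneg t' ->
  leaf_coord (q, e) t = leaf_coord (q, e') t' ->
  leaf_node (q, e') \in orb (mirror U) (zero_set (leaf_coord (q, e) t)) (leaf_node (q, e)) ->
  t = t' /\ (q, e') \in orb (mirror U') (zero_set t) (q, e).
Proof.
move=> nt nt'; rewrite /leaf_coord /leaf_node /= eqxx => /far_inj tt; rewrite -{}tt => h; split=> //.
have [<-|ee] := eqVneq e e'; first exact: orb_refl.
have -> : e' = ~~ e by move: ee; case: (e); case: (e').
have [/existsP[k kZ]|/existsPn none] := boolP [exists k, k \in zero_set (collapse_far t)].
  by move: kZ; rewrite inE => /eqP/(far_zero nt)[l li tl]; exact: mirror_q li tl.
by case: (orb_empty none h) => /negb_inj ee'; rewrite ee' eqxx in ee.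
Qed.

Lemma leaf_inj_QU e x' t t' : x'.1 \in U -> nonneg t -> nonneg t' ->
  leaf_coord (q, e) t = leaf_coord x' t' ->
  leaf_node x' \in orb (mirror U) (zero_set (leaf_coord (q, e) t)) (leaf_node (q, e)) ->
  t = t' /\ x' \in orb (mirror U') (zero_set t) (q, e).
Proof.
move=> x'U nt nt'; rewrite /leaf_coord /leaf_node /= eqxx (negbTE (neq_q x'U)).
have [xp /(near_far_inj nt nt')[tt ti]|xp ts h] := eqVneq x'.1 p.
  rewrite -{}tt => h; split=> //; case: x' xp x'U h => r e' /= -> _ h.
  have [->|ee] := eqVneq e' (~~ e); first exact: mirror_q0.
  have ->: e' = e by move: ee; case: (e); case: (e').
  have [/existsP[k kZ]|/existsPn none] := boolP [exists k, k \in zero_set (collapse_far t)].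
    move: kZ; rewrite inE => /eqP/(far_zero nt)[l li tl].
    have h2 := mirror_q0 (~~ e) ti; rewrite negbK in h2; exact: orb_trans (mirror_q e li tl) h2.
  by case: (orb_empty none h) => ee'; rewrite ee' eqxx in ee.
have [/existsP[k /andP[kZ ki]]|/existsPn none] :=
    boolP [exists k, (k \in zero_set (collapse_far t)) && (k != i0)]; last first.
  have := @orb_leaf_p _ _ x' _ h => /(_ _)/eqP; rewrite (negbTE xp) => H.
  have HZ k : k \in zero_set (collapse_far t) -> k = i0.
    by move=> kZ; have := none k; rewrite kZ /= negbK => /eqP.
  by have := H HZ.
have /eqP : collapse_far t ord0 k == 0 by move: kZ; rewrite inE.
rewrite mxE (negbTE ki) => s0; have := nt k; have := nt i0 => z1 z2.
have tk : t ord0 k = 0 by lra.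
have ti : t ord0 i0 = 0 by lra.
have st : collapse_far t = t by rewrite -near_far // (near_id nt ki tk).
rewrite st in ts h *; split=> //; apply: orb_trans (mirror_q0 e ti) _.
by apply: orb_leaf_good h => // _; exists k => //; rewrite inE tk.
Qed.

Lemma leaf_inj_UU x x' t t' : x.1 \in U -> x'.1 \in U -> nonneg t -> nonneg t' ->
  leaf_coord x t = leaf_coord x' t' ->
  leaf_node x' \in orb (mirror U) (zero_set (leaf_coord x t)) (leaf_node x) ->
  t = t' /\ x' \in orb (mirror U') (zero_set t) x.
Proof.
move=> xU x'U nt nt'; rewrite /leaf_node (negbTE (neq_q xU)) (negbTE (neq_q x'U)).
move=> ts h.
have [/existsP[k /andP[kZ ki]]|/existsPn none] :=
    boolP [exists k, (k \in zero_set (leaf_coord x t)) && (k != i0)].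
  have coordE z u : z.1 \in U -> nonneg u -> leaf_coord z u ord0 k = 0 -> leaf_coord z u = u.
    move=> zU nu; rewrite /leaf_coord (negbTE (neq_q zU)); case: ifP => // _.
    by rewrite mxE (negbTE ki); exact: near_id.
  have zk : leaf_coord x t ord0 k = 0 by move: kZ; rewrite inE => /eqP.
  have e1 := coordE x t xU nt zk; rewrite ts in zk; have e2 := coordE x' t' x'U nt' zk.
  rewrite e1 in ts h kZ; rewrite e2 in ts; split=> //.
  by apply: orb_leaf_good h => // _; exists k.
have HZ k : k \in zero_set (leaf_coord x t) -> k = i0.
  by move=> kZ; have := none k; rewrite kZ /= negbK => /eqP.
have [xp|xp] := eqVneq x.1 p; last first.
  have [x'p h'] := orb_leaf_away xU xp HZ h.
  have e1 z u : z.1 \in U -> z.1 != p -> leaf_coord z u = u.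
    by move=> zU zp; rewrite /leaf_coord (negbTE (neq_q zU)) (negbTE zp).
  by rewrite !e1 // in ts h'; split.
have x'p : x'.1 = p.
  have h2 : x' \in orb (mirror U) (zero_set (leaf_coord x t)) (p, x.2) by rewrite -xp -surjective_pairing.
  exact: orb_leaf_p HZ h2.
have cE z u : z.1 = p -> leaf_coord z u = collapse_near u.
  by move=> zp; rewrite /leaf_coord zp (negbTE (neq_q pU)) eqxx.
rewrite !cE // in ts h HZ none; move/near_inj: ts => tt; split=> //.
rewrite (orb_empty _ h); first exact: orb_refl.
move=> k; apply/negP => kZ; have ki := HZ k kZ; move: kZ; rewrite ki inE mxE eqxx => /eqP z0.
have r0 := rest_ge0 nt; have ti := nt i0; have rz : rest t = 0 by lra.
have [l li le] := rest_ex t; have := none l; rewrite li andbT inE mxE (negbTE li) -le rz eqxx //.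
Qed.

Lemma chart_leaf Phi : is_chart U Phi -> is_chart U' (fun x t => Phi (leaf_node x) (leaf_coord x t)).
Proof.
case=> [[L L0 HL] glue surj inj [K K0 HK]].
split.
- exists (L * 2) => [|x s t]; first by rewrite mulr_ge0.
  apply: le_trans (HL _ _ _) _; rewrite -mulrA ler_wpM2l //.
  have [h1 h2] := collapse_lipschitz s t.
  rewrite /leaf_coord; case: ifP => _ //; case: ifP => _ //.
  by have := normr_ge0 (s - t); lra.
- move=> [r e] t i /= /caseU' rU nt ti.
  have nearE k : k != i0 -> t ord0 k = 0 -> collapse_near t = t by exact: near_id.
  rewrite /mirror /=; case: rU => [->|rU].
    have [ii|ii] := eqVneq i i0.
      rewrite ii restr'_q0 /leaf_node /leaf_coord /= eqxx (negbTE (neq_q pU)) eqxx.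
      by rewrite near_far // -ii.
    (* The face [i] of [q] lands on the [i0]-face of [p], which in [U] is folded onto its mirror. *)
    rewrite restr'_q // /leaf_node /leaf_coord /= eqxx.
    have := glue (p, ~~ e) (collapse_far t) i0 pU (far_nonneg nt).
    by rewrite mxE eqxx (rest_eq0 nt ii ti) /mirror /= restr_p; apply.
  have [rp|rp] := boolP ((r != p) || (i != i0)) => //; last first.
    move: rp; rewrite negb_or !negbK => /andP[/eqP -> /eqP ii].
    rewrite ii restr'_p /leaf_node /leaf_coord /= eqxx (negbTE (neq_q pU)) eqxx negbK.
    by rewrite near_far // -ii.
  rewrite restr'E //; set r' := restr U i r; have r'U : r' \in U by exact: restr_in.
  rewrite /leaf_node /leaf_coord /= (negbTE (neq_q rU)) (negbTE (neq_q r'U)).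
  have idp z : z \in U -> (z = p -> i != i0) -> (if z == p then collapse_near t else t) = t.
    by move=> zU h; case: eqP => // /h /nearE; apply.
  rewrite !idp //; first exact: (glue (r, e)).
  + by move=> e1; move: rp; rewrite e1 eqxx.
  + move=> e1; apply: contraTneq rp => ii; rewrite ii eqxx orbF negbK.
    by rewrite -(restrK U i r) -/r' e1 ii restr_p.
- move=> y; have [[r e] [s [rU ns <-]]] := surj y.
  have [rp|rp] := eqVneq r p; last first.
    exists (r, e), s; split=> //; first exact: subU'.
    by rewrite /leaf_node /leaf_coord /= (negbTE (neq_q rU)) (negbTE rp).
  have [t nt [<-|<-]] := collapse_onto ns.
    exists (r, e), t; split=> //; first exact: subU'.
    by rewrite /leaf_node /leaf_coord /= (negbTE (neq_q rU)) rp eqxx.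
  exists (q, ~~ e), t; split=> //=.
  by rewrite /leaf_node /leaf_coord /= eqxx negbK rp.
- move=> x x' t t' xU x'U nt nt' h.
  have [ts ho] := inj _ _ _ _ (leaf_node_in xU) (leaf_node_in x'U)
    (leaf_coord_nonneg x nt) (leaf_coord_nonneg x' nt') h.
  case: (caseU' xU) => xq; case: (caseU' x'U) => x'q.
  + case: x x' xq x'q ts ho {h xU x'U} => [r e] [r' e'] /= -> ->; exact: leaf_inj_QQ.
  + by case: x xq ts ho {h xU} => [r e] /= ->; exact: leaf_inj_QU.
  + have ho' : leaf_node x \in orb (mirror U) (zero_set (leaf_coord x' t')) (leaf_node x').
      by rewrite -ts (orb_sym (mirrorK U)).
    case: x' x'q ts ho' {h x'U ho} => [r e] /= -> ts ho'.
    have [tt oo] := leaf_inj_QU xq nt' nt (esym ts) ho'.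
    by split=> //; rewrite (orb_sym (mirrorK U')) -tt.
  + exact: leaf_inj_UU.
- exists K => // x t xU nt; have [h1 h2] := collapse_norm nt.
  apply: le_trans (HK _ _ (leaf_node_in xU) (leaf_coord_nonneg x nt)).
  by rewrite /leaf_coord; case: ifP => _ //; case: ifP.
Qed.

(** The retraction sending [q] to [p] carries paths of [U'] to paths of [U]. *)
Lemma leaf_connected : tree_connected U' -> tree_connected U.
Proof.
move=> conn x y xU yU; have := conn x y (subU' xU) (subU' yU).
pose rho w := if w == q then p else w.
suff H w : w \in orb (restr U') [set: 'I_d]%SET x ->
    w \in U' /\ rho w \in orb (restr U) [set: 'I_d]%SET x.
  by move=> /H[_]; rewrite /rho (negbTE (neq_q yU)).
apply: (@orb_ind _ _ (restr U') _ x w (fun w => w \in U' /\ rho w \in orb (restr U) [set: 'I_d]%SET x)); last first.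
  by split; [exact: subU'|rewrite /rho (negbTE (neq_q xU)); exact: orb_refl].
move=> i u _ [uU' uo]; split; first exact: restr_in.
case: (caseU' uU') uo => [->|uU].
  rewrite {1}/rho eqxx => po; have [ii|ii] := eqVneq i i0.
    by rewrite ii restr'_q0 /rho (negbTE (neq_q pU)).
  by rewrite restr'_q // /rho eqxx.
rewrite {1}/rho (negbTE (neq_q uU)) => uo; have [h|] := boolP ((u != p) || (i != i0)).
  rewrite restr'E // /rho (negbTE (neq_q (restr_in i uU))).
  by apply: orb_trans uo _; apply: orb_step; rewrite inE.
by rewrite negb_or !negbK => /andP[/eqP up /eqP ->]; rewrite up restr'_p /rho eqxx -up.
Qed.

End Leaf.

End Collapse.

Hypothesis degenerate : forall W : {set P}, W != finset.set0 -> exists q i0, q \in W /\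
  forall i, i != i0 -> a i q \notin W \/ a i q = q.

(** A node with at most one neighbour inside is removed. Connectedness makes that neighbour exist,
    and the rest stays connected, so the induction applies and [chart_leaf] restores the node. *)
Lemma tree_chart U : U != finset.set0 -> tree_connected U -> exists Phi, is_chart U Phi.
Proof.
have [m] := ubnP #|U|; elim: m U => // m IH U Um U0 conn.
have [q [i0 [qU leaf]]] := degenerate U0.
have [->|Uq] := eqVneq U [set q]%SET; first exact: chart1.
have [r rU rq] : exists2 r, r \in U & r != q.
  apply/exists_inP; apply: contraNT Uq => /exists_inPn H.
  by apply/eqP/setP => w; rewrite inE; apply/idP/eqP => [/H/negPn/eqP|->].
have [p0U pq] : a i0 q \in U /\ a i0 q != q.
  have h : restr U i0 q != q.
    apply: contraNneq rq => e0; apply/eqP.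
    apply: (@orb_ind _ _ (restr U) [set: 'I_d]%SET q r (fun w => w = q)) (conn q r qU rU) => // i u _ ->.
    have [->|/leaf[h|h]] := eqVneq i i0 => //; rewrite /restr qU /= ?h ?if_same //.
    by rewrite (negbTE h).
  by move: h; rewrite /restr qU /=; case: ifP => //; rewrite eqxx.
set p := a i0 q in p0U pq.
have apq : a i0 p = q by rewrite /p aK.
have UE : (q |: (U :\ q))%SET = U by exact: finset.setD1K.
have qW : q \notin (U :\ q)%SET by rewrite !inE eqxx.
have pW : p \in (U :\ q)%SET by rewrite !inE pq.
have leaf' i : i != i0 -> a i q \notin (q |: (U :\ q))%SET \/ a i q = q by rewrite UE; exact: leaf.
have [|||Phi HPhi] := IH (U :\ q)%SET.
- by move: Um; rewrite (cardsD1 q) qU.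
- by apply/finset.set0Pn; exists p.
- by apply: (leaf_connected qW pW apq leaf'); rewrite UE.
by have := chart_leaf qW pW apq leaf' HPhi; rewrite UE; eexists; exact: H.
Qed.

End TreeChart.

(** * From orthant charts to charts of vertex stars *)

Section Projective.
Variables (d' : nat).
Local Notation d := d'.+2.
Variable (j : 'I_d.+1).
Local Notation row := 'rV[R]_d.+1.
Local Notation std := (std_simplex d).

(** Projective coordinates stretch the part of the simplex with positive coordinate [j] onto a whole
    orthant, so a chart onto R^d covers the open star of vertex [j]. *)
Definition ratio (t : row) : 'rV[R]_d := \row_k (t ord0 (lift j k) / t ord0 j).

Definition unratio (s : 'rV[R]_d) : row :=
  \row_i ((if unlift j i is Some k then s ord0 k else 1) / (1 + \sum_k s ord0 k)).

Lemma unratio_j s : unratio s ord0 j = (1 + \sum_k s ord0 k)^-1.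
Proof. by rewrite mxE unlift_none mul1r. Qed.

Lemma unratio_lift s k : unratio s ord0 (lift j k) = s ord0 k / (1 + \sum_k s ord0 k).
Proof. by rewrite mxE liftK. Qed.

Lemma ratio_nonneg t : std t -> nonneg (ratio t).
Proof. by move=> [t0 _] k; rewrite mxE divr_ge0. Qed.

Section Nonneg.
Variable s : 'rV[R]_d.
Hypothesis s0 : nonneg s.

Let S0 : 0 < 1 + \sum_k s ord0 k.
Proof. by apply: ltr_wpDr; rewrite ?ltr01 // sumr_ge0. Qed.

Lemma unratio_std : std (unratio s) /\ 0 < unratio s ord0 j.
Proof.
split; last by rewrite unratio_j invr_gt0.
split=> [i|]; first by rewrite mxE divr_ge0 ?(ltW S0) //; case: unlift.
rewrite (bigD1_ord j) //= unratio_j; under eq_bigr do rewrite unratio_lift.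
by rewrite -mulr_suml -[X in X + _]mul1r -mulrDl divff // gt_eqF.
Qed.

Lemma unratioK : ratio (unratio s) = s.
Proof.
apply/rowP => k; rewrite mxE unratio_lift unratio_j invrK divfK // gt_eqF //.
Qed.

(** Bounded orthant coordinates keep coordinate [j] away from 0; the compactness argument for the
    inverse chart rests on this. *)
Lemma unratio_j_bound M : `|s| <= M -> (1 + d%:R * M)^-1 <= unratio s ord0 j.
Proof.
move=> sM; have M0 : 0 <= M by apply: le_trans sM.
rewrite unratio_j lef_pV2 ?posrE //; last by apply: ltr_wpDr; rewrite ?ltr01 // mulr_ge0.
rewrite lerD2l; apply: le_trans (_ : \sum_(k < d) M <= _).
  by apply: ler_sum => k _; apply: le_trans sM; apply: le_trans (ler_norm _) (row_coord_le _ _).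
by rewrite sumr_const card_ord -[_ *+ _]mulr_natl.
Qed.

Lemma unratio_zero k : (lift j k \in zeros (unratio s)) = (k \in zero_set s).
Proof. by rewrite !inE unratio_lift mulf_eq0 invr_eq0 [X in _ || X]gt_eqF // orbF. Qed.

End Nonneg.

Lemma ratioK (t : row) : std t -> 0 < t ord0 j -> unratio (ratio t) = t.
Proof.
move=> [t0 t1] tj; have e : 1 + \sum_k ratio t ord0 k = (t ord0 j)^-1.
  under eq_bigr do rewrite mxE.
  rewrite -mulr_suml -[1](@divff _ (t ord0 j)) ?gt_eqF // -mulrDl.
  by rewrite -(@bigD1_ord _ _ _ d.+1 j xpredT (fun i => t ord0 i)) // t1 mul1r.
apply/rowP => i; rewrite [LHS]mxE e invrK.
by case: unliftP => [k ->|->]; rewrite ?mxE ?mul1r // divfK // gt_eqF.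
Qed.

Lemma ratio_zero (t : row) k : 0 < t ord0 j -> (k \in zero_set (ratio t)) = (lift j k \in zeros t).
Proof. by move=> tj; rewrite !inE mxE mulf_eq0 invr_eq0 [X in _ || X]gt_eqF // orbF. Qed.

Lemma ratio_continuous (t : row) (e : R) : std t -> 0 < t ord0 j -> 0 < e ->
  exists2 e', 0 < e' & forall t', std t' -> `|t' - t| < e' ->
    0 < t' ord0 j /\ `|ratio t' - ratio t| < e.
Proof.
move=> [t0 t1] tj e0; set x := t ord0 j in tj *.
have le1 i : t ord0 i <= 1 by rewrite -t1 (bigD1 i) //= lerDl sumr_ge0.
(* The first bound keeps the new denominator above [x / 2], the second controls the difference of
   the quotients. *)
pose e' := Num.min (x / 2) (x * x * e / 8).
have e'0 : 0 < e' by rewrite lt_min !divr_gt0 ?mulr_gt0.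
have ex : e' <= x / 2 by rewrite ge_min lexx.
have ee : e' <= x * x * e / 8 by rewrite ge_min lexx orbT.
exists e' => // t' _ tt.
have co i : `|t' ord0 i - t ord0 i| < e'.
  by apply: le_lt_trans tt; apply: le_trans (row_coord_le _ i); rewrite !mxE.
have tj' : x / 2 < t' ord0 j.
  by have := co j; rewrite ltr_norml -/x => /andP[h _]; lra.
have tj'0 : 0 < t' ord0 j by lra.
split=> //; apply: (@le_lt_trans _ _ (e / 2)); last by lra.
apply/row_norm_leP => [|k]; first by rewrite divr_ge0 // ltW.
rewrite !mxE -/x; set i := lift j k; set y := t' ord0 j in tj' tj'0 *.
have -> : t' ord0 i / y - t ord0 i / x =
    ((t' ord0 i - t ord0 i) * x - t ord0 i * (y - x)) / (x * y).
  by field; rewrite !gt_eqF.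
rewrite normrM normfV (gtr0_norm (mulr_gt0 tj tj'0)) ler_pdivrMr ?mulr_gt0 //.
have h1 : `|(t' ord0 i - t ord0 i) * x| <= e'.
  rewrite normrM (gtr0_norm tj); apply: le_trans (ltW (co i)); rewrite ler_piMr // le1 //.
have h2 : `|t ord0 i * (y - x)| <= e'.
  by rewrite normrM ger0_norm //; apply: le_trans (ltW (co j)); rewrite ler_piMl // le1.
apply: le_trans (ler_normB _ _) _; apply: le_trans (lerD h1 h2) _.
have h3 : x * x * e / 2 <= x * y * e.
  rewrite [X in X <= _](_ : _ = (x * e) * (x / 2)); last by field.
  by rewrite [X in _ <= X](_ : _ = (x * e) * y); [rewrite ler_pM2l ?mulr_gt0 // ltW|ring].
rewrite (_ : e / 2 * (x * y) = x * y * e / 2); last by field.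
lra.
Qed.

End Projective.

Section DoubleManifold.
Variables (d' n : nat).
Local Notation d := d'.+2.
Variables (P : finType) (a : 'I_d.+1 -> P -> P) (G : colgraph d n).
Variables (b : 'I_n -> P * bool) (b' : P * bool -> 'I_n).
Hypothesis aK : forall i, involutive (a i).
Hypothesis bK : cancel b b'.
Hypothesis b'K : cancel b' b.
Hypothesis Gb : forall i v, b (G i v) = (a i (b v).1, ~~ (b v).2).
Local Notation X := (XG G).
Local Notation row := 'rV[R]_d.+1.
Local Notation gr := (fun (i : 'I_d.+1) (v : 'I_n) => G i v).

Lemma double_involutive i : involutive (G i).
Proof. by move=> v; apply: (can_inj bK); rewrite !Gb /= aK negbK -surjective_pairing. Qed.
Let GK := double_involutive.

Section Star.
Variables (j : 'I_d.+1) (U : {set P}) (Phi : P * bool -> 'rV[R]_d -> 'rV[R]_d).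
Local Notation aj := (fun (k : 'I_d) p => a (lift j k) p).
Hypothesis U_closed : forall k p, p \in U -> aj k p \in U.
Hypothesis chartPhi : is_chart aj U Phi.

Let mirE k x : x.1 \in U -> mirror aj U k x = b (G (lift j k) (b' x)).
Proof. by move=> xU; rewrite Gb b'K /mirror /restr xU U_closed. Qed.

Lemma star_orb (T : {set 'I_d.+1}) v w : j \notin T -> w \in orb gr T v ->
  (b v).1 \in U -> (b w).1 \in U.
Proof.
move=> jT wv vU; apply: (@orb_ind _ _ gr T v w (fun w => (b w).1 \in U)) wv => // i u iT uU.
rewrite Gb /=; case: (unliftP j i) iT => [k -> _|->]; first exact: U_closed.
by rewrite (negbTE jT).
Qed.

Let star := [set y : X | 0 < coords y ord0 j /\ (b (cell_of y)).1 \in U].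
Let f (y : X) := Phi (b (cell_of y)) (ratio j (coords y)).

Let jzero (t : row) : 0 < t ord0 j -> j \notin zeros t.
Proof. by move=> tj; rewrite inE gt_eqF. Qed.

Let cell_in v (t : row) : std_simplex d t -> 0 < t ord0 j ->
  ((b (cell_of (point_of G v t))).1 \in U) = ((b v).1 \in U).
Proof.
move=> st tj; have h := cell_ofK GK v st.
apply/idP/idP; last exact: star_orb (jzero tj) h.
by apply: star_orb (jzero tj) _; rewrite (orb_sym GK).
Qed.

(** [f] is defined through the cell chosen by [repr]; the gluing property of [Phi] makes the choice
    irrelevant. *)
Let f_point v (t : row) : std_simplex d t -> 0 < t ord0 j -> (b v).1 \in U ->
  f (point_of G v t) = Phi (b v) (ratio j t).
Proof.
move=> st tj vU; rewrite /f coordsK //; have [_ glue _ _ _] := chartPhi.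
suff [] : (b (cell_of (point_of G v t))).1 \in U /\
  Phi (b (cell_of (point_of G v t))) (ratio j t) = Phi (b v) (ratio j t) by [].
apply: (@orb_ind _ _ gr (zeros t) v _ (fun w => (b w).1 \in U /\ Phi (b w) (ratio j t) = Phi (b v) (ratio j t)))
  (cell_ofK GK v st) => // i u iz [uU <-].
case: (unliftP j i) iz => [k ->|->] iz; last by move: (jzero tj); rewrite iz.
have kz : k \in zero_set (ratio j t) by rewrite ratio_zero.
have e : b (G (lift j k) u) = mirror aj U k (b u) by rewrite mirE // bK.
split; first by rewrite Gb /=; exact: U_closed.
by rewrite e glue //; [exact: ratio_nonneg|move: kz; rewrite inE => /eqP].
Qed.

Let star_open : open star.
Proof.
apply/open_XG => v t st [/=]; rewrite coordsK // => tj; rewrite cell_in // => vU.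
have [e e0 He] := ratio_continuous st tj ltr01; exists e => // t' st' /(He _ st')[tj' _].
by split; rewrite /= ?coordsK // cell_in.
Qed.

Let f_open z e : open [set y | star y /\ `|f y - z| < e].
Proof.
apply/open_XG => v t st [/= [+ +]]; rewrite coordsK // => tj; rewrite cell_in // => vU.
rewrite f_point // => h.
have [[L L0 HL] _ _ _ _] := chartPhi.
pose x := (e - `|Phi (b v) (ratio j t) - z|) / (L + 1).
have L1 : 0 < L + 1 by lra.
have x0 : 0 < x by rewrite divr_gt0 // subr_gt0.
have [e' e'0 He'] := ratio_continuous st tj x0; exists e' => // t' st' /(He' _ st')[tj' hr].
split; first by split; rewrite /= ?coordsK // cell_in.
rewrite /= f_point // -(subrK (Phi (b v) (ratio j t)) (Phi (b v) (ratio j t'))) -addrA.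
apply: le_lt_trans (ler_normD _ _) _; rewrite -ltrBrDr.
apply: le_lt_trans (HL _ _ _) _; apply: (@le_lt_trans _ _ ((L + 1) * `|ratio j t' - ratio j t|)).
  by apply: ler_wpM2r => //; lra.
by rewrite mulrC -ltr_pdivlMr.
Qed.

Let f_cont : {within star, continuous f}.
Proof.
rewrite continuous_open_subspace // => y; rewrite inE => sy W /row_nbhsP[e e0 HW].
apply: (filterS (P := [set y' | star y' /\ `|f y' - f y| < e])).
  by move=> y' [_ /HW].
by apply: open_nbhs_nbhs; split; [exact: f_open|split => //; rewrite /= subrr normr0].
Qed.

Let pick_inv z : exists xt : (P * bool) * 'rV[R]_d,
  [/\ xt.1.1 \in U, nonneg xt.2 & Phi xt.1 xt.2 = z].
Proof. by have [_ _ surj _ _] := chartPhi; have [x [t H]] := surj z; exists (x, t). Qed.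

Let inv z := projT1 (cid (pick_inv z)).
Let invP z : [/\ (inv z).1.1 \in U, nonneg (inv z).2 & Phi (inv z).1 (inv z).2 = z].
Proof. by rewrite /inv; case: cid. Qed.

Let g z : X := point_of G (b' (inv z).1) (unratio j (inv z).2).

Let g_star z : star (g z).
Proof.
have [xU nt _] := invP z; have [st tj] := unratio_std j nt.
by split; rewrite /= ?coordsK // cell_in // b'K.
Qed.

Let gK z : f (g z) = z.
Proof.
have [xU nt e] := invP z; have [st tj] := unratio_std j nt.
by rewrite /g f_point // b'K // unratioK.
Qed.

Let fK y : star y -> g (f y) = y.
Proof.
move=> [/= yj yU]; have [xU nt e] := invP (f y); have [_ _ _ inj _] := chartPhi.
set x := (inv (f y)).1 in xU e *; set t := (inv (f y)).2 in nt e *.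
have sy := coords_std y.
have [tE oE] := inj x (b (cell_of y)) t (ratio j (coords y)) xU yU nt (ratio_nonneg j sy) e.
have uE : unratio j t = coords y by rewrite tE ratioK.
rewrite -[RHS]point_of_coords /g -/x -/t.
have [st _] := unratio_std j nt.
apply/(point_of_eq GK _ _ st sy); split=> //.
rewrite -[cell_of y]bK.
suff [] : (b (cell_of y)).1 \in U /\ b' (b (cell_of y)) \in orb gr (zeros (unratio j t)) (b' x) by [].
apply: (@orb_ind _ _ (mirror aj U) (zero_set t) x _ (fun w => w.1 \in U /\ b' w \in orb gr (zeros (unratio j t)) (b' x))) oE; last first.
  by split=> //; exact: orb_refl.
move=> k w kz [wU wo]; rewrite mirE // bK; split; first by rewrite Gb b'K /=; exact: U_closed.
by apply: orb_trans wo _; apply: (orb_step gr); rewrite unratio_zero.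
Qed.

Let K_closed kappa : 0 < kappa -> closed [set y : X | kappa <= coords y ord0 j /\ (b (cell_of y)).1 \in U].
Proof.
move=> k0; rewrite -[X in closed X]setCK; apply: open_closedC; apply/open_XG => v t st /= H.
have coord_near t' e i : `|t' - t| < e -> `|t' ord0 i - t ord0 i| < e.
  by apply: le_lt_trans; apply: le_trans (row_coord_le _ i); rewrite !mxE.
rewrite coordsK // in H; have [tk|tk] := ltP (t ord0 j) kappa.
  exists (kappa - t ord0 j); first by rewrite subr_gt0.
  move=> t' st' /(coord_near _ _ j); rewrite ltr_norml => /andP[_ h] [/=].
  by rewrite coordsK // => h' _; lra.
have tj := lt_le_trans k0 tk; have [e e0 He] := ratio_continuous st tj ltr01; exists e => // t' st' /(He _ st')[tj' _].
by move=> [_]; rewrite cell_in // => vU; apply: H; split=> //; rewrite cell_in.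
Qed.

(* [f] is proper by the norm bound of the chart, hence its inverse is continuous. *)
Let g_cont : continuous g.
Proof.
move=> z0 W; rewrite nbhsE /= => -[W' [oW' W'z] W'W].
have [_ _ _ _ [C C0 HC]] := chartPhi.
pose kappa := (1 + d%:R * (C * (`|z0| + 1)))^-1.
have k0 : 0 < kappa.
  by rewrite invr_gt0; apply: ltr_wpDr; rewrite ?ltr01 // !mulr_ge0 // addr_ge0.
pose K := [set y : X | kappa <= coords y ord0 j /\ (b (cell_of y)).1 \in U].
(* The points of [K] outside [W'] form a compact set whose image is closed and misses [z0]; near
   [z0] the values of [g] lie in [K], hence in [W']. *)
have cK : compact (K `&` ~` W').
  apply: (@subclosed_compact _ _ [set: X]) => //; last exact: XG_compact.
  by apply: closedI; [exact: K_closed|exact: open_closedC].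
have cf : compact (f @` (K `&` ~` W')).
  apply: continuous_compact cK; apply: continuous_subspaceW f_cont => y [[/= h1 h2] _].
  by split=> //; exact: lt_le_trans h1.
have : closed (f @` (K `&` ~` W')) by apply: compact_closed => //; exact: norm_hausdorff.
move=> /closed_openC/(_ z0) oC.
have nz : (~` (f @` (K `&` ~` W'))) z0.
  move=> [y [[h1 h2] Wy] fy]; apply: Wy.
  by rewrite -(fK (y := y)) ?fy //; split=> //; exact: lt_le_trans h1.
have /row_nbhsP[e e0 He] : nbhs z0 (~` (f @` (K `&` ~` W'))).
  by apply: open_nbhs_nbhs; split=> //; exact: closed_openC (compact_closed (@norm_hausdorff _ _) cf).
apply/row_nbhsP; exists (Num.min e 1) => [|z]; first by rewrite lt_min e0 ltr01.
rewrite lt_min => /andP[/He nfz z1]; apply: W'W; apply: contrapT => gW; apply: nfz.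
exists (g z); last exact: gK.
split=> //; have [sj sU] := g_star z; split=> //.
have [xU nt e1] := invP z; have [st _] := unratio_std j nt.
rewrite /g coordsK //; apply: unratio_j_bound => //.
apply: le_trans (HC _ _ xU nt) _; apply: ler_wpM2l => //; rewrite e1.
rewrite -(subrK z0 z) addrC; apply: le_trans (ler_normD _ _) _; lra.
Qed.

Lemma star_chart y : 0 < coords y ord0 j -> (b (cell_of y)).1 \in U ->
  exists (U0 : set X) (V : set 'rV[R]_d) (f0 : X -> 'rV[R]_d) (g0 : 'rV[R]_d -> X),
      open U0 /\ U0 y /\ open V /\
      {within U0, continuous f0} /\ {within V, continuous g0} /\
      (forall y, U0 y -> V (f0 y) /\ g0 (f0 y) = y) /\
      (forall z, V z -> U0 (g0 z) /\ f0 (g0 z) = z).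
Proof.
move=> yj yU; exists star, setT, f, g; split; first exact: star_open.
split; first by [].
split; first exact: openT.
split; first exact: f_cont.
split; first exact: continuous_subspaceT.
by split=> [x /fK //|z _]; split; [exact: g_star|exact: gK].
Qed.

End Star.

Hypothesis degenerate : forall (j : 'I_d.+1) (W : {set P}), W != finset.set0 ->
  exists q i0, q \in W /\ forall i, i != j -> i != i0 -> a i q \notin W \/ a i q = q.

(** Some coordinate [j] of the point is positive. The component of its cell under the other colours
    is connected and leaf-collapsible, so its double fills R^d and gives a chart around the
    point. *)
Lemma double_manifold : is_manifold X d.
Proof.
split; first exact: XG_compact.
split; first exact: XG_hausdorff.
move=> y; have [y0 y1] := coords_std y.
have [j yj] : exists j, 0 < coords y ord0 j.
  apply: contrapT => /forallNP H; move: y1; rewrite big1 => [/esym/eqP|i _]; first by rewrite oner_eq0.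
  by apply/le_anti; rewrite y0 andbT leNgt; apply/negP; exact: H.
pose aj (k : 'I_d) p := a (lift j k) p.
have ajK k : involutive (aj k) by exact: aK.
pose U := orb aj [set: 'I_d]%SET (b (cell_of y)).1.
have Ucl k p : p \in U -> aj k p \in U.
  have kT : k \in [set: 'I_d]%SET by rewrite finset.inE.
  by move=> pU; exact: orb_trans pU (orb_step aj p kT).
have [|||Phi HPhi] := @tree_chart R d' P aj ajK _ U.
- move=> W /(degenerate j)[q [i0 [qW H]]].
  case: (unliftP j i0) H => [k ->|->] H; [exists q, k|exists q, ord0]; split=> // i ik; apply: H.
  + by rewrite eq_sym neq_lift.
  + by rewrite (inj_eq lift_inj).
  + by rewrite eq_sym neq_lift.
  + by rewrite eq_sym neq_lift.
- by apply/finset.set0Pn; exists (b (cell_of y)).1; exact: orb_refl.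
- move=> p q pU qU; have qp : q \in orb aj [set: 'I_d]%SET p.
    by apply: orb_trans qU; rewrite (orb_sym ajK).
  suff [] : q \in U /\ q \in orb (restr aj U) [set: 'I_d]%SET p by [].
  apply: (@orb_ind _ _ aj [set: 'I_d]%SET p q (fun q => q \in U /\ q \in orb (restr aj U) [set: 'I_d]%SET p)) qp; last first.
    by split=> //; exact: orb_refl.
  move=> k w _ [wU wo]; split; first exact: Ucl.
  apply: orb_trans wo _; have := orb_step (restr aj U) w (finset.in_setT k).
  by rewrite /restr wU Ucl.
by apply: (star_chart Ucl HPhi) => //; exact: orb_refl.
Qed.

End DoubleManifold.

Lemma M_card d n :
  M d n = #|[set G : colgraph d n | colourful G && `[< is_manifold (XG G) d >]]%SET|.
Proof.
rewrite /M; apply: eq_card => G; rewrite [RHS]finset.in_set.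
by apply/idP/idP => [/set_mem|h]; last exact/mem_set.
Qed.

(** * Labelled doubles of plugged paths *)

Section Construction.
Local Open Scope nat_scope.
Variables (d' N n : nat).
Local Notation d := d'.+3.
Hypothesis nE : n = N.+1 * 2.
Local Notation P := 'I_N.+1.

Let d_gt2 : 2 < d. Proof. by []. Qed.

Let nT : n = #|{: P * bool}|.
Proof. by rewrite card_prod card_ord card_bool nE. Qed.

Definition std_label (v : 'I_n) : P * bool := enum_val (cast_ord nT v).
Definition std_vertex (x : P * bool) : 'I_n := cast_ord (esym nT) (enum_rank x).

Lemma std_labelK : cancel std_label std_vertex.
Proof. by move=> v; rewrite /std_vertex /std_label enum_valK cast_ordK. Qed.

Lemma std_vertexK : cancel std_vertex std_label.
Proof. by move=> x; rewrite /std_vertex /std_label cast_ordKV enum_rankK. Qed.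

Definition node_nbr (l : seq nat) (i : 'I_d.+1) (x : P) : P := inord (nbr d N l i x).

Section Labelled.
Variables (l : seq nat) (s : {perm 'I_n}).
Hypothesis gl : good_code d N l.

Lemma node_nbrE i x : node_nbr l i x = nbr d N l i x :> nat.
Proof. by rewrite inordK // ltnS (nbr_le d_gt2 gl) // -ltnS. Qed.

Lemma node_nbrK i : involutive (node_nbr l i).
Proof. by move=> x; apply/val_inj; rewrite /= !node_nbrE (nbrK d_gt2 gl) // -ltnS. Qed.

Definition label (v : 'I_n) := std_label (s v).
Definition vertex (x : P * bool) := (s^-1)%g (std_vertex x).

Lemma labelK : cancel label vertex.
Proof. by move=> v; rewrite /vertex /label std_labelK permK. Qed.

Lemma vertexK : cancel vertex label.
Proof. by move=> x; rewrite /vertex /label permKV std_vertexK. Qed.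

Definition step i (v : 'I_n) := vertex (node_nbr l i (label v).1, ~~ (label v).2).

Lemma stepK i : involutive (step i).
Proof. by move=> v; rewrite /step vertexK /= node_nbrK negbK -surjective_pairing labelK. Qed.

Definition plugged_graph : colgraph d n := [ffun i => perm (inv_inj (stepK i))].

Lemma plugged_graphE i v : plugged_graph i v = step i v.
Proof. by rewrite ffunE permE. Qed.

Lemma plugged_graph_label i v :
  label (plugged_graph i v) = (node_nbr l i (label v).1, ~~ (label v).2).
Proof. by rewrite plugged_graphE /step vertexK. Qed.

Lemma plugged_graph_vertex i x e : plugged_graph i (vertex (x, e)) = vertex (node_nbr l i x, ~~ e).
Proof. by rewrite plugged_graphE /step vertexK. Qed.

Lemma plugged_colourful : colourful plugged_graph.
Proof.
apply/andP; split.
  apply/forallP => i; apply/forallP => v; rewrite !plugged_graphE stepK eqxx /=.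
  apply/eqP => e.
  have := congr1 (fun x => (label x).2) e; rewrite /step vertexK /=.
  by case: (label v).2.
apply/existsP; exists [ffun v => (label v).2]; apply/forallP => i; apply/forallP => v.
by rewrite [X in X != _]ffunE [X in _ != X]ffunE plugged_graph_label /=; case: (label v).2.
Qed.

Lemma plugged_manifold : is_manifold (XG plugged_graph) d.
Proof.
apply: (@double_manifold d'.+1 n P (node_nbr l) plugged_graph label vertex node_nbrK
  labelK vertexK plugged_graph_label) => j W /finset.set0Pn[x0 x0W].
have [|x|q [c [/existsP[q0 /andP[q0W /eqP q0E]] cd H]]] :=
    @nbr_degenerate d N d_gt2 l gl j (fun x => [exists y : P, (y \in W) && (y == x :> nat)]) (leq_ord j).
- by exists x0; apply/existsP; exists x0; rewrite x0W /=.
- by move=> /existsP[y /andP[_ /eqP <-]]; rewrite -ltnS.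
exists q0, (inord c); split=> // i ij ic.
have ij' : i != j :> nat by [].
have ic' : i != c :> nat by apply: contraNneq ic => e; apply/eqP/val_inj; rewrite /= inordK.
case: (H i (leq_ord i) ij' ic') => h; [left|right].
  apply: contra h => iW; apply/existsP; exists (node_nbr l i q0).
  by rewrite iW node_nbrE q0E /=.
by apply/val_inj; rewrite /= node_nbrE q0E.
Qed.

End Labelled.

Section Injective.
Variables (l1 l2 : seq nat) (s1 s2 : {perm 'I_n}).
Hypothesis gl1 : good_code d N l1.
Hypothesis gl2 : good_code d N l2.
Hypothesis eG : plugged_graph s1 gl1 = plugged_graph s2 gl2.
Hypothesis eB : vertex s1 (ord0, true) = vertex s2 (ord0, true).

(** Colour 1 fixes node 0 and so joins its two copies, and colour [k %% d] leads from node [k] to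
    the next; hence the graph and one vertex determine all labels. *)
Lemma vertex_determined x e : vertex s1 (x, e) = vertex s2 (x, e).
Proof.
suff H k : k <= N -> forall e, vertex s1 (inord k, e) = vertex s2 (inord k, e).
  by have := H x _ e; rewrite inord_val -ltnS; apply.
have i0 : inord 0 = ord0 :> P by apply/val_inj; rewrite /= inordK.
elim: k => [_|k IH kN] {}e.
  rewrite i0; case: e => //.
  have n0 l (gl : good_code d N l) : node_nbr l (inord 1) ord0 = ord0.
    by apply/val_inj; rewrite /= (node_nbrE gl) inordK.
  have := plugged_graph_vertex s1 gl1 (inord 1) ord0 true.
  by rewrite eG eB plugged_graph_vertex !n0.
have kd : k %% d < d.+1 by rewrite ltnS ltnW // ltn_pmod.
have nk l (gl : good_code d N l) : node_nbr l (Ordinal kd) (inord k) = inord k.+1.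
  apply/val_inj; rewrite /= (node_nbrE gl) /= !inordK // ?ltnS ?(ltnW kN) //.
  by rewrite /nbr ltn_pmod // /path_nbr eqxx kN.
have := plugged_graph_vertex s1 gl1 (Ordinal kd) (inord k) (~~ e).
rewrite eG IH; last exact: ltnW.
by rewrite plugged_graph_vertex !nk // negbK.
Qed.

Lemma perm_determined : s1 = s2.
Proof.
apply: invg_inj; apply/permP => v; have := vertex_determined (std_label v).1 (std_label v).2.
by rewrite -surjective_pairing /vertex std_labelK.
Qed.

Lemma code_determined : size l1 = size l2 -> l1 = l2.
Proof.
move=> sl; apply: (plug_inj d_gt2 gl1 gl2 sl) => x xN.
have h := plugged_graph_vertex s1 gl1 ord_max (inord x) true.
rewrite eG vertex_determined plugged_graph_vertex -vertex_determined in h.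
have := congr1 (label s1) h; rewrite !vertexK => -[/(congr1 val)] /=.
by rewrite (node_nbrE gl1) (node_nbrE gl2) inordK // /nbr /= ltnn.
Qed.

End Injective.

(** A code and a labelling permutation are recovered from the graph and the vertex carrying
    [(ord0, true)], for which there are [n] choices. *)
Lemma lower_count m : d * m.+1 <= N -> (m.+1)`! * n`! <= M d n * n.
Proof.
move=> mN; have gd (k : 'I_(size (codes d m))) : good_code d N (nth [::] (codes d m) k).
  by apply: (codes_good mN); exact: mem_nth.
pose F (x : 'I_(size (codes d m)) * {perm 'I_n}) :=
  (plugged_graph x.2 (gd x.1), vertex x.2 (ord0, true)).
have Finj : injective F.
  move=> [k1 s1] [k2 s2] [/= eG eB]; congr pair; last exact: perm_determined eG eB.
  have sz k : size (nth [::] (codes d m) k) = m \/ size (codes d m) <= k.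
    have [kl|] := ltnP k (size (codes d m)); last by right.
    by left; have [] := codesP (mem_nth [::] kl).
  have el : nth [::] (codes d m) k1 = nth [::] (codes d m) k2.
    apply: (code_determined eG eB).
    case: (sz k1) => [->|]; last by rewrite leqNgt ltn_ord.
    by case: (sz k2) => [->|]; last by rewrite leqNgt ltn_ord.
  have := nth_uniq [::] (ltn_ord k1) (ltn_ord k2) (codes_uniq d m).
  by rewrite el eqxx => /esym/eqP/val_inj.
have := card_imset [set: 'I_(size (codes d m)) * {perm 'I_n}]%SET Finj.
rewrite cardsT card_prod card_ord card_Sn => cF.
apply: (@leq_trans (size (codes d m) * n`!)).
  by rewrite leq_mul2r (size_codes d_gt2) orbT.
rewrite -cF (_ : M d n * n = #|finset.setX
    [set G : colgraph d n | colourful G && `[< is_manifold (XG G) d >]]%SET [set: 'I_n]%SET|); last first.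
  by rewrite M_card cardsX cardsT card_ord.
apply: subset_leq_card.
apply/fintype.subsetP => _ /imsetP[[k s] _ ->]; rewrite !inE andbT /= plugged_colourful /=.
by apply/asboolP; exact: plugged_manifold.
Qed.

End Construction.

(** * The bounds *)

Lemma bin_le_exp n m : ('C(n, m) <= 2 ^ n)%N.
Proof.
elim: n m => [|n IH] [|m]; rewrite ?bin0 ?expn_gt0 // binS expnS mul2n -addnn.
exact: leq_add.
Qed.

(** Both sides are compared with n! C(2n, n), which is a product of n factors larger than n. *)
Lemma expn_le_fact n : (n ^ n <= n`! * 4 ^ n)%N.
Proof.
apply: (@leq_trans ((n + n) ^_ n)); last first.
  by rewrite -bin_ffact mulnC leq_mul2l (_ : 4 ^ n = 2 ^ (n + n))%N ?bin_le_exp ?orbT // addnn -mul2n expnM.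
rewrite ffact_prod -[X in (X <= _)%N](_ : \prod_(i < n) n = n ^ n)%N; last by rewrite prod_nat_const card_ord.
by apply: leq_prod => i _; rewrite -addnBA ?leq_addr // ltnW.
Qed.

Lemma leq_exp2 n : (n <= 2 ^ n)%N.
Proof. exact: ltnW (ltn_expl n (ltnSn 1)). Qed.

(** The factors absorb, in this order, the number of pairs, the polynomial [n.+1 ^ d.+2], the powers
    of 2 and of 32 from the coding, and the 4^n that trades n^n for n!. *)
Definition upper_base d : nat := (d.+1 ^ 2 * 4 ^ d.+2 * 8 * 32 ^ d.+1 * 4)%N.

Lemma upper_base_gt0 d : (0 < upper_base d)%N.
Proof. by rewrite /upper_base; repeat rewrite muln_gt0 ?expn_gt0 /=. Qed.

Lemma expnMn5 a b c e f n : ((a * b * c * e * f) ^ n = a ^ n * b ^ n * c ^ n * e ^ n * f ^ n)%N.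
Proof. by rewrite !expnMn. Qed.

Section FixedDimension.
Variable d' : nat.
Local Notation d := d'.+3.

Lemma upper_count n : (0 < n)%N ->
  (M d n <= d.+1 ^ 2 * n.+1 ^ d.+2 * (2 ^ (3 * n) * 32 ^ (n * d.+1) * n ^ growth_exponent d n))%N.
Proof.
move=> n0; rewrite M_card.
have := @card_euler_graphs 'I_n d [set G : colgraph d n | colourful G && `[< is_manifold (XG G) d >]]%SET.
rewrite card_ord; apply=> // G; rewrite finset.in_set => /andP[cG /asboolP mG].
have [_ _ iG bG] := colourfulP cG; split=> // S Sd.
exact: (manifold_euler cG mG Sd).
Qed.

Lemma upper_count_fact n : (0 < n)%N ->
  (M d n * n ^ n <= n`! * (upper_base d ^ n * n ^ growth_exponent d n))%N.
Proof.
move=> n0; apply: leq_trans (leq_mul (upper_count n0) (expn_le_fact n)) _.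
rewrite /upper_base expnMn5 mulnCA leq_mul2l; apply/orP; right.
have h1 : (d.+1 ^ 2 <= (d.+1 ^ 2) ^ n)%N by rewrite -{1}(expn1 (d.+1 ^ 2)) leq_pexp2l ?expn_gt0.
have h2 : (n.+1 ^ d.+2 <= (4 ^ d.+2) ^ n)%N.
  rewrite -expnM mulnC expnM; elim: d.+2 => // k IH; rewrite !expnS leq_mul //.
  by apply: leq_trans (ltn_expl n (ltnSn 1)) _; rewrite -[4%N]/(2 ^ 2)%N -expnM leq_pexp2l // leq_pmull.
have h3 : (2 ^ (3 * n) = 8 ^ n)%N by rewrite expnM.
have h4 : (32 ^ (n * d.+1) = (32 ^ d.+1) ^ n)%N by rewrite mulnC expnM.
rewrite h3 h4; apply: (@leq_trans ((d.+1 ^ 2) ^ n * (4 ^ d.+2) ^ n * (8 ^ n * (32 ^ d.+1) ^ n * n ^ growth_exponent d n) * 4 ^ n)).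
  by rewrite leq_mul2r leq_mul2r leq_mul ?orbT.
have ac (x y z t u v : nat) : (x * y * (z * t * v) * u = x * y * z * t * u * v)%N by ring.
by rewrite ac.
Qed.

Lemma preceq_upper (e : R) :
  (forall n, (0 < n)%N -> (growth_exponent d n)%:R - n%:R <= e * n%:R) ->
  preceq (fun n => (M d n)%:R / (n`!)%:R) (fun n => n%:R `^ (e * n%:R)).
Proof.
move=> he; have := upper_count_fact; move: (upper_base_gt0 d); move: (upper_base d) => K K0 HK.
exists K%:R; split; first by rewrite ltr0n.
exists 1%N => n n0 _.
have nR : (0 : R) < n%:R by rewrite ltr0n.
have := HK n n0; rewrite -(ler_nat R) !natrM !natrX => h.
rewrite ler_pdivrMr ?ltr0n ?fact_gt0 // -(ler_pM2r (exprn_gt0 n nR)).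
apply: le_trans h _; rewrite mulrC -!mulrA ler_wpM2l ?exprn_ge0 //.
rewrite mulrC [X in _ <= X]mulrCA ler_wpM2l ?ler0n //.
rewrite -!powR_mulrn ?(ltW nR) // -powRD; last by rewrite (gt_eqF nR) implybT.
by apply: ler_powR; [rewrite ler1n|have := he n n0; lra].
Qed.

Lemma preceq_lower :
  preceq (fun n => n%:R `^ (n%:R / (2 * d)%:R)) (fun n => (M d n)%:R / (n`!)%:R).
Proof.
exists (64 * d)%:R; split; first by rewrite ltr0n.
exists (4 * d)%N => n n4d ev.
have n0 : (0 < n)%N by apply: leq_trans n4d.
pose N := (n./2).-1.
have nN : n = (N.+1 * 2)%N.
  have := odd_double_half n; rewrite (negbTE ev) add0n -muln2 => e; rewrite /N prednK //.
  by move: n0; rewrite -{1}e muln_gt0 => /andP[].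
(* With [f.-1] plugs there are already f! codes; [4 * d <= n] makes [f] positive. *)
pose f := (N %/ d)%N.
have f0 : (0 < f)%N by rewrite divn_gt0 //; move: n4d; rewrite nN; lia.
have dN : (d * f.-1.+1 <= N)%N by rewrite prednK // mulnC leq_divM.
have := lower_count nN dN; rewrite prednK // => low.
have nf : (n <= 2 * d * f.+1)%N.
  have := ltn_ceil N (isT : (0 < d)%N); rewrite -/f nN => h.
  by rewrite [X in (X <= _)%N]mulnC -mulnA leq_pmul2l // [X in (_ <= X)%N]mulnC.
(* The exponent [f.+1] is at least n/(2d). The factor 16 d comes from n <= 4 d f and f^f <= 4^f f!,
   and the remaining 4 absorbs n^2 <= 4^n. *)
have key : (n ^ f.+1 * n`! <= (64 * d) ^ n * M d n)%N.
  have h1 : (n ^ f <= (16 * d) ^ n * f`!)%N.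
    have fn : (f <= n)%N.
      by apply: leq_trans (leq_div N d) _; rewrite nN; lia.
    apply: (@leq_trans ((4 * d * f) ^ f)).
      by rewrite leq_exp2r //; apply: leq_trans nf _; nia.
    rewrite expnMn; apply: leq_trans (leq_mul (leqnn _) (expn_le_fact f)) _.
    rewrite mulnCA [X in (_ <= X)%N]mulnC leq_mul2l; apply/orP; right.
    by rewrite -expnMn mulnAC leq_pexp2l // mulnC.
  rewrite expnS; apply: leq_trans (leq_mul (leq_mul (leqnn n) h1) (leqnn _)) _.
  apply: (@leq_trans (n * (16 * d) ^ n * (M d n * n))).
    by rewrite -!mulnA !leq_mul2l low !orbT.
  rewrite (_ : 64 * d = 2 * 2 * (16 * d))%N; last by ring.
  rewrite !expnMn.
  have h2 := leq_exp2 n.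
  rewrite (_ : (n * _ * _ = (n * n) * ((16 ^ n * d ^ n) * M d n))%N); last by ring.
  by rewrite -[X in (_ <= X)%N]mulnA leq_mul // leq_mul.
have nR : (0 : R) < n%:R by rewrite ltr0n.
rewrite mulrA ler_pdivlMr ?ltr0n ?fact_gt0 //.
have keyR : n%:R ^+ f.+1 * (n`!)%:R <= (64 * d)%N%:R ^+ n * (M d n)%:R :> R.
  by rewrite -!natrX -!natrM ler_nat.
apply: le_trans keyR; rewrite ler_wpM2r // -powR_mulrn ?(ltW nR) //; apply: ler_powR; first by rewrite ler1n.
by rewrite ler_pdivrMr ?ltr0n // -natrM ler_nat mulnC.
Qed.

End FixedDimension.

Theorem theorem1 :
  (forall d : nat, (3 <= d)%N -> d <> 4%N ->
     preceq (fun n => n%:R `^ (n%:R / (2 * d)%:R))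
            (fun n => (M d n)%:R / (n`!)%:R) /\
     preceq (fun n => (M d n)%:R / (n`!)%:R)
            (fun n => n%:R `^ ((6^-1 + (d%:R - 3) * (3 / 20)) * n%:R))) /\
  (preceq (fun n => n%:R `^ (n%:R / 8))
          (fun n => (M 4 n)%:R / (n`!)%:R) /\
   preceq (fun n => (M 4 n)%:R / (n`!)%:R)
          (fun n => n%:R `^ (n%:R / 3))).
Proof.
split=> [[|[|[|d']]] // _ /eqP d4|].
  split; first exact: preceq_lower.
  apply: preceq_upper => n n0; rewrite /growth_exponent (negbTE d4).
  have := leq_divM ((9 * d'.+3 + 43) * n) 60; rewrite -(ler_nat R) !natrM natrD natrM.
  by move: (_ %/ 60)%N => q; lra.
(* The section is written for dimension d' + 3, so the argument 1 means dimension 4. *)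
split; first exact: (preceq_lower 1).
have := @preceq_upper 1 3^-1; rewrite (_ : (fun n => n%:R `^ (3^-1 * n%:R)) = (fun n : nat => n%:R `^ (n%:R / 3) : R)).
  apply=> n n0; rewrite /growth_exponent eqxx.
  have := leq_divM (4 * n) 3; rewrite -(ler_nat R) !natrM.
  by move: (_ %/ 3)%N => q; lra.
by apply/funext => n; rewrite mulrC.
Qed.
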